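(* Let $\mathbb{K}\in\{\mathbb{R},\mathbb{C}\}$, $d,m,n\ge1$ with $(m,n)\ne(1,1)$ and $d(\mathbb{K})mn\ge3$. Then the stabilization map $s^{d,m}_{n,\mathbb{K}}:\mathrm{Q}^{d,m}_n(\mathbb{K})\to\mathrm{Q}^{d+1,m}_n(\mathbb{K})$ is a homology equivalence if $\lfloor d/n\rfloor=\lfloor (d+1)/n\rfloor$, and it is a homology equivalence through dimension $D(d;m,n,\mathbb{K})=(d(\mathbb{K})mn-2)(\lfloor d/n\rfloor+1)-1$ if $\lfloor d/n\rfloor<\lfloor(d+1)/n\rfloor$.
   Context: $d(\mathbb{K})=\dim_\mathbb{R}\mathbb{K}$. $\mathrm{Q}^{d,m}_n(\mathbb{K})$ is the space of $m$-tuples of monic degree-$d$ polynomials over $\mathbb{K}$ with no common real root of multiplicity $\ge n$. The stabilization map $s^{d,m}_{n,\mathbb{K}}$ (well defined up to homotopy) adds one root ''from infinity'' to each polynomial: it multiplies each $f_i$ by a linear factor $(z-x_i)$, where $x_1,\dots,x_m$ are distinct real numbers larger than the moduli of all roots of all $f_j$; it extends to an open embedding of discriminants $\Sigma^{d,m}_{n,\mathbb{K}}\times\mathbb{K}^m\to\Sigma^{d+1,m}_{n,\mathbb{K}}$. A map is a homology equivalence (through dimension $N$) if it induces isomorphisms on $H_k(-;\mathbb{Z})$ for all $k$ (for all $k\le N$). *)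

(* Defs.v *)
From HB Require Import structures.
From mathcomp Require Import all_boot all_order all_algebra.
From mathcomp Require Import all_classical all_reals all_analysis.
From mathcomp Require Import complex.
From Stdlib Require List.
Import Order.TTheory GRing.Theory Num.Theory.
Import numFieldNormedType.Exports.

Set Implicit Arguments.
Unset Strict Implicit.
Unset Printing Implicit Defensive.

Local Open Scope ring_scope.
Local Open Scope classical_set_scope.

(* The complex numbers over a real field R, as a numFieldType
   (so that 'M[CC R]_(m, d) gets its canonical (norm) topology). *)
Definition CC (R : realType) : numFieldType := R[i].

Section SingularHomology.
Variable R : realType.

Definition stdsimplex (k : nat) : set 'rV[R]_(k.+1) :=
  [set t | (forall i, 0 <= t ord0 i) /\ \sum_(i < k.+1) t ord0 i = 1].
Arguments stdsimplex k : clear implicits.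

Definition coface (k : nat) (i : 'I_k.+2) (t : 'rV[R]_(k.+1)) : 'rV[R]_(k.+2) :=
  \row_j (if unlift i j is Some j' then t ord0 j' else 0).

Variable T : topologicalType.

(* a (raw) singular k-simplex: its values outside Delta^k are irrelevant *)
Definition sing_simplex (k : nat) := 'rV[R]_(k.+1) -> T.

Definition is_sing (A : set T) (k : nat) (s : sing_simplex k) : Prop :=
  {within (stdsimplex k), continuous (s : _ -> T)} /\ (s @` (stdsimplex k)) `<=` A.

Definition simplex_eq (k : nat) (s s' : sing_simplex k) : Prop :=
  forall t, stdsimplex k t -> s t = s' t.

(* integral k-chains, as formal finite sums  sum_p p.1 * p.2  *)
Definition chain (k : nat) := seq (int * sing_simplex k).

Definition chain_in (A : set T) (k : nat) (c : chain k) : Prop :=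
  forall p, List.In p c -> is_sing A p.2.

Definition coef (k : nat) (c : chain k) (s : sing_simplex k) : int :=
  \sum_(p <- c) (if `[< simplex_eq p.2 s >] then p.1 else 0).

Definition bd (k : nat) (c : chain k.+1) : chain k :=
  flatten [seq [seq (((-1) ^+ i * p.1)%R, p.2 \o coface i) | i : 'I_k.+2 <- enum 'I_k.+2]
          | p <- c].

Definition chain_sub (k : nat) (c c' : chain k) : chain k :=
  c ++ [seq (- p.1, p.2) | p <- c'].

Definition is_cycle (k : nat) : chain k -> Prop :=
  match k return chain k -> Prop with
  | 0 => fun _ => True
  | k'.+1 => fun c => forall s, coef (bd c) s = 0
  end.

Definition is_boundary (A : set T) (k : nat) (c : chain k) : Prop :=
  exists b : chain k.+1, chain_in A b /\ forall s, coef (bd b) s = coef c s.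

Definition homologous (A : set T) (k : nat) (c c' : chain k) : Prop :=
  is_boundary A (chain_sub c c').

End SingularHomology.

Section InducedMap.
Variables (R : realType) (T U : topologicalType).

Definition push (f : T -> U) (k : nat) (c : chain R T k) : chain R U k :=
  [seq (p.1, f \o p.2) | p <- c].

(* f : A -> B induces an isomorphism H_k(A; Z) -> H_k(B; Z):
   it is injective (a cycle whose image bounds, bounds) and surjective
   (every cycle of B is homologous to the image of a cycle of A). *)
Definition homology_iso (A : set T) (B : set U) (f : T -> U) (k : nat) : Prop :=
  (forall z : chain R T k, chain_in A z -> is_cycle z ->
     is_boundary B (push f z) -> is_boundary A z) /\
  (forall z' : chain R U k, chain_in B z' -> is_cycle z' ->
     exists z : chain R T k, [/\ chain_in A z, is_cycle z &
                                 homologous B (push f z) z']).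

Definition homology_equivalence (A : set T) (B : set U) (f : T -> U) : Prop :=
  forall k, homology_iso A B f k.

Definition homology_equivalence_through (A : set T) (B : set U) (f : T -> U)
  (N : nat) : Prop :=
  forall k, (k <= N)%N -> homology_iso A B f k.

End InducedMap.

(* Spaces of polynomials.  A point M of 'M[K]_(m, d) encodes the      *)
(* m-tuple of monic degree-d polynomials f_i = X^d + sum_j M i j X^j. *)
Section Polys.
Variable K : numFieldType.

Definition rowpoly (m d : nat) (M : 'M[K]_(m, d)) (i : 'I_m) : {poly K} :=
  'X^d + \sum_(j < d) (M i j)%:P * 'X^j.

Definition Qspace (d m n : nat) : set 'M[K]_(m, d) :=
  [set M | ~ exists x : K, x \is Num.real /\
               forall i : 'I_m, (('X - x%:P) ^+ n %| rowpoly M i)%R].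

(* a (continuous) bound strictly exceeding the moduli of all roots of all f_j
   (Cauchy bound) *)
Definition rootbound (m d : nat) (M : 'M[K]_(m, d)) : K :=
  1 + \sum_(i < m) \sum_(j < d) `|M i j|.

Definition stab (m d : nat) (M : 'M[K]_(m, d)) : 'M[K]_(m, d.+1) :=
  \matrix_(i < m, j < d.+1)
    ((rowpoly M i * ('X - (rootbound M + (i : nat)%:R)%:P))`_j).

End Polys.

Arguments Qspace K d m n : clear implicits.
Arguments stab K m d M : clear implicits.

(* Main.v *)
(* Let N = d(K)mn and let U_k be the space of degree-d tuples with at most k
   common n-fold real roots, counted with multiplicity: U_0 = Q and U_k is
   everything for k large. Translating all roots to the left, or to the right,
   shows that U_{k+1} has the homology of the open subset G- where fewer than k+1
   of these roots are nonnegative, and of the open subset G+ where either there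
   are at most k of them or all are positive. Now G- n G+ = U_k, while the
   complement of G- u G+ in U_{k+1} consists of the tuples X^n h, where h has
   degree d-n and exactly k of these roots, all nonnegative. Mayer-Vietoris and
   the Thom isomorphism of the slice {X^n | f}, of real codimension N, give
   H(U_{k+1}, U_k) = 0 for k >= 1, so that U_1 is acyclic, and
   H_j(U_1, Q^d) ~ H_{j+1-N}(Q^{d-n}). The latter is natural for stab, which
   commutes with multiplication by X^n. By the five lemma, stab on Q^d is an
   isomorphism in degree i as soon as stab on Q^{d-n} is one in the degrees i+1-N
   and i+2-N, and one concludes by induction on d in steps of n. *)
Require Import Defs.
From mathcomp Require Import freeg.
From HB Require Import structures.
From mathcomp Require Import all_boot all_order all_algebra.
From mathcomp Require Import all_classical all_reals all_analysis.
From mathcomp Require Import complex ring lra zify.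
Import Order.TTheory GRing.Theory Num.Theory.
Import numFieldNormedType.Exports.
Set Implicit Arguments.
Unset Strict Implicit.
Unset Printing Implicit Defensive.
Local Open Scope ring_scope.
Local Open Scope classical_set_scope.

(** The bound obeys D(d) = D(d-n) + N - 2: in degree i the five lemma looks at degree i+1 of the
    pair (U_1, Q), which the connecting map raises by one and the slice lowers by N. The start is d
    = n-1, where Q^d is the whole matrix space while Q^n is affine N-space minus a properly embedded
    line, whose first new class sits in degree N-2, one above D. For d+1 < n both spaces are affine.

    Naturality is checked on chains. Homology is therefore kept as cycles and boundaries, and
    isomorphisms that are not induced by a map of chains, such as connecting maps, are
    correspondences. Likewise the Thom isomorphism does not come from a normal bundle: it is a
    composite of N connecting maps, one for each real coordinate transverse to the slice, each
    comparing the two half-spaces of that coordinate. A map respects this as soon as it is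
    triangular in these coordinates. Since [stab] multiplies the lowest nonzero coefficients by
    negative numbers, it exchanges the half-spaces, and relabelling them absorbs the sign. *)

(** * Free abelian groups and spans of generators *)

Section FreeAbelian.
Variables (X : choiceType) (M : lmodType int).
Implicit Types (f : X -> M) (z : {freeg X / int}).

Definition ext f z : M := fglift f z.

Lemma ext_is_linear f : linear (ext f).
Proof.
have extB : {morph ext f : x y / x - y} by exact: lift_is_additive.
have ext0 : ext f 0 = 0 by rewrite -(subrr 0) extB subrr.
have extN : {morph ext f : x / - x} by move=> x; rewrite -[- x]sub0r extB ext0 sub0r.
have extD : {morph ext f : x y / x + y}.
  by move=> x y; rewrite -[y in LHS]opprK extB extN opprK.
pose A := GRing.isZmodMorphism.Build _ _ (ext f) extB.
pose g : {additive {freeg X / int} -> M} := HB.pack (ext f) A.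
move=> k x y; rewrite extD; congr (_ + _).
by rewrite -[k]intz !scaler_int -[ext f]/(g : _ -> _) raddfMz.
Qed.

HB.instance Definition _ f :=
  GRing.isLinear.Build int {freeg X / int} M *:%R (ext f) (ext_is_linear f).

Lemma ext_gen f x : ext f << x >> = f x.
Proof. by rewrite /ext liftU scale1r. Qed.

Lemma genZ (k : int) (x : X) : << k *g x >> = k *: << x >> :> {freeg X / int}.
Proof.
by apply/eqP/freeg_eqP => y; rewrite coeffZ !coeffU mul1r.
Qed.

Lemma ext_sum f z : ext f z = \sum_(x <- dom z) coeff x z *: f x.
Proof.
rewrite -{1}[z]freeg_sumE linear_sum; apply: eq_bigr => x _ /=.
by rewrite genZ linearZ /= ext_gen.
Qed.

End FreeAbelian.

Section Span.
Variable X : choiceType.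
Implicit Types (P Q : X -> Prop) (z : {freeg X / int}).

(** Described by supports, so that a chain lying in two spans lies in the span of the common
    generators ([gspanI]). This makes chains in two sets chains in the intersection. *)
Definition gspan P : set {freeg X / int} := [set z | forall x, x \in dom z -> P x].

Lemma gspan0 P : gspan P 0.
Proof. by move=> x; rewrite dom0. Qed.

Lemma gspanB P z z' : gspan P z -> gspan P z' -> gspan P (z - z').
Proof.
by move=> h h' x /domB; rewrite mem_cat => /orP [/h|/h'].
Qed.

Lemma gspanN P z : gspan P z -> gspan P (- z).
Proof. by move=> h; rewrite -sub0r; apply: gspanB => //; exact: gspan0. Qed.

Lemma gspanD P z z' : gspan P z -> gspan P z' -> gspan P (z + z').
Proof. by move=> h h'; rewrite -[z']opprK; apply: gspanB => //; exact: gspanN. Qed.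

Lemma gspanZ P (k : int) z : gspan P z -> gspan P (k *: z).
Proof. by move=> h x /domZ_subset /h. Qed.

Lemma gspan_sum P I (r : seq I) (F : I -> {freeg X / int}) :
  (forall i, gspan P (F i)) -> gspan P (\sum_(i <- r) F i).
Proof. by move=> h; elim/big_ind: _ => //; [exact: gspan0 | exact: gspanD]. Qed.

Lemma gspan_sum_seq P (I : eqType) (r : seq I) (F : I -> {freeg X / int}) :
  (forall i, i \in r -> gspan P (F i)) -> gspan P (\sum_(i <- r) F i).
Proof.
move=> h; rewrite big_seq; elim/big_ind: _ => //; [exact: gspan0 | exact: gspanD].
Qed.

Lemma gspan_gen P x : P x -> gspan P << x >>.
Proof. by move=> Px y; rewrite domU1 inE => /eqP ->. Qed.

Lemma sub_gspan P Q z : (forall x, P x -> Q x) -> gspan P z -> gspan Q z.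
Proof. by move=> h h' x /h' /h. Qed.

Lemma gspanI P Q z : gspan P z -> gspan Q z -> gspan (fun x => P x /\ Q x) z.
Proof. by move=> h h' x hx; split; [exact: h | exact: h']. Qed.

Lemma gspanF z : gspan (fun _ => False) z -> z = 0.
Proof.
move=> h; rewrite -[z]freeg_sumE big_seq big1 // => x /h [].
Qed.

Lemma gspan_split P Q z : (forall x, x \in dom z -> P x \/ Q x) ->
  exists y y', [/\ gspan P y, gspan Q y' & z = y + y'].
Proof.
move=> h; rewrite -[z]freeg_sumE big_seq.
elim/big_ind: _ => [|z1 z2 [y1 [y1' [p1 q1 ->]]] [y2 [y2' [p2 q2 ->]]]|x /h [Px|Qx]].
- by exists 0, 0; rewrite addr0; split=> //; exact: gspan0.
- by exists (y1 + y2), (y1' + y2'); split; [exact: gspanD | exact: gspanD | rewrite addrACA].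
- exists << coeff x z *g x >>, 0; rewrite addr0 genZ.
  by split; [exact: gspanZ (gspan_gen Px) | exact: gspan0 | ].
- exists 0, << coeff x z *g x >>; rewrite add0r genZ.
  by split; [exact: gspan0 | exact: gspanZ (gspan_gen Qx) | ].
Qed.

End Span.

Lemma gspan_ext (X Y : choiceType) (P : X -> Prop) (Q : Y -> Prop)
    (f : X -> {freeg Y / int}) z :
  (forall x, P x -> gspan Q (f x)) -> gspan P z -> gspan Q (ext f z).
Proof.
move=> fPQ Pz; rewrite ext_sum; apply: gspan_sum_seq => x /Pz Px.
by apply: gspanZ; exact: fPQ.
Qed.

Lemma eq_ext_gspan (X : choiceType) (M : lmodType int) (P : X -> Prop)
    (f g : {linear {freeg X / int} -> M}) z :
  (forall x, P x -> f << x >> = g << x >>) -> gspan P z -> f z = g z.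
Proof.
move=> fg Pz; rewrite -[z]freeg_sumE !linear_sum /= !big_seq.
by apply: eq_bigr => x /Pz Px; rewrite genZ !linearZ /= fg.
Qed.

Lemma eq_ext (X : choiceType) (M : lmodType int)
    (f g : {linear {freeg X / int} -> M}) :
  (forall x, f << x >> = g << x >>) -> f =1 g.
Proof. by move=> fg z; apply: (@eq_ext_gspan _ _ (fun _ => True)) => // x _; exact: fg. Qed.

(** * Continuity of maps into fields and matrix spaces *)

Section Continuity.
Context {T : topologicalType} {K : numFieldType}.
Implicit Types (f g : T -> K).

Lemma cts_cst {U : topologicalType} (c : U) : continuous (fun _ : T => c).
Proof. by move=> x; exact: cvg_cst. Qed.

Lemma ctsD f g : continuous f -> continuous g -> continuous (fun x => f x + g x).
Proof. by move=> hf hg x; apply: cvgD; [exact: hf | exact: hg]. Qed.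

Lemma ctsN f : continuous f -> continuous (fun x => - f x).
Proof. by move=> hf x; apply: cvgN; exact: hf. Qed.

Lemma ctsB f g : continuous f -> continuous g -> continuous (fun x => f x - g x).
Proof. by move=> hf hg; apply: ctsD => //; exact: ctsN. Qed.

Lemma ctsM f g : continuous f -> continuous g -> continuous (fun x => f x * g x).
Proof. by move=> hf hg x; apply: cvgM; [exact: hf | exact: hg]. Qed.

Lemma ctsV f : (forall x, f x != 0) -> continuous f -> continuous (fun x => (f x)^-1).
Proof. by move=> f0 hf x; apply: cvgV; [exact: f0 | exact: hf]. Qed.

Lemma cts_sum I (r : seq I) (P : pred I) (F : I -> T -> K) :
  (forall i, P i -> continuous (F i)) ->
  continuous (fun x => \sum_(i <- r | P i) F i x).
Proof.
move=> hF; elim: r => [|i r IH].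
  by rewrite (_ : (fun _ => _) = fun=> 0); [exact: cts_cst | apply: funext => x; rewrite big_nil].
rewrite (_ : (fun _ => _) = fun x => if P i then F i x + \sum_(j <- r | P j) F j x else \sum_(j <- r | P j) F j x); last by apply: funext => x; rewrite big_cons.
by case Pi: (P i) => //; apply: ctsD => //; exact: hF.
Qed.

Lemma cts_comp {U V : topologicalType} (f : U -> V) (g : T -> U) :
  continuous f -> continuous g -> continuous (fun x => f (g x)).
Proof. by move=> hf hg x; apply: continuous_comp; [exact: hg | exact: hf]. Qed.

Lemma cts_entry m n (F : T -> 'M[K]_(m, n)) i j :
  continuous F -> continuous (fun x => F x i j).
Proof. by move=> hF; apply: (cts_comp (f := fun M : 'M[K]_(m, n) => M i j)) => //; exact: coord_continuous. Qed.

Lemma cts_mx m n (F : T -> 'M[K]_(m, n)) :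
  (forall i j, continuous (fun x => F x i j)) -> continuous F.
Proof.
move=> hF x A [P hP sPA].
rewrite nbhs_filterE /=.
have : \forall y \near x, forall i j, P i j (F y i j).
  apply: filter_forall => i; apply: filter_forall => j.
  exact: (hF i j x _ (hP i j)).
by apply: filterS => y hy; exact: sPA.
Qed.

Lemma cts_pair {U V : topologicalType} (f : T -> U) (g : T -> V) :
  continuous f -> continuous g -> continuous (fun x => (f x, g x)).
Proof. by move=> hf hg x; apply: cvg_pair; [exact: hf | exact: hg]. Qed.

End Continuity.

Lemma cts_open {T U : topologicalType} (f : T -> U) (D : set U) :
  continuous f -> open D -> open (f @^-1` D).
Proof. by move=> cf; apply: open_comp => x _; exact: cf. Qed.

Lemma cts_closed {T U : topologicalType} (f : T -> U) (D : set U) :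
  continuous f -> closed D -> closed (f @^-1` D).
Proof. by move=> cf; apply: preimage_closed => x _; exact: cf. Qed.

Lemma cts_max {R : realType} {T : topologicalType} (f g : T -> R) :
  continuous f -> continuous g -> continuous (fun x => Num.max (f x) (g x)).
Proof. by move=> hf hg x; apply: continuous_max; [exact: hf | exact: hg]. Qed.

Lemma cts_id {T : topologicalType} : continuous (fun x : T => x).
Proof. by move=> x; exact: cvg_id. Qed.

Lemma cts_fst {T U : topologicalType} : continuous (fun x : T * U => x.1).
Proof. by move=> x; exact: cvg_fst. Qed.

Lemma cts_snd {T U : topologicalType} : continuous (fun x : T * U => x.2).
Proof. by move=> x; exact: cvg_snd. Qed.

(** * A retraction onto the standard simplex *)

Section Retraction.
Variables (R : realType) (k : nat).
Implicit Types t : 'rV[R]_k.+1.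

Definition posmass t : R := \sum_i Num.max 0 (t ord0 i).

(* A retraction of the ambient space onto the standard simplex, so that every
   singular simplex is the restriction of a globally continuous map. *)
Definition retr t : 'rV[R]_k.+1 :=
  \row_i ((Num.max 0 (t ord0 i) + (i == ord0)%:R * Num.max 0 (1 - posmass t))
          / Num.max 1 (posmass t)).

Lemma posmass_simplex t : stdsimplex t -> posmass t = 1.
Proof. by move=> [t0 <-]; apply: eq_bigr => i _; rewrite max_r. Qed.

(** A total positive mass below 1 is completed at vertex 0, one above 1 is rescaled. In both cases
    the numerators add up to [Num.max 1 (posmass t)], which never vanishes. *)
Lemma retr_simplex t : stdsimplex (retr t).
Proof.
have p1 : 0 < Num.max 1 (posmass t) by rewrite lt_max ltr01.
split=> [i|].
  rewrite mxE divr_ge0 ?(ltW p1)// addr_ge0 ?mulr_ge0 ?ler0n ?le_max ?lexx //.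
under eq_bigr do rewrite mxE; rewrite -mulr_suml big_split /= -/(posmass t).
rewrite (bigD1 ord0) //= mul1r big1 ?addr0; last first.
  by move=> i /negPf ->; rewrite mul0r.
have -> : posmass t + Num.max 0 (1 - posmass t) = Num.max 1 (posmass t).
  case: (leP 1 (posmass t)) => h.
    by rewrite max_l ?addr0 // subr_le0.
  by rewrite max_r ?subr_ge0 ?ltW // addrC subrK.
by rewrite divff // gt_eqF.
Qed.

Lemma retr_id t : stdsimplex t -> retr t = t.
Proof.
move=> ht; apply/rowP => i; rewrite mxE (posmass_simplex ht) subrr !maxxx.
by rewrite mulr0 addr0 divr1 max_r //; case: ht.
Qed.

Lemma retr_cts : continuous retr.
Proof.
have ce i : continuous (fun t : 'rV[R]_k.+1 => t ord0 i) by exact: coord_continuous.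
have cm i : continuous (fun t => Num.max 0 (t ord0 i)).
  by apply: cts_max => //; exact: cts_cst.
have cp : continuous posmass by apply: cts_sum => i _; exact: cm.
apply: cts_mx => i j; under eq_fun do rewrite mxE.
apply: ctsM.
  apply: ctsD => //; apply: ctsM; first exact: cts_cst.
  by apply: cts_max; [exact: cts_cst | apply: ctsB => //; exact: cts_cst].
apply: ctsV; last by apply: cts_max => //; exact: cts_cst.
by move=> t; rewrite gt_eqF // lt_max ltr01.
Qed.

End Retraction.

(** * Affine chains *)

Section AffineChains.
Variable R : realType.
Implicit Types (q l k : nat).

(* The matrix V stands for the affine simplex t |-> t *m V. *)
Definition aff q l := {freeg 'M[R]_(l.+1, q) / int}.

Definition face q l (V : 'M[R]_(l.+2, q)) : aff q l :=
  \sum_(i < l.+2) (-1) ^+ i *: << (row' i V : 'M[R]_(l.+1, q)) >>.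

Definition abd q l : aff q l.+1 -> aff q l := ext (@face q l).
HB.instance Definition _ q l := GRing.Linear.on (@abd q l).

Definition amul q q' l (L : 'M[R]_(q, q')) : aff q l -> aff q' l :=
  ext (fun V => << V *m L >>).
HB.instance Definition _ q q' l (L : 'M[R]_(q, q')) := GRing.Linear.on (@amul q q' l L).

Definition cone q l (b : 'rV[R]_q) : aff q l -> aff q l.+1 :=
  ext (fun V => << (col_mx b V : 'M[R]_(l.+2, q)) >>).
HB.instance Definition _ q l (b : 'rV[R]_q) := GRing.Linear.on (@cone q l b).

Lemma abd_gen q l (V : 'M[R]_(l.+2, q)) : abd << V >> = face V.
Proof. exact: ext_gen. Qed.

Lemma amul_gen q q' l (L : 'M[R]_(q, q')) (V : 'M[R]_(l.+1, q)) :
  amul L << V >> = << V *m L >>.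
Proof. exact: ext_gen. Qed.

Lemma cone_gen q l (b : 'rV[R]_q) (V : 'M[R]_(l.+1, q)) :
  cone b << V >> = << (col_mx b V : 'M[R]_(l.+2, q)) >>.
Proof. exact: ext_gen. Qed.

Lemma col_mx_ord0 q l (b : 'rV[R]_q) (V : 'M[R]_(l, q)) j :
  (col_mx b V : 'M[R]_(l.+1, q)) ord0 j = b ord0 j.
Proof.
by rewrite -(col_mxEu b V ord0 j); congr (col_mx b V _ _); apply: val_inj.
Qed.

Lemma col_mx_lift q l (b : 'rV[R]_q) (V : 'M[R]_(l, q)) (i : 'I_l) j :
  (col_mx b V : 'M[R]_(l.+1, q)) (lift ord0 i) j = V i j.
Proof.
by rewrite -(col_mxEd b V i j); congr (col_mx b V _ _); apply: val_inj.
Qed.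

Lemma row'E q l (V : 'M[R]_(l.+1, q)) i (x : 'I_l) j : row' i V x j = V (lift i x) j.
Proof. by rewrite mxE. Qed.

Lemma row'0_cone q l (b : 'rV[R]_q) (V : 'M[R]_(l.+1, q)) :
  row' ord0 (col_mx b V : 'M[R]_(l.+2, q)) = V.
Proof. by apply/matrixP => i j; rewrite row'E col_mx_lift. Qed.

Lemma row'S_cone q l (b : 'rV[R]_q) (V : 'M[R]_(l.+2, q)) (i : 'I_l.+2) :
  row' (lift ord0 i) (col_mx b V : 'M[R]_(l.+3, q)) =
  (col_mx b (row' i V) : 'M[R]_(l.+2, q)).
Proof.
apply/matrixP => k j; rewrite row'E.
have [k'|] := unliftP ord0 k.
  move=> ->; rewrite col_mx_lift row'E -(col_mx_lift b V); congr (col_mx b V _ _).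
  by apply: val_inj; rewrite /= /bump !leq0n !add1n ltnS addnS.
move=> ->; rewrite col_mx_ord0 -(col_mx_ord0 b V); congr (col_mx b V _ _).
exact: val_inj.
Qed.

Lemma abd_cone q l (b : 'rV[R]_q) (u : aff q l.+1) :
  abd (cone b u) = u - cone b (abd u).
Proof.
pose f := @abd q l.+1 \o @cone q l.+1 b.
pose g := (@idfun (aff q l.+1)) \- (@cone q l b \o @abd q l).
rewrite -[LHS]/(f u) -[RHS]/(g u); apply: eq_ext => V.
rewrite /f /g /= /GRing.sub_fun /= cone_gen !abd_gen {1}/face big_ord_recl /=.
rewrite expr0 scale1r row'0_cone; congr (_ + _).
rewrite linear_sum /= -sumrN; apply: eq_bigr => i _.
by rewrite linearZ /= cone_gen row'S_cone /bump /= add1n exprS mulN1r scaleNr.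
Qed.

(** In degree 0 the correction term is an augmentation: each point of [u] leaves behind one copy of
    the apex. *)
Lemma abd_cone0 q (b : 'rV[R]_q) (u : aff q 0) :
  abd (cone b u) = u - ext (fun _ => << b >>) u.
Proof.
pose f := @abd q 0 \o @cone q 0 b.
pose g := (@idfun (aff q 0)) \- (ext (fun _ => << b >>) : aff q 0 -> aff q 0).
rewrite -[LHS]/(f u) -[RHS]/(g u); apply: eq_ext => V.
rewrite /f /g /= /GRing.sub_fun /= cone_gen abd_gen ext_gen /face.
rewrite !big_ord_recl big_ord0 addr0.
rewrite expr0 scale1r row'0_cone; congr (_ + _).
rewrite expr1 scaleN1r; congr (- << _ >>).
by apply/rowP => j; rewrite row'E -(col_mx_ord0 b V); congr (col_mx b V _ _); apply: val_inj.
Qed.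

Lemma row'_mul q q' l (V : 'M[R]_(l.+1, q)) (L : 'M[R]_(q, q')) i :
  row' i (V *m L) = row' i V *m L.
Proof. by apply/matrixP => a b; rewrite !mxE; apply: eq_bigr => c _; rewrite !mxE. Qed.

Lemma amul_face q q' l (L : 'M[R]_(q, q')) (V : 'M[R]_(l.+2, q)) :
  amul L (face V) = face (V *m L).
Proof.
rewrite linear_sum; apply: eq_bigr => i _; rewrite linearZ /= amul_gen.
by rewrite row'_mul.
Qed.

Lemma amul_cone q q' l (L : 'M[R]_(q, q')) b (u : aff q l) :
  amul L (cone b u) = cone (b *m L) (amul L u).
Proof.
pose f := @amul q q' l.+1 L \o @cone q l b.
pose g := @cone q' l (b *m L) \o @amul q q' l L.
rewrite -[LHS]/(f u) -[RHS]/(g u); apply: eq_ext => V.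
rewrite /f /g /= cone_gen !amul_gen cone_gen; congr (<< _ >>); exact: (mul_col_mx b V L).
Qed.

Lemma abd_abd q l (u : aff q l.+2) : abd (abd u) = 0.
Proof.
pose f := @abd q l \o @abd q l.+1.
rewrite -[LHS]/(f u) -[RHS]/((\0 : aff q l.+2 -> aff q l) u); apply: eq_ext => V.
rewrite /f /= abd_gen /face linear_sum /=.
pose F (p : 'I_l.+3 * 'I_l.+2) : aff q l :=
  (-1) ^+ (p.1 + p.2) *: << row' p.2 (row' p.1 V : 'M[R]_(l.+2, q)) >>.
transitivity (\sum_(i < l.+3) \sum_(j < l.+2) F (i, j)).
  apply: eq_bigr => i _; rewrite linearZ /= abd_gen /face scaler_sumr.
  by apply: eq_bigr => j _; rewrite scalerA -exprD.
rewrite pair_big /= (bigID (fun p : 'I_l.+3 * 'I_l.+2 => (p.2 < p.1)%N)) /= addrC.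
(* Deleting vertex i and then j < i is the same as deleting j and then i - 1. The bijection (i, j)
   -> (j, i - 1) cancels the terms in pairs. *)
pose h (p : 'I_l.+3 * 'I_l.+2) : 'I_l.+3 * 'I_l.+2 := (inord p.2, inord p.1.-1).
pose h' (p : 'I_l.+3 * 'I_l.+2) : 'I_l.+3 * 'I_l.+2 := (inord p.2.+1, inord p.1).
rewrite (reindex_onto h h') /=; last first.
  move=> [i j] /=; rewrite -leqNgt => ij; rewrite /h /h' /=.
  have il : (i < l.+2)%N by apply: leq_ltn_trans ij _.
  have jl : (j.+1 < l.+3)%N by rewrite ltnS.
  congr pair; apply: val_inj; rewrite /= ?(inordK il) ?(inordK jl) inordK //.
rewrite [X in X + _](eq_bigl (fun p : 'I_l.+3 * 'I_l.+2 => (p.2 < p.1)%N)); last first.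
  move=> [i j]; rewrite /h /h' /=.
  have jl : (j < l.+3)%N by rewrite ltnS ltnW.
  have il : (i.-1 < l.+2)%N by case: (i : nat) (ltn_ord i).
  rewrite !inordK //.
  apply/idP/idP.
    move=> /andP [h1 /eqP [/(congr1 val) /= e1 _]]; move: h1 e1.
    rewrite -leqNgt inordK; last by rewrite ltnS.
    by case: (i : nat) => [|i'] //=; rewrite ltnS.
  move=> ji; have i0 : (0 < i)%N by apply: leq_ltn_trans ji.
  rewrite -leqNgt -ltnS prednK // ji /=; apply/eqP; congr pair.
    by apply: val_inj; rewrite /= inordK.
  by apply: val_inj; rewrite /= inordK.
rewrite -big_split big1 //= => -[i j] /= ji.
have jl : (j < l.+3)%N by rewrite ltnS ltnW.
have i0 : (0 < i)%N by apply: leq_ltn_trans ji.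
have il : (i.-1 < l.+2)%N by rewrite prednK // -ltnS.
rewrite /F /h /= !inordK //.
rewrite (_ : row' (inord i.-1) _ = row' j (row' i V : 'M[R]_(l.+2, q)) :> 'M[R]_(l.+1, q)).
  have -> : (i + j)%N = (j + i.-1).+1 by rewrite -addnS prednK // addnC.
  by rewrite exprS mulN1r scaleNr addrN.
apply/matrixP => a b; rewrite !mxE; congr (V _ _); apply: val_inj => /=.
rewrite !inordK // /bump; case: i ji i0 il => [[|i] hi] //= ji _ _.
case: (leqP i a); case: (leqP j a) => /=; rewrite ?add0n ?add1n //.
- by move=> ja ia; rewrite (leq_trans ja) // ltnS ia.
- by move=> aj ia; move: (leq_ltn_trans ia aj); rewrite ltnNge -ltnS ji.
- by move=> _ ai; rewrite ltnS leqNgt ai.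
- by move=> _ ai; rewrite ltnNge ltnW.
Qed.

End AffineChains.

(** * Barycentric subdivision and prisms for affine simplices *)

Section NaturalFamilies.
Variable R : realType.
Implicit Types (q l k : nat).

(** [L] on the space coordinates, the identity on the last one, which is the time of a prism. *)
Definition up q q' (L : 'M[R]_(q, q')) : 'M[R]_(q + 1, q' + 1) :=
  block_mx L 0 0 1%:M.

Definition bcen l : 'rV[R]_l.+1 := const_mx (l.+1%:R^-1).
Definition bary q l (V : 'M[R]_(l.+1, q)) : 'rV[R]_q := bcen l *m V.

Lemma bary_mul q q' l (V : 'M[R]_(l.+1, q)) (L : 'M[R]_(q, q')) :
  bary (V *m L) = bary V *m L.
Proof. by rewrite /bary mulmxA. Qed.

Lemma amul_ext q q' l l' r r' (L : 'M[R]_(q, q')) (L' : 'M[R]_(r, r'))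
    (f : 'M[R]_(l.+1, q) -> aff R r l') (f' : 'M[R]_(l.+1, q') -> aff R r' l') u :
  (forall V, f' (V *m L) = amul L' (f V)) ->
  ext f' (amul L u) = amul L' (ext f u).
Proof.
move=> h.
pose F := ext f' \o @amul R q q' l L; pose G := @amul R r r' l' L' \o ext f.
rewrite -[LHS]/(F u) -[RHS]/(G u); apply: eq_ext => V.
by rewrite /F /G /= amul_gen !ext_gen h.
Qed.

(** Defined for all ambient dimensions at once: naturality under linear maps ([sd_mul]) lets the
    subdivided identity simplex determine the subdivision of every singular simplex. *)
Fixpoint sd q l : 'M[R]_(l.+1, q) -> aff R q l :=
  match l return 'M[R]_(l.+1, q) -> aff R q l with
  | 0 => fun V => << V >>
  | l'.+1 => fun V => cone (bary V) (ext (@sd q l') (face V))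
  end.

Lemma sd_mul q q' l (L : 'M[R]_(q, q')) (V : 'M[R]_(l.+1, q)) :
  sd (V *m L) = amul L (sd V).
Proof.
elim: l V => [|l IH] V /=; first by rewrite amul_gen.
by rewrite bary_mul -amul_face amul_cone (amul_ext (L' := L) (f := @sd q l)).
Qed.

Lemma ext_cst_face q l (M : lmodType int) (c : M) (V : 'M[R]_(2, q)) :
  ext (fun _ => c) (@face R q 0 V) = 0 :> M.
Proof.
rewrite /face !big_ord_recl big_ord0 addr0 linearD /= !linearZ /= !ext_gen.
by rewrite expr0 expr1 scale1r scaleN1r subrr.
Qed.

Lemma abd_ext q r l l' (f : 'M[R]_(l.+1, q) -> aff R r l'.+1) (g : 'M[R]_(l.+1, q) -> aff R r l') u :
  (forall V, abd (f V) = g V) -> abd (ext f u) = ext g u.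
Proof.
move=> h; pose F := @abd R r l' \o ext f.
rewrite -[LHS]/(F u); apply: eq_ext => V.
by rewrite /F /= !ext_gen h.
Qed.

Lemma ext_face q l r l' (f : 'M[R]_(l.+1, q) -> aff R r l') (u : aff R q l.+1) :
  ext (fun V => ext f (face V)) u = ext f (abd u).
Proof.
pose F := ext f \o @abd R q l.
rewrite -[RHS]/(F u); apply: eq_ext => V.
by rewrite /F /= !ext_gen abd_gen.
Qed.

Lemma sd_face q l (V : 'M[R]_(l.+2, q)) : abd (sd V) = ext (@sd q l) (face V).
Proof.
elim: l V => [|l IH] V.
  rewrite /= abd_cone0 -/(face V).
  have -> : ext (@sd q 0) (face V) = face V.
    by rewrite -[RHS]/(idfun (face V)); apply: eq_ext => W; rewrite /= ext_gen.
  by rewrite ext_cst_face // subr0.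
rewrite [sd V]/= abd_cone (abd_ext (g := fun W => ext (@sd q l) (face W))) //.
by rewrite ext_face -abd_gen abd_abd 2!linear0 subr0.
Qed.

Definition row0 q (p : 'rV[R]_q) : 'rV[R]_(q + 1) := row_mx p 0.

Lemma row0_up q q' (L : 'M[R]_(q, q')) p : row0 (p *m L) = row0 p *m up L.
Proof. by rewrite /row0 /up mul_row_block !mulmx0 !mul0mx !addr0. Qed.

Section ConeHomotopy.
Variables a b : forall q l, 'M[R]_(l.+1, q) -> aff R (q + 1) l.
Hypothesis a_mul : forall q q' l (L : 'M[R]_(q, q')) (V : 'M[R]_(l.+1, q)),
  a (V *m L) = amul (up L) (a V).
Hypothesis b_mul : forall q q' l (L : 'M[R]_(q, q')) (V : 'M[R]_(l.+1, q)),
  b (V *m L) = amul (up L) (b V).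
Hypothesis a_face : forall q l (V : 'M[R]_(l.+2, q)),
  abd (a V) = ext (@a q l) (face V).
Hypothesis b_face : forall q l (V : 'M[R]_(l.+2, q)),
  abd (b V) = ext (@b q l) (face V).
Hypothesis ab_deg : forall q (V : 'M[R]_(1, q)) (M : lmodType int) (c : M),
  ext (fun _ => c) (a V) = ext (fun _ => c) (b V).

(* Coning from the barycentre of the bottom face makes two families natural in V
   homotopic; the extra coordinate is the time of the prism. *)
Fixpoint hm q l : 'M[R]_(l.+1, q) -> aff R (q + 1) l.+1 :=
  match l return 'M[R]_(l.+1, q) -> aff R (q + 1) l.+1 with
  | 0 => fun V => cone (row0 (bary V)) (a V - b V)
  | l'.+1 => fun V =>
      cone (row0 (bary V)) (a V - b V - ext (@hm q l') (face V))
  end.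

Lemma hm_mul q q' l (L : 'M[R]_(q, q')) (V : 'M[R]_(l.+1, q)) :
  hm (V *m L) = amul (up L) (hm V).
Proof.
elim: l V => [|l IH] V /=.
  by rewrite bary_mul row0_up a_mul b_mul -linearB amul_cone.
rewrite bary_mul row0_up a_mul b_mul -amul_face.
by rewrite (amul_ext (L' := up L) (f := @hm q l)) // -!linearB amul_cone.
Qed.

Lemma hm_face0 q (V : 'M[R]_(1, q)) : abd (hm V) = a V - b V.
Proof. by rewrite /= abd_cone0 linearB /= ab_deg subrr subr0. Qed.

(** The chain being coned is a cycle, by induction and [abd_abd], so the boundary of the cone is its
    base. In degree 0 equal augmentations ([ab_deg]) take the place of the cycle condition. *)
Lemma hm_face q l (V : 'M[R]_(l.+2, q)) :
  abd (hm V) = a V - b V - ext (@hm q l) (face V).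
Proof.
elim: l V => [|l IH] V; rewrite [hm V]/= abd_cone.
  rewrite !(linearB (@abd R _ _)) /= a_face b_face (abd_ext (g := fun W => a W - b W)).
    rewrite (_ : ext (fun W => a W - b W) (face V) = ext (@a q 0) (face V) - ext (@b q 0) (face V)).
      by rewrite subrr linear0 subr0.
    pose F := ext (@a q 0) \- ext (@b q 0).
    by rewrite -[RHS]/(F _); apply: eq_ext => W; rewrite /F /= /GRing.sub_fun !ext_gen.
  exact: hm_face0.
rewrite !(linearB (@abd R _ _)) /= a_face b_face.
rewrite (abd_ext (g := fun W => a W - b W - ext (@hm q l) (face W))) //.
rewrite (_ : ext (fun W => a W - b W - ext (@hm q l) (face W)) (face V) = ext (@a q l.+1) (face V) - ext (@b q l.+1) (face V)).
  by rewrite subrr linear0 subr0.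
pose F := ext (@a q l.+1) \- ext (@b q l.+1) \- (ext (@hm q l) \o @abd R q l).
transitivity (F (face V)).
  apply: eq_ext => W; rewrite /F /= /GRing.sub_fun /= !ext_gen abd_gen.
  by [].
by rewrite /F /= /GRing.sub_fun /= -[face V]abd_gen abd_abd linear0 subr0.
Qed.

End ConeHomotopy.

(** The bottom of the prism, its top and its subdivided bottom. Comparing [emb1] with [emb0] gives
    homotopy invariance; comparing [emb0] with [embsd] relates a chain to its subdivision. *)
Definition emb0 q l (V : 'M[R]_(l.+1, q)) : aff R (q + 1) l :=
  << row_mx V (const_mx 0) >>.
Definition emb1 q l (V : 'M[R]_(l.+1, q)) : aff R (q + 1) l :=
  << row_mx V (const_mx 1) >>.
Definition embsd q l (V : 'M[R]_(l.+1, q)) : aff R (q + 1) l :=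
  ext (@emb0 q l) (sd V).

Lemma row_mx_up q q' l (L : 'M[R]_(q, q')) (V : 'M[R]_(l, q)) (c : 'M[R]_(l, 1)) :
  row_mx V c *m up L = row_mx (V *m L) c.
Proof. by rewrite /up mul_row_block !mulmx0 mulmx1 addr0 add0r. Qed.

Lemma row'_row_mx q l (V : 'M[R]_(l.+1, q)) (c : R) i :
  row' i (row_mx V (const_mx c) : 'M[R]_(l.+1, q + 1)) = row_mx (row' i V) (const_mx c).
Proof.
apply/matrixP => x y; rewrite row'E.
case: (split_ordP y) => z ->; first by rewrite !row_mxEl row'E.
by rewrite !row_mxEr !mxE.
Qed.

Lemma emb0_mul q q' l (L : 'M[R]_(q, q')) (V : 'M[R]_(l.+1, q)) :
  emb0 (V *m L) = amul (up L) (emb0 V).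
Proof. by rewrite amul_gen row_mx_up. Qed.

Lemma emb1_mul q q' l (L : 'M[R]_(q, q')) (V : 'M[R]_(l.+1, q)) :
  emb1 (V *m L) = amul (up L) (emb1 V).
Proof. by rewrite amul_gen row_mx_up. Qed.

Lemma emb0_face q l (V : 'M[R]_(l.+2, q)) :
  abd (emb0 V) = ext (@emb0 q l) (face V).
Proof.
rewrite abd_gen /face linear_sum; apply: eq_bigr => i _.
by rewrite linearZ /= ext_gen /emb0 row'_row_mx.
Qed.

Lemma emb1_face q l (V : 'M[R]_(l.+2, q)) :
  abd (emb1 V) = ext (@emb1 q l) (face V).
Proof.
rewrite abd_gen /face linear_sum; apply: eq_bigr => i _.
by rewrite linearZ /= ext_gen /emb1 row'_row_mx.
Qed.

Lemma embsd_mul q q' l (L : 'M[R]_(q, q')) (V : 'M[R]_(l.+1, q)) :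
  embsd (V *m L) = amul (up L) (embsd V).
Proof.
by rewrite /embsd sd_mul (amul_ext (L' := up L) (f := @emb0 q l)) // => W; exact: emb0_mul.
Qed.

Lemma embsd_face q l (V : 'M[R]_(l.+2, q)) :
  abd (embsd V) = ext (@embsd q l) (face V).
Proof.
rewrite /embsd (abd_ext (g := fun W => ext (@emb0 q l) (face W))); last first.
  by move=> W; exact: emb0_face.
rewrite ext_face sd_face.
pose F := ext (@emb0 q l) \o ext (@sd q l).
by rewrite -[LHS]/(F _); apply: eq_ext => W; rewrite /F /= !ext_gen.
Qed.

Lemma emb01_deg q (V : 'M[R]_(1, q)) (M : lmodType int) (c : M) :
  ext (fun _ => c) (emb1 V) = ext (fun _ => c) (emb0 V).
Proof. by rewrite !ext_gen. Qed.

Lemma emb0sd_deg q (V : 'M[R]_(1, q)) (M : lmodType int) (c : M) :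
  ext (fun _ => c) (emb0 V) = ext (fun _ => c) (embsd V).
Proof. by rewrite /embsd /= !ext_gen. Qed.

Definition rows_in q (C : set 'rV[R]_q) l (V : 'M[R]_(l, q)) := forall i, C (row i V).

Definition prism k : set 'rV[R]_(k.+1 + 1) :=
  [set w | stdsimplex (lsubmx w) /\ 0 <= w ord0 (rshift _ ord0) <= 1].

Lemma rows_in_row' q (C : set 'rV[R]_q) l (V : 'M[R]_(l.+1, q)) i :
  rows_in C V -> rows_in C (row' i V).
Proof.
move=> h x; rewrite (_ : row x _ = row (lift i x) V) //.
by apply/rowP => y; rewrite !mxE.
Qed.

Lemma rows_in_face q (C : set 'rV[R]_q) l (V : 'M[R]_(l.+2, q)) :
  rows_in C V -> gspan (rows_in C (l := l.+1)) (face V).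
Proof.
by move=> h; apply: gspan_sum => i; apply: gspanZ; apply: gspan_gen; exact: rows_in_row'.
Qed.

Lemma rows_in_cone q (C : set 'rV[R]_q) l p (u : aff R q l) :
  C p -> gspan (rows_in C (l := l.+1)) u -> gspan (rows_in C (l := l.+2)) (cone p u).
Proof.
move=> Cp; apply: gspan_ext => V hV; apply: gspan_gen => i.
have [i'|] := unliftP ord0 i => ->.
  rewrite (_ : row _ _ = row i' V) //.
  by apply/rowP => y; rewrite mxE col_mx_lift mxE.
rewrite (_ : row _ _ = p) //.
by apply/rowP => y; rewrite mxE col_mx_ord0.
Qed.

Lemma mul_simplex k l (t : 'rV[R]_l.+1) (V : 'M[R]_(l.+1, k.+1)) :
  stdsimplex t -> rows_in (@stdsimplex R k) V -> stdsimplex (t *m V).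
Proof.
move=> [t0 t1] hV; split=> [i|].
  rewrite mxE; apply: sumr_ge0 => j _; apply: mulr_ge0 => //.
  by have [/(_ i)] := hV j; rewrite mxE.
under eq_bigr do rewrite mxE.
rewrite exchange_big /= -t1; apply: eq_bigr => j _.
rewrite -mulr_sumr -[RHS]mulr1; congr (_ * _).
by have [_ <-] := hV j; apply: eq_bigr => i _; rewrite mxE.
Qed.

Lemma bcen_simplex l : stdsimplex (bcen l).
Proof.
split=> [i|]; first by rewrite mxE invr_ge0 ler0n.
under eq_bigr do rewrite mxE.
by rewrite sumr_const card_ord -[LHS]mulr_natl mulfV // pnatr_eq0.
Qed.

Lemma rows_in_sd k l (V : 'M[R]_(l.+1, k.+1)) :
  rows_in (@stdsimplex R k) V ->
  gspan (rows_in (@stdsimplex R k) (l := l.+1)) (sd V).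
Proof.
elim: l V => [|l IH] V hV /=; first exact: gspan_gen.
apply: rows_in_cone; first exact: mul_simplex (bcen_simplex _) hV.
by apply: gspan_ext (rows_in_face hV) => W; exact: IH.
Qed.

Lemma rows_in_row_mx k l (V : 'M[R]_(l, k.+1)) (c : R) :
  rows_in (@stdsimplex R k) V -> 0 <= c <= 1 ->
  rows_in (@prism k) (row_mx V (const_mx c)).
Proof.
move=> hV hc i; split.
  rewrite (_ : lsubmx _ = row i V) //.
  by apply/rowP => j; rewrite [LHS]mxE [LHS]mxE row_mxEl [RHS]mxE.
by rewrite mxE row_mxEr mxE.
Qed.

Lemma prism_row0 k (p : 'rV[R]_k.+1) : stdsimplex p -> prism (row0 p).
Proof.
move=> hp; split; first by rewrite /row0 row_mxKl.
by rewrite /row0 row_mxEr mxE lexx ler01.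
Qed.

Lemma prism_mul k l (t : 'rV[R]_l.+1) (V : 'M[R]_(l.+1, k.+1 + 1)) :
  stdsimplex t -> rows_in (@prism k) V -> prism (t *m V).
Proof.
move=> ht hV; split.
  rewrite -mulmx_lsub; apply: mul_simplex => // i.
  have [h _] := hV i; rewrite (_ : row _ _ = lsubmx (row i V)) //.
  by apply/rowP => j; rewrite !mxE.
rewrite mxE; have [t0 t1] := ht; apply/andP; split.
  apply: sumr_ge0 => j _; apply: mulr_ge0 => //.
  by have [_ /andP [h _]] := hV j; move: h; rewrite mxE.
rewrite -t1; apply: ler_sum => j _; rewrite ler_piMr //.
by have [_ /andP [_ h]] := hV j; move: h; rewrite mxE.
Qed.

Lemma rows_in_emb0 k l (V : 'M[R]_(l.+1, k.+1)) :
  rows_in (@stdsimplex R k) V -> gspan (rows_in (@prism k) (l := l.+1)) (emb0 V).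
Proof. by move=> h; apply: gspan_gen; apply: rows_in_row_mx; rewrite ?lexx ?ler01. Qed.

Lemma rows_in_emb1 k l (V : 'M[R]_(l.+1, k.+1)) :
  rows_in (@stdsimplex R k) V -> gspan (rows_in (@prism k) (l := l.+1)) (emb1 V).
Proof. by move=> h; apply: gspan_gen; apply: rows_in_row_mx; rewrite ?lexx ?ler01. Qed.

Lemma rows_in_embsd k l (V : 'M[R]_(l.+1, k.+1)) :
  rows_in (@stdsimplex R k) V -> gspan (rows_in (@prism k) (l := l.+1)) (embsd V).
Proof. by move=> h; apply: gspan_ext (rows_in_sd h) => W; exact: rows_in_emb0. Qed.

Lemma rows_in_hm (a b : forall q l, 'M[R]_(l.+1, q) -> aff R (q + 1) l) k :
  (forall l (V : 'M[R]_(l.+1, k.+1)), rows_in (@stdsimplex R k) V ->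
     gspan (rows_in (@prism k) (l := l.+1)) (a _ _ V)) ->
  (forall l (V : 'M[R]_(l.+1, k.+1)), rows_in (@stdsimplex R k) V ->
     gspan (rows_in (@prism k) (l := l.+1)) (b _ _ V)) ->
  forall l (V : 'M[R]_(l.+1, k.+1)), rows_in (@stdsimplex R k) V ->
     gspan (rows_in (@prism k) (l := l.+2)) (hm a b V).
Proof.
move=> ha hb; elim=> [|l IH] V hV /=;
  (apply: rows_in_cone; first exact: prism_row0 (mul_simplex (bcen_simplex _) hV)).
  by apply: gspanB; [exact: ha | exact: hb].
apply: gspanB; first by apply: gspanB; [exact: ha | exact: hb].
by apply: gspan_ext (rows_in_face hV) => W; exact: IH.
Qed.

End NaturalFamilies.

(** * Singular chains *)

Section SingularChains.
Variable R : realType.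
Implicit Types (T U : topologicalType) (k l q : nat).

Definition Ch T k := {freeg (sing_simplex R T k) / int}.

(* Precomposition with the retraction selects one representative in each class
   of simplex_eq. *)
Definition nsimp T k (s : sing_simplex R T k) : Ch T k := << s \o @retr R k >>.

Definition sbd T k : Ch T k.+1 -> Ch T k :=
  ext (fun s : sing_simplex R T k.+1 => \sum_(i < k.+2) (-1) ^+ i *: nsimp (s \o coface i)).
HB.instance Definition _ T k := GRing.Linear.on (@sbd T k).

Definition spush T U (f : T -> U) k : Ch T k -> Ch U k :=
  ext (fun s : sing_simplex R T k => nsimp (f \o s)).
HB.instance Definition _ T U f k := GRing.Linear.on (@spush T U f k).

Definition sing_in T (A : set T) k (s : sing_simplex R T k) :=
  [/\ continuous (s : 'rV[R]_k.+1 -> T), forall t, A (s t) & s \o @retr R k = s].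

Definition C T (A : set T) k : set (Ch T k) := gspan (sing_in A (k := k)).

(** The image of an affine chain under [g]. Being a chain map ([sbd_rz]), it turns identities
    between affine chains into identities between singular chains. *)
Definition rz T q (g : 'rV[R]_q -> T) l : aff R q l -> Ch T l :=
  ext (fun V => nsimp (fun t : 'rV[R]_l.+1 => g (t *m V))).
HB.instance Definition _ T q g l := GRing.Linear.on (@rz T q g l).

Lemma nsimp_eq T k (s s' : sing_simplex R T k) :
  (forall t, stdsimplex t -> s t = s' t) -> nsimp s = nsimp s'.
Proof.
by move=> h; congr << _ >>; apply: funext => t /=; apply: h; exact: retr_simplex.
Qed.

Lemma coface_mul k (i : 'I_k.+2) (t : 'rV[R]_k.+1) :
  coface i t = t *m row' i 1%:M.
Proof.
apply/rowP => j; rewrite !mxE; case: unliftP => [j'|] ->.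
  rewrite (bigD1 j') //= !mxE eqxx mulr1 big1 ?addr0 // => x xj.
  by rewrite !mxE (inj_eq lift_inj) (negPf xj) mulr0.
by rewrite big1 // => x _; rewrite !mxE eq_sym (negPf (neq_lift _ _)) mulr0.
Qed.

Lemma coface_simplex k (i : 'I_k.+2) (t : 'rV[R]_k.+1) :
  stdsimplex t -> stdsimplex (coface i t).
Proof.
move=> ht; rewrite coface_mul; apply: mul_simplex => // j; split=> [x|].
  by rewrite !mxE ler0n.
rewrite (bigD1 (lift i j)) //= !mxE eqxx big1 ?addr0 // => x xj.
by rewrite !mxE eq_sym (negPf xj).
Qed.

Lemma sbd_gen T k (s : sing_simplex R T k.+1) :
  sbd << s >> = \sum_(i < k.+2) (-1) ^+ i *: nsimp (s \o coface i).
Proof. exact: ext_gen. Qed.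

Lemma sbd_nsimp T k (s : sing_simplex R T k.+1) :
  sbd (nsimp s) = \sum_(i < k.+2) (-1) ^+ i *: nsimp (s \o coface i).
Proof.
rewrite sbd_gen; apply: eq_bigr => i _; congr (_ *: _); apply: nsimp_eq => t ht /=.
by rewrite retr_id //; exact: coface_simplex.
Qed.

Lemma rz_gen T q (g : 'rV[R]_q -> T) l (V : 'M[R]_(l.+1, q)) :
  rz g << V >> = nsimp (fun t => g (t *m V)).
Proof. exact: ext_gen. Qed.

Lemma sbd_rz T q (g : 'rV[R]_q -> T) l (u : aff R q l.+1) :
  sbd (rz g u) = rz g (abd u).
Proof.
pose F := @sbd T l \o @rz T q g l.+1; pose G := @rz T q g l \o @abd R q l.
rewrite -[LHS]/(F u) -[RHS]/(G u); apply: eq_ext => V.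
rewrite /F /G /= rz_gen sbd_nsimp abd_gen /face linear_sum; apply: eq_bigr => i _.
rewrite linearZ /= rz_gen; congr (_ *: _); apply: nsimp_eq => t _ /=.
by rewrite coface_mul -mulmxA -row'_mul mul1mx.
Qed.

(** A singular simplex is the image of the identity affine simplex; this reduces [sbd_sbd] to
    [abd_abd]. *)
Lemma sbd_gen_rz T k (s : sing_simplex R T k.+1) :
  sbd << s >> = rz s (face 1%:M).
Proof.
rewrite sbd_gen /face linear_sum; apply: eq_bigr => i _.
by rewrite linearZ /= rz_gen; congr (_ *: _); apply: nsimp_eq => t _ /=; rewrite coface_mul.
Qed.

Lemma sbd_sbd T k (z : Ch T k.+2) : sbd (sbd z) = 0.
Proof.
pose F := @sbd T k \o @sbd T k.+1.
rewrite -[LHS]/(F z) -[RHS]/((\0 : Ch T k.+2 -> Ch T k) z); apply: eq_ext => s.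
by rewrite /F /= sbd_gen_rz sbd_rz -abd_gen abd_abd linear0.
Qed.

Lemma nsimp_in T (A : set T) k (s : sing_simplex R T k) :
  continuous (s : 'rV[R]_k.+1 -> T) -> (forall t, stdsimplex t -> A (s t)) ->
  C A (nsimp s).
Proof.
move=> cs As; apply: gspan_gen; split.
- by apply: cts_comp => //; exact: retr_cts.
- by move=> t; apply: As; exact: retr_simplex.
- by apply: funext => t /=; rewrite retr_id //; exact: retr_simplex.
Qed.

Lemma nsimp_id T (A : set T) k (s : sing_simplex R T k) : sing_in A s -> nsimp s = << s >>.
Proof. by case=> _ _ e; rewrite /nsimp e. Qed.

Lemma mulmx_cts q l (V : 'M[R]_(l, q)) : continuous (fun t : 'rV[R]_l => t *m V).
Proof.
apply: cts_mx => i j; under eq_fun do rewrite mxE.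
by apply: cts_sum => x _; apply: ctsM; [exact: coord_continuous | exact: cts_cst].
Qed.

Lemma sbd_in T (A : set T) k (z : Ch T k.+1) : C A z -> C A (sbd z).
Proof.
apply: gspan_ext => s [cs As _]; apply: gspan_sum => i; apply: gspanZ.
apply: nsimp_in => [|t _]; last exact: As.
apply: (cts_comp (f := s) (g := coface i)) => //.
rewrite (_ : coface i = fun t => t *m row' i 1%:M); first exact: mulmx_cts.
by apply: funext => t; exact: coface_mul.
Qed.

Lemma sub_C T (A B : set T) k (z : Ch T k) : A `<=` B -> C A z -> C B z.
Proof. by move=> AB; apply: sub_gspan => s [cs As e]; split=> // t; exact: AB. Qed.

Lemma C_setI T (A B : set T) k (z : Ch T k) : C A z -> C B z -> C (A `&` B) z.
Proof.
move=> hA hB; apply: sub_gspan (gspanI hA hB) => s [[cs As e] [_ Bs _]].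
by split.
Qed.

Lemma C_set0 T k (z : Ch T k) : C set0 z -> z = 0.
Proof. by move=> h; apply: gspanF; apply: sub_gspan h => s [_ /(_ 0)]. Qed.

Lemma spush_gen T U (f : T -> U) k s : spush f << s >> = nsimp (f \o s) :> Ch U k.
Proof. exact: ext_gen. Qed.

Lemma spush_in T U (f : T -> U) (A : set T) (B : set U) k (z : Ch T k) :
  continuous f -> (forall x, A x -> B (f x)) -> C A z -> C B (spush f z).
Proof.
move=> cf AB; apply: gspan_ext => s [cs As _]; apply: nsimp_in.
  exact: cts_comp.
by move=> t _; exact: AB.
Qed.

Lemma sbd_spush T U (f : T -> U) k (z : Ch T k.+1) :
  sbd (spush f z) = spush f (sbd z).
Proof.
pose F := @sbd U k \o @spush T U f k.+1; pose G := @spush T U f k \o @sbd T k.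
rewrite -[LHS]/(F z) -[RHS]/(G z); apply: eq_ext => s.
rewrite /F /G /= spush_gen sbd_nsimp sbd_gen linear_sum; apply: eq_bigr => i _.
rewrite linearZ /= spush_gen; congr (_ *: _); apply: nsimp_eq => t ht /=.
by rewrite retr_id.
Qed.

Lemma spush_id T (A : set T) k (z : Ch T k) : C A z -> spush id z = z.
Proof.
move=> h; rewrite -[RHS]/(idfun z).
by apply: (eq_ext_gspan _ h) => s hs; rewrite /= spush_gen -(nsimp_id hs).
Qed.

Lemma spush_comp T U (V : topologicalType) (f : T -> U) (g : U -> V) k (z : Ch T k) :
  spush g (spush f z) = spush (g \o f) z.
Proof.
pose F := @spush U V g k \o @spush T U f k.
rewrite -[LHS]/(F z); apply: eq_ext => s.
rewrite /F /= !spush_gen; apply: nsimp_eq => t ht /=.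
by rewrite retr_id.
Qed.

Lemma rz_eq T q (P : set 'rV[R]_q) (g g' : 'rV[R]_q -> T) l (u : aff R q l) :
  (forall (t : 'rV[R]_l.+1) (V : 'M[R]_(l.+1, q)), stdsimplex t -> rows_in P V -> P (t *m V)) ->
  (forall w, P w -> g w = g' w) ->
  gspan (rows_in P (l := l.+1)) u -> rz g u = rz g' u.
Proof.
move=> hP gg' hu; apply: (eq_ext_gspan _ hu) => V hV /=.
rewrite !rz_gen; apply: nsimp_eq => t ht; apply: gg'.
exact: hP.
Qed.

Section Operators.
Variables (T : topologicalType) (h : R -> T -> T).

Definition hcyl k (s : sing_simplex R T k) (w : 'rV[R]_(k.+1 + 1)) : T :=
  h (w ord0 (rshift _ ord0)) (s (lsubmx w)).

(** An affine chain [u] of the prism acts on [s] through the cylinder of [s] under [h]. Homotopies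
    are of this form, and so is subdivision, with [h] constant in time. *)
Definition op k l (u : aff R (k.+1 + 1) l) : Ch T k -> Ch T l :=
  ext (fun s : sing_simplex R T k => rz (hcyl s) u).
HB.instance Definition _ k l u := GRing.Linear.on (@op k l u).

Lemma op_gen k l (u : aff R (k.+1 + 1) l) (s : sing_simplex R T k) :
  op u << s >> = rz (hcyl s) u.
Proof. exact: ext_gen. Qed.

Lemma opB k l (u v : aff R (k.+1 + 1) l) z : op (u - v) z = op u z - op v z.
Proof.
pose F := @op k l u \- @op k l v.
rewrite -[RHS]/(F z); apply: eq_ext => s.
by rewrite /F /= /GRing.sub_fun /= !op_gen linearB.
Qed.

Lemma sbd_op k l (u : aff R (k.+1 + 1) l.+1) z : sbd (op u z) = op (abd u) z.
Proof.
pose F := @sbd T l \o @op k l.+1 u.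
rewrite -[LHS]/(F z); apply: eq_ext => s.
by rewrite /F /= !op_gen sbd_rz.
Qed.

Lemma op_in k l (u : aff R (k.+1 + 1) l) (A B : set T) z :
  continuous (fun p : R * T => h p.1 p.2) ->
  (forall s x, 0 <= s <= 1 -> A x -> B (h s x)) ->
  gspan (rows_in (@prism R k) (l := l.+1)) u ->
  C A z -> C B (op u z).
Proof.
move=> ch AB hu; apply: gspan_ext => s [cs As _].
apply: gspan_ext hu => V hV; apply: nsimp_in.
  pose g (t : 'rV[R]_l.+1) : R * T := ((t *m V) ord0 (rshift _ ord0), s (lsubmx (t *m V))).
  have cg : continuous g.
    apply: cts_pair; first by apply: cts_entry; exact: mulmx_cts.
    apply: cts_comp => //.
    rewrite (_ : (fun _ => _) = fun t => t *m lsubmx V); first exact: mulmx_cts.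
    by apply: funext => t; rewrite mulmx_lsub.
  exact: (cts_comp ch cg).
move=> t ht; have [_ h1] := prism_mul ht hV.
exact: AB.
Qed.

Lemma rz_hcyl_mul k k' l (L : 'M[R]_(k.+1, k'.+1)) (s : sing_simplex R T k') (u : aff R (k.+1 + 1) l) :
  rz (hcyl (s \o (fun t => t *m L))) u = rz (hcyl s) (amul (up L) u).
Proof.
pose F := @rz T _ (hcyl s) l \o @amul R _ _ l (up L).
rewrite -[RHS]/(F u); apply: eq_ext => V.
rewrite /F /= amul_gen !rz_gen; apply: nsimp_eq => t _.
rewrite mulmxA /hcyl /=; set w := t *m V.
have -> : w *m up L = row_mx (lsubmx w *m L) (rsubmx w).
  by rewrite -{1}[w]hsubmxK row_mx_up.
by rewrite row_mxKl row_mxEr [rsubmx w _ _]mxE.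
Qed.

(** Naturality of [th] rewrites its value on a face of the identity simplex as [up] of the coface
    applied to its value on the smaller identity simplex, and [rz_hcyl_mul] moves the coface into
    [s]. *)
Lemma op_face k l (th : forall q, 'M[R]_(k.+1, q) -> aff R (q + 1) l) (z : Ch T k.+1) :
  (forall q q' (L : 'M[R]_(q, q')) V, th q' (V *m L) = amul (up L) (th q V)) ->
  gspan (rows_in (@prism R k) (l := l.+1)) (th k.+1 1%:M) ->
  op (ext (@th k.+2) (face 1%:M)) z = op (th k.+1 1%:M) (sbd z).
Proof.
move=> thM thin.
pose F := @op k l (th k.+1 1%:M) \o @sbd T k.
rewrite -[RHS]/(F z); apply: eq_ext => s.
rewrite /F /= op_gen sbd_gen /face !linear_sum; apply: eq_bigr => i _.
rewrite !linearZ /= ext_gen op_gen; congr (_ *: _).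
rewrite -[X in th k.+2 X]mul1mx thM -rz_hcyl_mul.
apply: (rz_eq _ _ thin); first by move=> t V; exact: prism_mul.
move=> w [hw _]; rewrite /hcyl /= retr_id // -coface_mul //.
Qed.

End Operators.
End SingularChains.

(** * Homotopy invariance and subdivision of singular chains *)

Section HomotopyAndSubdivision.
Variable R : realType.
Implicit Types (T U : topologicalType) (k l q : nat).

(** The boundary, extended by 0 in degree 0, so that relative cycles can be treated uniformly in
    [k]. *)
Definition bdy T k : Ch R T k -> Ch R T k.-1 :=
  match k return Ch R T k -> Ch R T k.-1 with
  | 0 => fun _ => 0
  | k'.+1 => @sbd R T k'
  end.

Lemma bdy_is_linear T k : linear (@bdy T k).
Proof. by case: k => [|k] c x y /=; [rewrite scaler0 addr0 | rewrite linearP]. Qed.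
HB.instance Definition _ T k :=
  GRing.isLinear.Build int (Ch R T k) (Ch R T k.-1) *:%R (@bdy T k) (@bdy_is_linear T k).

Lemma bdy_sbd T k (z : Ch R T k.+1) : bdy (sbd z) = 0.
Proof. by case: k z => [|k] z //=; rewrite sbd_sbd. Qed.

Lemma bdy_in T (A : set T) k (z : Ch R T k) : C A z -> C A (bdy z).
Proof. by case: k z => [|k] z h; [exact: gspan0 | exact: sbd_in]. Qed.

Lemma bdy_spush T U (f : T -> U) k (z : Ch R T k) :
  bdy (spush f z) = spush f (bdy z).
Proof. by case: k z => [|k] z /=; [rewrite linear0 | rewrite sbd_spush]. Qed.

Lemma rows_in_1 k : rows_in (@stdsimplex R k) (1%:M : 'M[R]_k.+1).
Proof.
move=> j; split=> [x|]; first by rewrite !mxE ler0n.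
rewrite (bigD1 j) //= !mxE eqxx big1 ?addr0 // => x xj.
by rewrite !mxE eq_sym (negPf xj).
Qed.

Lemma op_emb T (h : R -> T -> T) k (c : R) (A : set T) (z : Ch R T k) :
  op h << row_mx 1%:M (const_mx c) : 'M[R]_(k.+1, k.+1 + 1) >> z = spush (h c) z.
Proof.
pose F := @op R T h k k << row_mx 1%:M (const_mx c) >>.
rewrite -[LHS]/(F z); apply: eq_ext => s.
rewrite /F /= op_gen rz_gen spush_gen; apply: nsimp_eq => t [_ t1].
rewrite /hcyl mul_mx_row mulmx1 row_mxKl row_mxEr mxE; congr (h _ _).
by rewrite -[RHS]mul1r -t1 mulr_suml; apply: eq_bigr => i _; rewrite mxE.
Qed.

Section ConeOp.
Variables (T : topologicalType) (h : R -> T -> T).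
Variables a b : forall q l, 'M[R]_(l.+1, q) -> aff R (q + 1) l.
Hypothesis a_mul : forall q q' l (L : 'M[R]_(q, q')) (V : 'M[R]_(l.+1, q)),
  a (V *m L) = amul (up L) (a V).
Hypothesis b_mul : forall q q' l (L : 'M[R]_(q, q')) (V : 'M[R]_(l.+1, q)),
  b (V *m L) = amul (up L) (b V).
Hypothesis a_face : forall q l (V : 'M[R]_(l.+2, q)),
  abd (a V) = ext (@a q l) (face V).
Hypothesis b_face : forall q l (V : 'M[R]_(l.+2, q)),
  abd (b V) = ext (@b q l) (face V).
Hypothesis ab_deg : forall q (V : 'M[R]_(1, q)) (M : lmodType int) (c : M),
  ext (fun _ => c) (a V) = ext (fun _ => c) (b V).
Hypothesis a_in : forall k l (V : 'M[R]_(l.+1, k.+1)), rows_in (@stdsimplex R k) V ->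
  gspan (rows_in (@prism R k) (l := l.+1)) (a V).
Hypothesis b_in : forall k l (V : 'M[R]_(l.+1, k.+1)), rows_in (@stdsimplex R k) V ->
  gspan (rows_in (@prism R k) (l := l.+1)) (b V).
Hypothesis h_cts : continuous (fun p : R * T => h p.1 p.2).

(** The boundary of [z] is allowed two summands with separate supports: subdividing small chains
    needs both, a relative homotopy only one. *)
Lemma chain_homotopy (D E1 E2 : set T) k (z : Ch R T k) e1 e2 :
  (forall s x, 0 <= s <= 1 -> D x -> D (h s x)) ->
  (forall s x, 0 <= s <= 1 -> E1 x -> E1 (h s x)) ->
  (forall s x, 0 <= s <= 1 -> E2 x -> E2 (h s x)) ->
  C D z -> C E1 e1 -> C E2 e2 -> bdy z = e1 + e2 ->
  exists y f1 f2, [/\ C D y, C E1 f1, C E2 f2 &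
    op h (a 1%:M) z - op h (b 1%:M) z - sbd y = f1 + f2].
Proof.
move=> hD hE1 hE2 Dz Ee1 Ee2.
have hin l := rows_in_hm (a_in (k := l)) (b_in (k := l)) (@rows_in_1 l).
exists (op h (hm a b 1%:M) z).
case: k z Dz e1 e2 Ee1 Ee2 H => [|k] z Dz e1 e2 Ee1 Ee2 e.
  exists 0, 0; split; [exact: (op_in h_cts hD (hin 0%N)) | exact: gspan0 | exact: gspan0 | ].
  by rewrite sbd_op -opB hm_face0 // subrr addr0.
exists (op h (hm a b 1%:M) e1), (op h (hm a b 1%:M) e2); split.
- exact: (op_in h_cts hD (hin k.+1)).
- exact: (op_in h_cts hE1 (hin k)).
- exact: (op_in h_cts hE2 (hin k)).
rewrite sbd_op -opB (hm_face a_face b_face ab_deg) -opB subKr -linearD -e.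
rewrite (op_face h z (th := fun q V => hm a b V)) //.
by move=> q q' L V; apply: hm_mul.
Qed.

Lemma op_chain_map k (z : Ch R T k.+1) :
  sbd (op h (a 1%:M) z) = op h (a 1%:M) (sbd z).
Proof.
rewrite sbd_op a_face (op_face h z (th := fun q V => a V)) //.
by apply: a_in; exact: rows_in_1.
Qed.

End ConeOp.

(** The prism over [z] joins it to a chain of [G], the image of the final map, and its sides stay in
    [G] because [G] is invariant. *)
Lemma homotopy_acyclic T (h : R -> T -> T) (W G : set T) :
  continuous (fun p : R * T => h p.1 p.2) ->
  (forall x, h 0 x = x) ->
  (forall s x, 0 <= s <= 1 -> W x -> W (h s x)) ->
  (forall s x, 0 <= s <= 1 -> G x -> G (h s x)) ->
  (forall x, W x -> G (h 1 x)) ->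
  forall k (z : Ch R T k), C W z -> C G (bdy z) ->
  exists y, C W y /\ C G (z - sbd y).
Proof.
move=> ch h0 hW hG h1 k z Wz Gz.
have [y [f1 [f2 [Wy Gf1 Gf2 e]]]] := chain_homotopy (@emb1_mul R) (@emb0_mul R) (@emb1_face R)
  (@emb0_face R) (@emb01_deg R) (@rows_in_emb1 R) (@rows_in_emb0 R) ch hW hG hG Wz Gz
  (@gspan0 _ _) (esym (addr0 _)).
have Gy := gspanD Gf1 Gf2; rewrite -e in Gy.
exists (- y); split; first exact: gspanN.
move: Gy; rewrite /emb0 /emb1 !op_emb; try exact: setT.
have -> : h 0 = id by apply: funext.
rewrite (spush_id Wz) => Gy.
have G1 : C G (spush (h 1) z).
  apply: (spush_in _ h1 Wz).
  have c1 : continuous (fun x : T => (1 : R, x)).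
    by apply: cts_pair; [exact: cts_cst | exact: cts_id].
  exact: (cts_comp ch c1).
rewrite linearN opprK.
have -> : z + sbd y = spush (h 1) z - (spush (h 1) z - z - sbd y).
  by rewrite opprD opprB addrA addrCA subrr addr0 opprK.
exact: gspanB.
Qed.

Definition SD T k : Ch R T k -> Ch R T k := op (fun _ => id) (embsd 1%:M).
HB.instance Definition _ T k := GRing.Linear.on (@SD T k).

Lemma SD_rz T q (g : 'rV[R]_q -> T) k (u : aff R q k) :
  SD (rz g u) = rz g (ext (@sd R q k) u).
Proof.
pose F := @SD T k \o @rz R T q g k; pose G := @rz R T q g k \o ext (@sd R q k).
rewrite -[LHS]/(F u) -[RHS]/(G u); apply: eq_ext => V.
rewrite /F /G /= rz_gen ext_gen /SD op_gen.
rewrite (rz_eq (P := @prism R k) (g' := hcyl (fun _ => id) (fun t => g (t *m V)))).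
- have -> : sd V = amul V (sd 1%:M) by rewrite -sd_mul mul1mx.
  rewrite /embsd.
  pose F' := @rz R T _ (hcyl (fun _ => id) (fun t : 'rV[R]_k.+1 => g (t *m V))) k \o ext (@emb0 R k.+1 k).
  pose G' := @rz R T q g k \o @amul R k.+1 q k V.
  rewrite -[LHS]/(F' _) -[RHS]/(G' _); apply: eq_ext => W.
  rewrite /F' /G' /= ext_gen amul_gen !rz_gen; apply: nsimp_eq => t _.
  by rewrite /hcyl mul_mx_row row_mxKl mulmxA.
- by move=> t W; exact: prism_mul.
- by move=> w [hw _]; rewrite /hcyl /= retr_id.
- by apply: rows_in_embsd; exact: rows_in_1.
Qed.

Lemma SD_in T (A : set T) k (z : Ch R T k) : C A z -> C A (SD z).
Proof.
apply: op_in => //; first exact: cts_snd.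
by apply: rows_in_embsd; exact: rows_in_1.
Qed.

Lemma bdy_SD T k (z : Ch R T k) : bdy (SD z) = SD (bdy z).
Proof.
case: k z => [|k] z /=; first by rewrite linear0.
by rewrite /SD (op_chain_map _ (@embsd_mul R) (@embsd_face R) (@rows_in_embsd R)).
Qed.

Lemma SD_homotopy T (D E1 E2 : set T) k (z : Ch R T k) e1 e2 :
  C D z -> C E1 e1 -> C E2 e2 -> bdy z = e1 + e2 ->
  exists y f1 f2, [/\ C D y, C E1 f1, C E2 f2 & z - SD z - sbd y = f1 + f2].
Proof.
move=> Dz Ee1 Ee2 e.
have [//|//|//|y [f1 [f2 [Dy Ef1 Ef2 eD]]]] := chain_homotopy (h := fun _ => id) (@emb0_mul R)
  (@embsd_mul R) (@emb0_face R) (@embsd_face R) (@emb0sd_deg R) (@rows_in_emb0 R)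
  (@rows_in_embsd R) (@cts_snd R T) _ _ _ Dz Ee1 Ee2 e.
exists y, f1, f2; split=> //; rewrite -eD /emb0 op_emb; last exact: setT.
by rewrite (spush_id Dz).
Qed.

End HomotopyAndSubdivision.

(** * Chains subordinate to two relatively open sets *)

Section SmallSimplices.
Variable R : realType.
Implicit Types (T : topologicalType) (k l q : nat).

Definition mesh_le (d : R) l q (V : 'M[R]_(l, q)) :=
  forall i i' j, `|V i j - V i' j| <= d.

Lemma rowij l q (V : 'M[R]_(l, q)) i j : row i V ord0 j = V i j.
Proof. by rewrite mxE. Qed.

Lemma rows_in_sd_convex q (P : set 'rV[R]_q) l (V : 'M[R]_(l.+1, q)) :
  (forall l (V : 'M[R]_(l.+1, q)), rows_in P V -> P (bary V)) ->
  rows_in P V -> gspan (rows_in P (l := l.+1)) (sd V).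
Proof.
move=> hP; elim: l V => [|l IH] V hV /=; first exact: gspan_gen.
apply: rows_in_cone; first exact: hP.
by apply: gspan_ext (rows_in_face hV) => W; exact: IH.
Qed.

Lemma baryE q l (V : 'M[R]_(l.+1, q)) j :
  bary V ord0 j = l.+1%:R^-1 * \sum_i V i j.
Proof.
rewrite mxE mulr_sumr; apply: eq_bigr => i _; by rewrite mxE.
Qed.

Lemma bary_dist q l (V : 'M[R]_(l.+1, q)) (d : R) (p : R) j :
  (forall i, `|p - V i j| <= d) -> `|p - bary V ord0 j| <= d.
Proof.
move=> h; have l0 : (0 : R) < l.+1%:R by rewrite ltr0n.
have -> : p - bary V ord0 j = l.+1%:R^-1 * \sum_i (p - V i j).
  rewrite sumrB sumr_const card_ord baryE mulrBr -[p *+ _]mulr_natl mulrA.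
  by rewrite mulVf ?mul1r // gt_eqF.
rewrite normrM ger0_norm ?invr_ge0 ?(ltW l0) // ler_pdivrMl //.
apply: le_trans (ler_norm_sum _ _ _) _.
rewrite [leRHS]mulr_natl -[X in _ *+ X]card_ord -sumr_const.
by apply: ler_sum => i _.
Qed.

(** Among the [l.+2] differences that are averaged, the one of the vertex with itself vanishes; this
    is the source of the contraction factor. *)
Lemma mesh_bary q l (V : 'M[R]_(l.+2, q)) (d : R) i j :
  mesh_le d V -> `|bary V ord0 j - V i j| <= l.+1%:R / l.+2%:R * d.
Proof.
move=> hV; have l0 : (0 : R) < l.+2%:R by rewrite ltr0n.
have -> : bary V ord0 j - V i j = l.+2%:R^-1 * \sum_i' (V i' j - V i j).
  rewrite sumrB sumr_const card_ord baryE mulrBr -[V i j *+ _]mulr_natl mulrA.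
  by rewrite mulVf ?mul1r // gt_eqF.
rewrite normrM ger0_norm ?invr_ge0 ?(ltW l0) // mulrAC ler_pdivrMl //.
rewrite mulrC divfK ?gt_eqF //.
apply: le_trans (ler_norm_sum _ _ _) _.
rewrite (bigD1 i) //= subrr normr0 add0r.
apply: le_trans (_ : \sum_(i' < l.+2 | i' != i) d <= _).
  by apply: ler_sum => i' _.
by rewrite sumr_const cardC1 card_ord mulr_natl.
Qed.

Lemma mesh_sd q l (V : 'M[R]_(l.+1, q)) (d : R) : 0 <= d ->
  mesh_le d V -> gspan (mesh_le (l%:R / l.+1%:R * d) (l := l.+1) (q := q)) (sd V).
Proof.
move=> d0; elim: l V => [|l IH] V hV /=.
  apply: gspan_gen => i i' j.
  by rewrite !ord1 subrr normr0 mul0r mul0r.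
set c := _ * d.
have frac : l%:R / l.+1%:R * d <= c.
  apply: ler_wpM2r => //; rewrite ler_pdivrMr ?ltr0n // mulrAC ler_pdivlMr ?ltr0n //.
  by rewrite -!natrM ler_nat mulnS mulSn leq_add2r leqnSn.
have hface : gspan (mesh_le d (l := l.+1) (q := q)) (face V).
  apply: gspan_sum => i; apply: gspanZ; apply: gspan_gen => x y j.
  by rewrite !row'E; exact: hV.
(* The new vertices must be close to the barycentre as well as to each other. The box [P] records
   the former through the subdivision of the faces. *)
pose P : set 'rV[R]_q := [set w | forall j, `|bary V ord0 j - w ord0 j| <= c].
have PV : rows_in P V by move=> i j; rewrite rowij; exact: mesh_bary.
have Pconv l' (W : 'M[R]_(l'.+1, q)) : rows_in P W -> P (bary W).
  by move=> hW j; apply: bary_dist => i; have := hW i j; rewrite rowij.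
have h1 : gspan (fun W : 'M[R]_(l.+1, q) => mesh_le c W /\ rows_in P W) (ext (@sd R q l) (face V)).
  apply: gspanI.
    apply: gspan_ext hface => W hW.
    apply: sub_gspan (IH W hW) => X hX i i' j.
    by apply: le_trans (hX i i' j) frac.
  apply: gspan_ext (rows_in_face PV) => W hW; exact: rows_in_sd_convex.
apply: gspan_ext h1 => W [mW PW]; apply: gspan_gen => i i' j.
have c0 : 0 <= c by rewrite mulr_ge0 // divr_ge0 ?ler0n.
have [x|] := unliftP ord0 i => ->; have [x'|] := unliftP ord0 i' => ->.
- by rewrite !col_mx_lift.
- by rewrite col_mx_lift col_mx_ord0 distrC; have := PW x j; rewrite rowij.
- by rewrite col_mx_lift col_mx_ord0; have := PW x' j; rewrite rowij.
- by rewrite subrr normr0.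
Qed.

Lemma nbhs_box k (x : 'rV[R]_k) (A : set 'rV[R]_k) : nbhs x A ->
  exists2 e : R, 0 < e & forall y : 'rV[R]_k, (forall j, `|x ord0 j - y ord0 j| < e) -> A y.
Proof.
move=> /nbhs_ballP [e e0 h]; exists e => // y hy; apply: h; split=> // i j.
by rewrite ord1; exact: hy.
Qed.

Lemma simplex_compact k : compact (@stdsimplex R k).
Proof.
have cs : closed [set t : 'rV[R]_k.+1 | \sum_(i < k.+1) t ord0 i = 1].
  have cf : continuous (fun t : 'rV[R]_k.+1 => \sum_(i < k.+1) t ord0 i).
    by apply: cts_sum => i _; exact: coord_continuous.
  exact: (cts_closed cf (@closed_eq R 1)).
have cp : compact [set v : 'rV[R]_k.+1 | forall i, `[0, 1]%classic (v ord0 i)].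
  have := @rV_compact R k.+1 (fun _ => `[0, 1]%classic) (fun _ => @segment_compact R 0 1).
  exact.
rewrite (_ : @stdsimplex R k = [set v : 'rV[R]_k.+1 | forall i, `[0, 1]%classic (v ord0 i)] `&`
   [set t : 'rV[R]_k.+1 | \sum_(i < k.+1) t ord0 i = 1]).
  exact: compact_closedI.
apply/seteqP; split=> t.
  move=> [t0 t1]; split=> // i /=; rewrite in_itv /= t0 /= -t1 (bigD1 i) //= lerDl.
  by apply: sumr_ge0.
by move=> [h1 h2]; split=> // i; have := h1 i; rewrite /= in_itv /= => /andP [].
Qed.

(** A Lebesgue number: near each point of the simplex the alternative holds for all small [d > 0],
    so compactness, as a near-covering property, yields one [d] for the whole simplex. *)
Lemma lebesgue_simplex T k (s : 'rV[R]_k.+1 -> T) (O1 O2 : set T) :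
  continuous s -> open O1 -> open O2 ->
  (forall t, stdsimplex t -> O1 (s t) \/ O2 (s t)) ->
  exists2 d : R, 0 < d & forall x, stdsimplex x ->
    (forall y : 'rV[R]_k.+1, (forall j, `|x ord0 j - y ord0 j| <= d) -> O1 (s y)) \/
    (forall y : 'rV[R]_k.+1, (forall j, `|x ord0 j - y ord0 j| <= d) -> O2 (s y)).
Proof.
move=> cs o1 o2 cov.
pose P (d : R) (x : 'rV[R]_k.+1) :=
    (forall y : 'rV[R]_k.+1, (forall j, `|x ord0 j - y ord0 j| <= d) -> O1 (s y)) \/
    (forall y : 'rV[R]_k.+1, (forall j, `|x ord0 j - y ord0 j| <= d) -> O2 (s y)).
have key O x : open O -> O (s x) ->
    exists2 e : R, 0 < e & forall (x' : 'rV[R]_k.+1) d, (forall j, `|x ord0 j - x' ord0 j| < e) -> d < e ->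
      forall y : 'rV[R]_k.+1, (forall j, `|x' ord0 j - y ord0 j| <= d) -> O (s y).
  move=> oO Ox; have : nbhs x (s @^-1` O) by apply: cs; exact: open_nbhs_nbhs.
  move=> /nbhs_box [e e0 he]; exists (e / 2); first by rewrite divr_gt0.
  move=> x' d hx' hd y hy; apply: he => j.
  rewrite -(subrK (x' ord0 j) (x ord0 j)) -addrA (splitr e).
  apply: le_lt_trans (ler_normD _ _) _; apply: ltrD; first exact: hx'.
  exact: le_lt_trans (hy j) hd.
have nearlt (e : R) : 0 < e -> \forall d \near 0^'+, d < e.
  by move=> e0; exact: nbhs_right_lt.
have : \forall d \near (0 : R)^'+, @stdsimplex R k `<=` P d.
  have /compact_near_coveringP ck := @simplex_compact k.
  apply: ck => x hx.
  have [Ox|Ox] := cov x hx.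
    have [e e0 he] := key _ _ o1 Ox.
    exists ([set y : 'rV[R]_k.+1 | forall j, `|x ord0 j - y ord0 j| < e], [set d | d < e]).
      split; last exact: nearlt.
      by apply/nbhs_ballP; exists e => // y [_ hy] j; exact: hy.
    by move=> [x' d] /= [hx' hd]; left; exact: he.
  have [e e0 he] := key _ _ o2 Ox.
  exists ([set y : 'rV[R]_k.+1 | forall j, `|x ord0 j - y ord0 j| < e], [set d | d < e]).
    split; last exact: nearlt.
    by apply/nbhs_ballP; exists e => // y [_ hy] j; exact: hy.
  by move=> [x' d] /= [hx' hd]; right; exact: he.
move=> h; have : \forall d \near (0 : R)^'+, 0 < d /\ @stdsimplex R k `<=` P d.
  by apply: filterS2 h (nbhs_right_gt _) => d hd d0; split.
by move=> /filter_ex [d [d0 hd]]; exists d => // x /hd.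
Qed.

Lemma mul_simplex_box k l (t : 'rV[R]_l.+1) (V : 'M[R]_(l.+1, k)) (d : R) j :
  stdsimplex t -> mesh_le d V -> `|V ord0 j - (t *m V) ord0 j| <= d.
Proof.
move=> [t0 t1] hV.
have -> : V ord0 j - (t *m V) ord0 j = \sum_i t ord0 i * (V ord0 j - V i j).
  rewrite mxE -[X in X - _]mul1r -t1 mulr_suml -sumrB.
  by apply: eq_bigr => i _; rewrite mulrBr.
apply: le_trans (ler_norm_sum _ _ _) _.
rewrite -[leRHS]mul1r -t1 mulr_suml; apply: ler_sum => i _.
by rewrite normrM ger0_norm //; apply: ler_wpM2l.
Qed.

Definition small T (A1 A2 : set T) k : set (Ch R T k) :=
  gspan (fun s => sing_in A1 s \/ sing_in A2 s).

Lemma small_l T (A1 A2 : set T) k (z : Ch R T k) : C A1 z -> small A1 A2 z.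
Proof. by apply: sub_gspan => s; left. Qed.

Lemma small_r T (A1 A2 : set T) k (z : Ch R T k) : C A2 z -> small A1 A2 z.
Proof. by apply: sub_gspan => s; right. Qed.

Lemma small_split T (A1 A2 : set T) k (z : Ch R T k) : small A1 A2 z ->
  exists y1 y2, [/\ C A1 y1, C A2 y2 & z = y1 + y2].
Proof. by move=> h; apply: gspan_split => s; exact: h. Qed.

Lemma small_SD T (A1 A2 : set T) k (z : Ch R T k) : small A1 A2 z -> small A1 A2 (SD z).
Proof.
move=> /small_split [y1 [y2 [h1 h2 ->]]]; rewrite linearD; apply: gspanD.
  by apply: small_l; exact: SD_in.
by apply: small_r; exact: SD_in.
Qed.

Definition SDa k q : aff R q k -> aff R q k := ext (@sd R q k).

Lemma iter_SD_rz T q (g : 'rV[R]_q -> T) k (u : aff R q k) r :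
  iter r (@SD R T k) (rz g u) = rz g (iter r (@SDa k q) u).
Proof. by elim: r => //= r ->; rewrite SD_rz. Qed.

Lemma iter_SDa_mesh k r :
  gspan (fun V : 'M[R]_(k.+1, k.+1) => rows_in (@stdsimplex R k) V /\
     mesh_le ((k%:R / k.+1%:R) ^+ r) V) (iter r (@SDa k k.+1) << 1%:M >>).
Proof.
elim: r => [|r IH] /=.
  apply: gspan_gen; split; first exact: rows_in_1.
  move=> i i' j; rewrite expr0 !mxE.
  by case: (i == j); case: (i' == j); rewrite ?subrr ?subr0 ?sub0r ?normrN ?normr0 ?normr1 ?ler01.
apply: gspan_ext IH => V [hV mV]; apply: gspanI; first exact: rows_in_sd.
by rewrite exprS; apply: mesh_sd => //; rewrite exprn_ge0 // divr_ge0 ?ler0n.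
Qed.

(** [A1] and [A2] are open in their union, as the traces of [O1] and [O2]. Once the mesh is below a
    Lebesgue number, each piece lies in one of them. *)
Lemma iter_SD_small_simplex T (A1 A2 O1 O2 : set T) k (s : sing_simplex R T k) :
  open O1 -> open O2 -> A1 = (A1 `|` A2) `&` O1 -> A2 = (A1 `|` A2) `&` O2 ->
  sing_in (A1 `|` A2) s -> exists r, small A1 A2 (iter r (@SD R T k) << s >>).
Proof.
move=> o1 o2 e1 e2 hs; have [cs As es] := hs.
have [d d0 hd] : exists2 d : R, 0 < d & forall x, stdsimplex x ->
    (forall y : 'rV[R]_k.+1, (forall j, `|x ord0 j - y ord0 j| <= d) -> O1 (s y)) \/
    (forall y : 'rV[R]_k.+1, (forall j, `|x ord0 j - y ord0 j| <= d) -> O2 (s y)).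
  apply: lebesgue_simplex => // t _; have := As t.
  by case; [rewrite e1 => -[]; left | rewrite e2 => -[]; right].
have [r hr] : exists r, (k%:R / k.+1%:R) ^+ r <= d :> R.
  have : (k%:R / k.+1%:R : R) ^+ n @[n --> \oo] --> 0.
    by apply: cvg_expr; rewrite ger0_norm ?divr_ge0 ?ler0n // ltr_pdivrMr ?ltr0n // mul1r ltr_nat.
  move=> /cvgr0Pnorm_le /(_ _ d0) [r _ /(_ r (leqnn r)) /= h]; exists r.
  by apply: le_trans h; exact: ler_norm.
exists r.
have -> : << s >> = rz s << 1%:M >> :> Ch R T k.
  rewrite rz_gen -(nsimp_id hs); apply: nsimp_eq => t _; by rewrite mulmx1.
rewrite iter_SD_rz; apply: gspan_ext (@iter_SDa_mesh k r) => V [hV mV].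
have hVd t j : stdsimplex t -> `|row ord0 V ord0 j - (t *m V) ord0 j| <= d.
  by move=> ht; apply: le_trans hr; rewrite rowij; exact: mul_simplex_box.
have cV : continuous (fun t : 'rV[R]_k.+1 => s (t *m V)).
  by apply: cts_comp => //; exact: mulmx_cts.
(* The vertex [row ord0 V] is the centre of a box of size [d] that contains the whole piece. *)
have [h|h] := hd _ (hV ord0).
  apply: small_l; apply: nsimp_in => // t ht; rewrite e1; split; first exact: As.
  by apply: h => j; exact: hVd.
apply: small_r; apply: nsimp_in => // t ht; rewrite e2; split; first exact: As.
by apply: h => j; exact: hVd.
Qed.

Lemma iter_SD_linear T k r : linear (iter r (@SD R T k)).
Proof. by elim: r => [|r IH] c x y //=; rewrite IH linearP. Qed.

Lemma iter_SD_small T (A1 A2 O1 O2 : set T) k (z : Ch R T k) :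
  open O1 -> open O2 -> A1 = (A1 `|` A2) `&` O1 -> A2 = (A1 `|` A2) `&` O2 ->
  C (A1 `|` A2) z -> exists r, small A1 A2 (iter r (@SD R T k) z).
Proof.
move=> o1 o2 e1 e2 hz.
have mono r r' (y : Ch R T k) : (r <= r')%N -> small A1 A2 (iter r (@SD R T k) y) ->
    small A1 A2 (iter r' (@SD R T k) y).
  move=> /subnK <-; rewrite addnC; elim: (r' - r)%N => [|p IH]; first by rewrite addn0.
  by move=> h; rewrite addnS /=; apply: small_SD; exact: IH.
rewrite -[z]freeg_sumE big_seq.
elim/big_ind: _ => [|x y [r hr] [r' hr']|s /hz hs].
- by exists 0%N; exact: gspan0.
- exists (maxn r r'); rewrite -[x]scale1r iter_SD_linear scale1r; apply: gspanD.
    by apply: mono hr; exact: leq_maxl.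
  by apply: mono hr'; exact: leq_maxr.
have [r hr] := iter_SD_small_simplex o1 o2 e1 e2 hs; exists r.
rewrite genZ -[_ *: _]addr0 iter_SD_linear.
rewrite (_ : iter r _ 0 = 0) ?addr0; last by elim: r {hr} => //= r ->; rewrite linear0.
exact: gspanZ.
Qed.

(** Each subdivision changes a chain with small boundary by a boundary and a small chain. These
    changes are summed until the subdivided chain is small. *)
Lemma small_chains T (A1 A2 O1 O2 : set T) k (z : Ch R T k) :
  open O1 -> open O2 -> A1 = (A1 `|` A2) `&` O1 -> A2 = (A1 `|` A2) `&` O2 ->
  C (A1 `|` A2) z -> small A1 A2 (bdy z) ->
  exists y, C (A1 `|` A2) y /\ small A1 A2 (z - sbd y).
Proof.
move=> o1 o2 e1 e2 hz sz.
have [r hr] := iter_SD_small o1 o2 e1 e2 hz.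
suff: forall r, exists y, C (A1 `|` A2) y /\ small A1 A2 (z - iter r (@SD R T k) z - sbd y).
  move=> /(_ r) [y [hy sy]]; exists y; split=> //.
  by move: (gspanD sy hr); rewrite addrAC subrK.
elim=> [|{hr}p [y [hy sy]]].
  by exists 0; split; [exact: gspan0 | rewrite /= subrr linear0 subr0; exact: gspan0].
set w := iter p _ z in sy *.
have hw : C (A1 `|` A2) w.
  by rewrite /w; elim: (p) => //= p' IH; exact: SD_in.
have sw : small A1 A2 (bdy w).
  by rewrite /w; elim: (p) => //= p' IH; rewrite bdy_SD; exact: small_SD.
have [D1 [D2 [h1 h2 eD]]] := small_split sw.
have [y' [hy' sy']] : exists y', C (A1 `|` A2) y' /\ small A1 A2 (w - SD w - sbd y').
  have [y' [f1 [f2 [hy' hf1 hf2 e]]]] := SD_homotopy hw h1 h2 eD.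
  by exists y'; split=> //; rewrite e; apply: gspanD; [exact: small_l | exact: small_r].
exists (y + y'); split; first exact: gspanD.
rewrite /= -/w linearD.
have -> : z - SD w - (sbd y + sbd y') = (z - w - sbd y) + (w - SD w - sbd y').
  by rewrite opprD [RHS]addrACA subrKA.
exact: gspanD.
Qed.

End SmallSimplices.

Lemma subrACA (V : zmodType) (a b c d : V) : a - b - (c - d) = a - c - (b - d).
Proof. by rewrite !opprD !opprK addrACA. Qed.

(** * Relative homology *)

Section HomologyGroups.

(* A homology group is presented by its cycles and boundaries. *)
Record hgrp := Hgrp {
  hcar :> zmodType;
  cyc : set hcar;
  bnd : set hcar;
  cycB : forall x y, cyc x -> cyc y -> cyc (x - y);
  bndB : forall x y, bnd x -> bnd y -> bnd (x - y) }.

Definition hzero (H : hgrp) := forall x : H, cyc x -> bnd x.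

Record hmor (H K : hgrp) (f : {additive H -> K}) : Prop := Hmor {
  hmor_cyc : forall x, cyc x -> cyc (f x);
  hmor_bnd : forall x, bnd x -> bnd (f x) }.

Definition hiso (H K : hgrp) (f : H -> K) : Prop :=
  (forall x, cyc x -> bnd (f x) -> bnd x) /\
  (forall y : K, cyc y -> exists2 x, cyc x & bnd (f x - y)).

(* Connecting homomorphisms are multivalued on chains, hence correspondences. *)
Record isorel (H K : hgrp) (G : H -> K -> Prop) : Prop := Isorel {
  isorelB : forall x y x' y', G x y -> G x' y' -> G (x - x') (y - y');
  isorel_tot : forall x, cyc x -> exists2 y, cyc y & G x y;
  isorel_surj : forall y, cyc y -> exists x y', [/\ cyc x, cyc y', G x y' & bnd (y' - y)];
  isorel_bnd : forall x y, cyc x -> cyc y -> G x y -> (bnd x <-> bnd y) }.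

Implicit Types H K : hgrp.

Lemma bnd0 H (x : H) : bnd x -> bnd (0 : H).
Proof. by move=> h; rewrite -(subrr x); exact: bndB. Qed.

Lemma bndN H (x : H) : bnd x -> bnd (- x).
Proof. by move=> h; rewrite -sub0r; apply: bndB => //; exact: bnd0 h. Qed.

Lemma bndD H (x y : H) : bnd x -> bnd y -> bnd (x + y).
Proof. by move=> hx hy; rewrite -[y]opprK; apply: bndB => //; exact: bndN. Qed.

Lemma bnd_congr H (x y : H) : bnd (x - y) -> bnd x -> bnd y.
Proof. by move=> hxy hx; rewrite -[y](subKr x); exact: bndB. Qed.

(** A chase around a square whose vertical sides are correspondences. It plays the role of
    conjugating by connecting isomorphisms, without choosing values for them. *)
Lemma isorel_transfer H K H' K' (G : H -> K -> Prop) (G' : H' -> K' -> Prop)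
    (f : {additive H -> H'}) (g : {additive K -> K'}) :
  isorel G -> isorel G' -> hmor f -> hmor g ->
  (forall x y, G x y -> G' (f x) (g y)) -> hiso f <-> hiso g.
Proof.
move=> iG iG' mf mg nat; split=> -[inj surj]; split.
- move=> y cy bgy; have [x [y' [cx cy' xy' b]]] := isorel_surj iG cy.
  apply: (bnd_congr b); apply/(isorel_bnd iG cx cy' xy'); apply: inj => //.
  apply/(isorel_bnd iG' (hmor_cyc mf cx) (hmor_cyc mg cy') (nat _ _ xy')).
  by rewrite -(subrK y y') raddfD; apply: bndD (hmor_bnd mg b) bgy.
- move=> y' cy'; have [x' [y'' [cx' cy'' xy b]]] := isorel_surj iG' cy'.
  have [x cx bx] := surj _ cx'; have [y cy xy'] := isorel_tot iG cx.
  exists y => //; rewrite -(subrKA y''); apply: bndD => //.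
  have h := isorelB iG' (nat _ _ xy') xy.
  by apply/(isorel_bnd iG' (cycB (hmor_cyc mf cx) cx') (cycB (hmor_cyc mg cy) cy'') h).
- move=> x cx bfx; have [y cy xy] := isorel_tot iG cx.
  apply/(isorel_bnd iG cx cy xy); apply: inj => //.
  by apply/(isorel_bnd iG' (hmor_cyc mf cx) (hmor_cyc mg cy) (nat _ _ xy)).
- move=> x' cx'; have [y' cy' xy'] := isorel_tot iG' cx'.
  have [y cy by_] := surj _ cy'; have [x [y2 [cx cy2 xy2 b2]]] := isorel_surj iG cy.
  exists x => //; have h := isorelB iG' (nat _ _ xy2) xy'.
  apply/(isorel_bnd iG' (cycB (hmor_cyc mf cx) cx') (cycB (hmor_cyc mg cy2) cy') h).
  by rewrite -(subrKA (g y)) -raddfB; exact: bndD (hmor_bnd mg b2) by_.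
Qed.

Lemma isorel_graph H K (f : {additive H -> K}) : hmor f -> (exists x : K, bnd x) -> hiso f ->
  isorel (fun x y => y = f x).
Proof.
move=> mf [z0 hz0] [inj surj]; split.
- by move=> x y x' y' -> ->; rewrite raddfB.
- by move=> x cx; exists (f x) => //; exact: hmor_cyc mf _ cx.
- move=> y cy; have [x cx bx] := surj _ cy.
  by exists x, (f x); split=> //; exact: hmor_cyc mf _ cx.
- by move=> x y cx cy ->; split=> [|b]; [exact: hmor_bnd mf _ | exact: inj].
Qed.

Lemma isorel_zero H K (G : H -> K -> Prop) : isorel G -> hzero K -> hzero H.
Proof.
move=> iG hK x cx; have [y cy xy] := isorel_tot iG cx.
by apply/(isorel_bnd iG cx cy xy); exact: hK.
Qed.

Lemma hzero_iso H K (f : {additive H -> K}) : (exists x : H, cyc x) ->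
  hzero H -> hzero K -> hiso f.
Proof.
move=> [z0 hz0] hH hK; split=> [x cx _|y cy]; first exact: hH.
exists (z0 - z0); first exact: cycB.
by rewrite subrr raddf0 sub0r; apply: bndN; exact: hK.
Qed.

Lemma hiso_comp H K (L : hgrp) (f : {additive H -> K}) (g : {additive K -> L}) :
  hmor f -> hmor g -> hiso f -> hiso g -> hiso (g \o f).
Proof.
move=> mf mg [fi fs] [gi gs]; split.
  by move=> x cx b; apply: fi => //; apply: gi => //; exact: hmor_cyc mf _ cx.
move=> z /gs [y cy byz]; have [x cx bxy] := fs y cy; exists x => //=.
by rewrite -(subrKA (g y)) -raddfB; exact: bndD (hmor_bnd mg bxy) byz.
Qed.

End HomologyGroups.

Section RelativeHomology.
Variable R : realType.
Implicit Types (T U : topologicalType) (k : nat).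

Section Pair.
Variables (T : topologicalType) (D G : set T) (k : nat).

Definition rcyc : set (Ch R T k) := [set z | C D z /\ C G (bdy z)].
Definition rbnd : set (Ch R T k) := [set z | exists y, C D y /\ C G (z - sbd y)].

Lemma rcycB x y : rcyc x -> rcyc y -> rcyc (x - y).
Proof. by move=> [h h'] [g g']; split; [exact: gspanB | rewrite linearB; exact: gspanB]. Qed.

Lemma rbndB x y : rbnd x -> rbnd y -> rbnd (x - y).
Proof.
move=> [a [ha ha']] [b [hb hb']]; exists (a - b); split; first exact: gspanB.
have -> : x - y - sbd (a - b) = (x - sbd a) - (y - sbd b).
  by rewrite linearB /= !opprD !opprK addrACA.
exact: gspanB.
Qed.

Definition Hrel := Hgrp rcycB rbndB.
End Pair.

Definition acyc T (D G : set T) := forall k, hzero (Hrel D G k).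

Lemma acycP T (D G : set T) : acyc D G ->
  forall k (z : Ch R T k), C D z -> C G (bdy z) -> exists y, C D y /\ C G (z - sbd y).
Proof. by move=> h k z hz hz'; exact: h. Qed.

Lemma homotopy_acyc T (h : R -> T -> T) (W G : set T) :
  continuous (fun p : R * T => h p.1 p.2) ->
  (forall x, h 0 x = x) ->
  (forall s x, 0 <= s <= 1 -> W x -> W (h s x)) ->
  (forall s x, 0 <= s <= 1 -> G x -> G (h s x)) ->
  (forall x, W x -> G (h 1 x)) -> acyc W G.
Proof. by move=> ch h0 hW hG h1 k z [Wz Gz]; exact: (homotopy_acyclic ch h0 hW hG h1 Wz Gz). Qed.

Lemma rcyc0 T (D G : set T) k : rcyc D G (0 : Ch R T k).
Proof. by split; [exact: gspan0 | rewrite linear0; exact: gspan0]. Qed.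

Lemma C_rbnd T (D G : set T) k (z : Ch R T k) : C G z -> rbnd D G z.
Proof. by move=> h; exists 0; split; [exact: gspan0 | rewrite linear0 subr0]. Qed.

Lemma rbnd0 T (D G : set T) k : rbnd D G (0 : Ch R T k).
Proof. by apply: C_rbnd; exact: gspan0. Qed.

Lemma sbd_rbnd T (D G : set T) k (y : Ch R T k.+1) : C D y -> rbnd D G (sbd y).
Proof. by move=> h; exists y; split=> //; rewrite subrr; exact: gspan0. Qed.

Lemma spush_hmor T U (f : T -> U) (D G : set T) (D' G' : set U) k :
  continuous f -> (forall x, D x -> D' (f x)) -> (forall x, G x -> G' (f x)) ->
  @hmor (Hrel D G k) (Hrel D' G' k) (@spush R T U f k).
Proof.
move=> cf DD' GG'; split=> z /=.
  by move=> [h h']; split; [exact: (spush_in cf DD') | rewrite bdy_spush; exact: (spush_in cf GG')].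
move=> [y [h h']]; exists (spush f y); split; first exact: (spush_in cf DD').
by rewrite sbd_spush -linearB; exact: (spush_in cf GG').
Qed.

Lemma id_hmor T (D G D' G' : set T) k : D `<=` D' -> G `<=` G' ->
  @hmor (Hrel D G k) (Hrel D' G' k) idfun.
Proof.
move=> DD' GG'; split=> z /=.
  by move=> [h h']; split; [exact: sub_C h | exact: sub_C h'].
by move=> [y [h h']]; exists y; split; [exact: sub_C h | exact: sub_C h'].
Qed.

(* Long exact sequence of a triple E c G c D with H(D, G) = 0. *)
Lemma triple_iso T (D G E : set T) k : G `<=` D -> E `<=` G -> acyc D G ->
  @hiso (Hrel G E k) (Hrel D E k) id.
Proof.
move=> GD EG ac; split.
- move=> z [Gz Ez] [y [Dy Ey]].
  have Gy : C G (bdy y).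
    by rewrite /= -(subKr z (sbd y)); apply: gspanB => //; exact: sub_C Ey.
  have [w [Dw Gw]] := acycP ac Dy Gy.
  exists (y - sbd w); split=> //.
  by rewrite linearB /= sbd_sbd subr0.
- move=> z [Dz Ez]; have [y [Dy Gy]] := acycP ac Dz (sub_C EG Ez).
  exists (z - sbd y).
    by split=> //; rewrite linearB /= bdy_sbd subr0.
  by rewrite [_ - z]addrC addKr; rewrite -linearN; apply: sbd_rbnd; exact: gspanN.
Qed.

Lemma triple_acyc T (D G E : set T) : G `<=` D -> E `<=` G ->
  (forall k, @hiso (Hrel G E k) (Hrel D E k) id) -> acyc D G.
Proof.
move=> GD EG iso k z [Dz Gz].
(* Injectivity one degree lower is applied to the boundary of [z], which bounds in [D]. Subtracting
   the resulting [y] makes [z] a cycle relative to [E]. *)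
have [y [Gy Ey]] : exists y, C G y /\ C E (bdy z - bdy y).
  case: k z Dz Gz => [|k] z Dz Gz.
    by exists 0; split; [exact: gspan0 | rewrite /= subrr; exact: gspan0].
  have [/(_ (sbd z)) inj _] := iso k.
  have [|y [Gy Ey]] := inj _ (sbd_rbnd _ Dz); last by exists y.
  by split=> //; rewrite bdy_sbd; exact: gspan0.
have [_ /(_ (z - y))] := iso k; case.
  by split; [apply: gspanB => //; exact: sub_C Gy | rewrite linearB].
move=> u [Gu _] [w [Dw Ew]]; exists (- w); split; first exact: gspanN.
rewrite linearN opprK.
have -> : z + sbd w = y + u - (u - (z - y) - sbd w).
  have -> : u - (z - y) - sbd w = u - (z - y + sbd w) by rewrite [in RHS]opprD addrA.
  by rewrite -addrA subKr addrA [y + _]addrC subrK.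
apply: gspanB; last exact: sub_C Ew.
by apply: gspanD.
Qed.

Section TwoSided.
Variables (T : topologicalType) (D G1 G2 O1 O2 : set T).
Hypotheses (o1 : open O1) (o2 : open O2).
Hypotheses (e1 : G1 = (G1 `|` G2) `&` O1) (e2 : G2 = (G1 `|` G2) `&` O2).

Lemma excision k : @hiso (Hrel G1 (G1 `&` G2) k) (Hrel (G1 `|` G2) G2 k) id.
Proof.
split.
- move=> z [Gz Ez] [y [Dy Ey]].
  have sy : small G1 G2 (bdy y).
    by rewrite /= -(subKr z (sbd y)); apply: gspanB; [exact: small_l | exact: small_r].
  have [r [hr /small_split [a [b [ha hb eab]]]]] := small_chains o1 o2 e1 e2 Dy sy.
  exists a; split=> //; apply: C_setI; first by apply: gspanB => //; exact: sbd_in.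
  have -> : z - sbd a = z - sbd y + sbd b.
    have -> : sbd y = sbd a + sbd b by rewrite -linearD -eab linearB /= sbd_sbd subr0.
    by rewrite opprD addrA subrK.
  by apply: gspanD => //; exact: sbd_in.
- move=> z [Dz Ez].
  have [y [hy /small_split [a [b [ha hb eab]]]]] := small_chains o1 o2 e1 e2 Dz (small_r G1 Ez).
  exists a.
    split=> //; apply: C_setI; first exact: bdy_in.
    have -> : bdy a = bdy z - bdy b.
      have -> : bdy z = bdy a + bdy b by rewrite -linearD -eab linearB /= bdy_sbd subr0.
      by rewrite addrK.
    by apply: gspanB => //; exact: bdy_in.
  exists (- y); split; first exact: gspanN.
  rewrite linearN opprK /=.
  have -> : a - z + sbd y = - b.
    by rewrite -[z](subrK (sbd y)) eab opprD addrA subrK opprD addrA subrr add0r.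
  exact: gspanN.
Qed.

Hypotheses (G1D : G1 `<=` D) (G2D : G2 `<=` D) (ac1 : acyc D G1) (ac2 : acyc D G2).

(* The connecting correspondence of 0 -> C(D)/C(G1 n G2) ->
   C(D)/C(G1) + C(D)/C(G2) -> C(D)/(C(G1) + C(G2)) -> 0. *)
Definition connecting k (w : Ch R T k) (z : Ch R T k.+1) :=
  exists x1 x2, [/\ C D x1, C D x2, C G1 (w - sbd x1), C G2 (w - sbd x2) & z = x1 - x2].

(** The middle term of the sequence is acyclic by [ac1] and [ac2], hence its connecting map is an
    isomorphism; [small_chains] lets chains of the union replace sums of chains of [G1] and [G2]. *)
Lemma connecting_isorel k :
  @isorel (Hrel D (G1 `&` G2) k) (Hrel D (G1 `|` G2) k.+1) (@connecting k).
Proof.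
have i1 : G1 `&` G2 `<=` G1 by move=> x [].
have i2 : G1 `&` G2 `<=` G2 by move=> x [].
have u1 : G1 `<=` G1 `|` G2 by move=> x; left.
have u2 : G2 `<=` G1 `|` G2 by move=> x; right.
have uD : G1 `|` G2 `<=` D by move=> x [/G1D|/G2D].
split.
- move=> w z w' z' [x1 [x2 [h1 h2 h3 h4 ->]]] [x1' [x2' [h1' h2' h3' h4' ->]]].
  exists (x1 - x1'), (x2 - x2'); split; try exact: gspanB.
  + have -> : w - w' - sbd (x1 - x1') = (w - sbd x1) - (w' - sbd x1').
      by rewrite linearB /= !opprD !opprK addrACA.
    exact: gspanB.
  + have -> : w - w' - sbd (x2 - x2') = (w - sbd x2) - (w' - sbd x2').
      by rewrite linearB /= !opprD !opprK addrACA.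
    exact: gspanB.
  + by rewrite !opprD !opprK addrACA.
- move=> w [Dw Iw].
  have [x1 [h1 h1']] := acycP ac1 Dw (sub_C i1 Iw).
  have [x2 [h2 h2']] := acycP ac2 Dw (sub_C i2 Iw).
  exists (x1 - x2); last by exists x1, x2.
  split; first exact: gspanB.
  have -> : bdy (x1 - x2) = (w - sbd x2) - (w - sbd x1).
    by rewrite linearB /= opprB [RHS]addrC subrKA.
  by apply: gspanB; [exact: sub_C h2' | exact: sub_C h1'].
- move=> z [Dz Uz].
  have [|y [Uy /small_split [a1 [a2 [h1 h2 ea]]]]] := small_chains o1 o2 e1 e2 Uz.
    by rewrite bdy_sbd; exact: gspan0.
  have ea' : sbd (z - y) = a1 + a2 by rewrite linearB.
  have eb : bdy a2 = - bdy a1.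
    by apply/eqP; rewrite -addr_eq0 addrC -linearD -ea' /= bdy_sbd.
  (* The boundary of [z - y] splits as [a1 + a2]. The part [a2] is a preimage, with [x1 = z - y] and
     [x2 = 0]. *)
  exists a2, (z - y); split.
  + split; first exact: sub_C h2.
    apply: C_setI; last exact: bdy_in.
    by rewrite eb; apply: gspanN; exact: bdy_in.
  + split; first by apply: gspanB => //; exact: sub_C Uy.
    rewrite /= ea'; apply: gspanD; [exact: sub_C h1 | exact: sub_C h2].
  + exists (z - y), 0; split.
    * by apply: gspanB => //; exact: sub_C Uy.
    * exact: gspan0.
    * by rewrite ea' opprD addrCA subrr addr0; exact: gspanN.
    * by rewrite linear0 subr0.
    * by rewrite subr0.
  + by apply: C_rbnd; rewrite addrAC subrr sub0r; exact: gspanN.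
- move=> w z [Dw Iw] [Dz Uz] [x1 [x2 [h1 h2 h3 h4 ez]]]; split.
  + move=> [y [Dy Iy]].
    have [|p [Dp Gp]] := acycP ac1 (gspanB h1 Dy).
      rewrite linearB /=.
      have -> : sbd x1 - sbd y = (w - sbd y) - (w - sbd x1) by rewrite opprB [RHS]addrC subrKA.
      by apply: gspanB => //; exact: sub_C Iy.
    have [|q [Dq Gq]] := acycP ac2 (gspanB h2 Dy).
      rewrite linearB /=.
      have -> : sbd x2 - sbd y = (w - sbd y) - (w - sbd x2) by rewrite opprB [RHS]addrC subrKA.
      by apply: gspanB => //; exact: sub_C Iy.
    exists (p - q); split; first exact: gspanB.
    have -> : z - sbd (p - q) = (x1 - y - sbd p) - (x2 - y - sbd q).
      by rewrite ez linearB /= [RHS]subrACA [X in _ = X - _]subrACA subrr subr0.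
    by apply: gspanB; [exact: sub_C Gp | exact: sub_C Gq].
  + move=> [p [Dp Up]].
    have [|r [Ur /small_split [b1 [b2 [hb1 hb2 eb]]]]] := small_chains o1 o2 e1 e2 Up.
      rewrite linearB /= sbd_sbd subr0 ez linearB /=.
      have -> : sbd x1 - sbd x2 = (w - sbd x2) - (w - sbd x1) by rewrite opprB [RHS]addrC subrKA.
      by apply: gspanB; [exact: small_r | exact: small_l].
    (* One chain in two forms: the first shows that [w] minus its boundary lies in [G1], the second
       that it lies in [G2]. *)
    have ez2 : x1 - b1 - sbd (p + r) = x2 + b2.
      have ex : x1 = b1 + b2 + sbd r + sbd p + x2 by rewrite -eb !subrK ez subrK.
      apply/eqP; rewrite !subr_eq; apply/eqP; rewrite ex linearD /=.
      rewrite [LHS]addrC -!addrA; congr (_ + _).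
      by rewrite addrC -!addrA; congr (_ + _); rewrite addrCA.
    exists (x1 - b1 - sbd (p + r)); split.
      apply: gspanB; first by apply: gspanB => //; exact: sub_C hb1.
      by apply: sbd_in; apply: gspanD => //; exact: sub_C Ur.
    apply: C_setI.
      have -> : w - sbd (x1 - b1 - sbd (p + r)) = w - sbd x1 + sbd b1.
        by rewrite [sbd (_ - _)]linearB /= sbd_sbd subr0 linearB /= opprB addrA addrAC.
      by apply: gspanD => //; exact: sbd_in.
    by rewrite ez2 linearD /= opprD addrA; apply: gspanB => //; exact: sbd_in.
Qed.

Lemma union_H0 : hzero (Hrel D (G1 `|` G2) 0).
Proof.
move=> z [Dz _]; have [|y [Dy Gy]] := acycP ac1 Dz; first exact: gspan0.
by exists y; split=> //; apply: sub_C Gy => x; left.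
Qed.

End TwoSided.

(* Five lemma for the end of the long exact sequence of the pair (U, Q). *)
Lemma pair_iso T T' (f : T -> T') (U Q : set T) (U' Q' : set T') k :
  continuous f -> (forall x, U x -> U' (f x)) -> (forall x, Q x -> Q' (f x)) ->
  Q `<=` U -> Q' `<=` U' ->
  (forall i, @hiso (Hrel U set0 i) (Hrel U' set0 i) (@spush R T T' f i)) ->
  @hiso (Hrel U Q k.+1) (Hrel U' Q' k.+1) (@spush R T T' f k.+1) ->
  @hiso (Hrel U Q k) (Hrel U' Q' k) (@spush R T T' f k) ->
  @hiso (Hrel Q set0 k) (Hrel Q' set0 k) (@spush R T T' f k).
Proof.
move=> cf UU' QQ' QU QU' isoU [pinj psurj] [pinj0 _]; split.
- move=> z [Qz z0] [y' [Qy' /C_set0 ey']].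
  have [Uinj _] := isoU k; have [_ Usurj] := isoU k.+1.
  have [|y [Uy /C_set0 /subr0_eq ey]] := Uinj z (conj (sub_C QU Qz) z0).
    by exists y'; split; [exact: sub_C Qy' | rewrite ey'; exact: gspan0].
  (* The cycle [u] corrects [y], so that the image of [y - u] agrees with [y'] up to a boundary and
     is thus trivial in the pair. *)
  have [|u [Uu u0] [v' [Uv' /C_set0 /subr0_eq ev']]] := Usurj (spush f y - y').
    split; first by apply: gspanB; [exact: (spush_in cf UU') | exact: sub_C Qy'].
    by rewrite /= linearB /= sbd_spush -ey ey'; exact: gspan0.
  have {}u0 : sbd u = 0 := C_set0 u0.
  have bz : sbd (y - u) = z by rewrite linearB /= u0 subr0 -ey.
  have [||p [Up Qp]] := pinj (y - u).
  + by split; [exact: gspanB | rewrite /= bz].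
  + exists (- v'); split; first exact: gspanN.
    have -> : spush f (y - u) - sbd (- v') = y'.
      by rewrite linearN opprK linearB /= -ev' subrKA subKr.
    exact: Qy'.
  exists (y - u - sbd p); split=> //.
  by rewrite linearB /= sbd_sbd subr0 bz subrr; exact: gspan0.
- move=> z' [Qz' z0'].
  have [_ Usurj] := isoU k.
  have [u [Uu u0] [v' [Uv' /C_set0 /subr0_eq ev']]] := Usurj z' (conj (sub_C QU' Qz') z0').
  have {}u0 : bdy u = 0 := C_set0 u0.
  have {}z0' : bdy z' = 0 := C_set0 z0'.
  have [||p [Up Qp]] := pinj0 u.
  + by split=> //; rewrite u0; exact: gspan0.
  + by exists v'; split=> //; rewrite -ev' subKr.
  set q := u - sbd p in Qp.
  have ey' : sbd (v' - spush f p) = spush f q - z'.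
    by rewrite linearB /= -ev' sbd_spush /q linearB /= addrAC.
  have [|y [Uy Qy] [w' [Uw' Qe]]] := psurj (v' - spush f p).
    split; first by apply: gspanB => //; exact: (spush_in cf UU').
    by rewrite /= ey'; apply: gspanB => //; exact: (spush_in cf QQ').
  exists (q - sbd y).
    split; first exact: gspanB.
    by rewrite linearB /= bdy_sbd subr0 /q linearB /= bdy_sbd u0 subr0; exact: gspan0.
  set e := _ - sbd w' in Qe.
  exists (- e); split; first exact: gspanN.
  have -> : spush f (q - sbd y) - z' - sbd (- e) = 0; last exact: gspan0.
  rewrite [sbd (- e)]linearN /= opprK.
  have -> : sbd e = sbd (spush f y) - sbd (v' - spush f p).
    by rewrite /e linearB /= sbd_sbd subr0 linearB.
  rewrite [spush f (_ - _)]linearB /= ey' sbd_spush.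
  by rewrite [X in X + _]addrAC subrKA subrr.
Qed.

(** [spush id] normalizes simplices: it is the identity on chains in [C D], but not on arbitrary
    formal sums. *)
Lemma hiso_spush_id T (D G D' G' : set T) k :
  @hiso (Hrel D G k) (Hrel D' G' k) id -> @hiso (Hrel D G k) (Hrel D' G' k) (@spush R T T id k).
Proof.
move=> [inj surj]; split=> [x [Dx Gx]|y cy].
  by rewrite (spush_id Dx); exact: inj.
have [x cx bx] := surj y cy; exists x => //.
by have [Dx _] := cx; rewrite (spush_id Dx).
Qed.

Lemma map_square T1 T2 T1' T2' (a : T1 -> T2) (a' : T1' -> T2') (f1 : T1 -> T1') (f2 : T2 -> T2')
    (D1 G1 : set T1) (D2 G2 : set T2) (D1' G1' : set T1') (D2' G2' : set T2') k :
  continuous a -> continuous a' -> continuous f1 -> continuous f2 ->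
  (forall x, D1 x -> D2 (a x)) -> (forall x, G1 x -> G2 (a x)) ->
  (forall x, D1' x -> D2' (a' x)) -> (forall x, G1' x -> G2' (a' x)) ->
  (forall x, D1 x -> D1' (f1 x)) -> (forall x, G1 x -> G1' (f1 x)) ->
  (forall x, D2 x -> D2' (f2 x)) -> (forall x, G2 x -> G2' (f2 x)) ->
  f2 \o a = a' \o f1 ->
  @hiso (Hrel D1 G1 k) (Hrel D2 G2 k) (@spush R _ _ a k) ->
  @hiso (Hrel D1' G1' k) (Hrel D2' G2' k) (@spush R _ _ a' k) ->
  @hiso (Hrel D1 G1 k) (Hrel D1' G1' k) (@spush R _ _ f1 k) <->
  @hiso (Hrel D2 G2 k) (Hrel D2' G2' k) (@spush R _ _ f2 k).
Proof.
move=> ca ca' c1 c2 aD aG aD' aG' f1D f1G f2D f2G e ia ia'.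
have ma := spush_hmor k ca aD aG; have ma' := spush_hmor k ca' aD' aG'.
have m1 := spush_hmor k c1 f1D f1G; have m2 := spush_hmor k c2 f2D f2G.
have z1 : exists x : Hrel D2 G2 k, bnd x by exists 0; exact: rbnd0.
have z2 : exists x : Hrel D2' G2' k, bnd x by exists 0; exact: rbnd0.
apply: (isorel_transfer (isorel_graph ma z1 ia) (isorel_graph ma' z2 ia') m1 m2).
by move=> x y ->; rewrite /= !spush_comp e.
Qed.

Lemma incl_square T T' (f : T -> T')
    (D1 G1 D2 G2 : set T) (D1' G1' D2' G2' : set T') k : continuous f ->
  D1 `<=` D2 -> G1 `<=` G2 -> D1' `<=` D2' -> G1' `<=` G2' ->
  (forall x, D1 x -> D1' (f x)) -> (forall x, G1 x -> G1' (f x)) ->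
  (forall x, D2 x -> D2' (f x)) -> (forall x, G2 x -> G2' (f x)) ->
  @hiso (Hrel D1 G1 k) (Hrel D2 G2 k) id ->
  @hiso (Hrel D1' G1' k) (Hrel D2' G2' k) id ->
  @hiso (Hrel D1 G1 k) (Hrel D1' G1' k) (@spush R _ _ f k) <->
  @hiso (Hrel D2 G2 k) (Hrel D2' G2' k) (@spush R _ _ f k).
Proof.
move=> cf d g d' g' h1 h2 h3 h4 /hiso_spush_id i1 /hiso_spush_id i2.
have ci U : continuous (id : U -> U) by exact: cts_id.
exact: (map_square (ci T) (ci T') cf cf d g d' g' h1 h2 h3 h4 _ i1 i2).
Qed.

End RelativeHomology.

(** * Comparison with the formal chains of the statement *)

Section FormalChains.
Variable R : realType.
Implicit Types (T U : topologicalType) (k : nat).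

Definition chn T k (c : chain R T k) : Ch R T k := \sum_(p <- c) p.1 *: nsimp p.2.

Lemma chn_cons T k p (c : chain R T k) : chn (p :: c) = p.1 *: nsimp p.2 + chn c.
Proof. by rewrite /chn big_cons. Qed.

Lemma chn_cat T k (c c' : chain R T k) : chn (c ++ c') = chn c + chn c'.
Proof. by rewrite /chn big_cat. Qed.

Lemma nsimp_inj T k (s s' : sing_simplex R T k) :
  (s \o @retr R k == s' \o @retr R k) = `[< simplex_eq s s' >].
Proof.
apply/eqP/asboolP => [e t ht|h].
  by have := congr1 (fun g => g t) e; rewrite /= retr_id.
by apply: funext => t /=; apply: h; exact: retr_simplex.
Qed.

Lemma coeff_chn T k (c : chain R T k) (s : sing_simplex R T k) :
  coeff (s \o @retr R k : sing_simplex R T k) (chn c) = coef c s.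
Proof.
elim: c => [|p c IH]; first by rewrite /chn /coef !big_nil coeff0.
rewrite chn_cons coeffD IH /coef big_cons; congr (_ + _).
rewrite coeffZ /nsimp coeffU mul1r nsimp_inj.
by case: ifP => _; rewrite ?mulr1 ?mulr0.
Qed.

Lemma chn_eq T k (c c' : chain R T k) :
  (forall s, coef c s = coef c' s) <-> chn c = chn c'.
Proof.
split=> [h|h s]; last by rewrite -!coeff_chn h.
apply/eqP/freeg_eqP => x.
(* Generators not fixed by the retraction have coefficient 0 in every [chn]; for the others the
   coefficient is [coef]. *)
have [e|ne] := pselect (x \o @retr R k = x).
  by rewrite -e !coeff_chn h.
have z (d : chain R T k) : coeff x (chn d) = 0.
  elim: d => [|p d IH]; first by rewrite /chn big_nil coeff0.
  rewrite chn_cons coeffD IH addr0 coeffZ /nsimp coeffU mul1r.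
  case: eqP => [e|]; last by rewrite mulr0.
  case: ne; rewrite -e; apply: funext => t /=; rewrite retr_id //; exact: retr_simplex.
by rewrite !z.
Qed.

Lemma chn_eq0 T k (c : chain R T k) : (forall s, coef c s = 0) <-> chn c = 0.
Proof.
have e : chn ([::] : chain R T k) = 0 by rewrite /chn big_nil.
rewrite -e -chn_eq; split=> h s; first by rewrite h /coef big_nil.
by rewrite h /coef big_nil.
Qed.

Lemma chn_bd T k (c : chain R T k.+1) : chn (bd c) = sbd (chn c).
Proof.
rewrite /chn /bd big_flatten /= big_map linear_sum; apply: eq_bigr => p _.
rewrite big_map linearZ /= sbd_nsimp scaler_sumr big_enum /=.
by apply: eq_bigr => i _; rewrite scalerA mulrC.
Qed.

Lemma chn_push T U (f : T -> U) k (c : chain R T k) : chn (push f c) = spush f (chn c).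
Proof.
rewrite /chn /push big_map linear_sum; apply: eq_bigr => p _.
rewrite linearZ /= spush_gen; congr (_ *: _); apply: nsimp_eq => t ht /=.
by rewrite retr_id.
Qed.

Lemma chn_sub T k (c c' : chain R T k) : chn (chain_sub c c') = chn c - chn c'.
Proof.
rewrite /chain_sub chn_cat; congr (_ + _).
rewrite /chn big_map -sumrN; apply: eq_bigr => p _; exact: scaleNr.
Qed.

(** The retraction is continuous with values in the simplex, so continuity within the simplex
    becomes continuity everywhere after composing with it. *)
Lemma is_sing_nsimp T (A : set T) k (s : sing_simplex R T k) : is_sing A s -> C A (nsimp s).
Proof.
move=> [cs As]; apply: gspan_gen; split.
- move=> x; apply: (@cvg_comp _ _ _ (@retr R k) s (nbhs x) (within (@stdsimplex R k) (nbhs (retr x)))).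
    move=> B hB; rewrite nbhs_filterE /=.
    have := retr_cts hB; rewrite nbhs_filterE /=.
    by apply: filterS => y; apply; exact: retr_simplex.
  by move/subspace_continuousP: cs; apply; exact: retr_simplex.
- by move=> t; apply: As; exists (retr t) => //; exact: retr_simplex.
- by apply: funext => t /=; rewrite retr_id //; exact: retr_simplex.
Qed.

Lemma chn_in T (A : set T) k (c : chain R T k) : chain_in A c -> C A (chn c).
Proof.
elim: c => [|p c IH] h; first by rewrite /chn big_nil; exact: gspan0.
rewrite chn_cons; apply: gspanD.
  by apply: gspanZ; apply: is_sing_nsimp; apply: h; left.
by apply: IH => q hq; apply: h; right.
Qed.

Lemma chn_surj T (A : set T) k (z : Ch R T k) : C A z ->
  exists2 c : chain R T k, chain_in A c & chn c = z.
Proof.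
move=> hz; exists [seq (coeff s z, s : sing_simplex R T k) | s <- dom z].
  move=> p /List.in_map_iff [s [<- hs]].
  have /hz [cs As _] : s \in dom z.
    elim: (dom z) hs => //= x l IH [->|/IH]; rewrite inE ?eqxx // => ->; exact: orbT.
  split; last by move=> _ [t _ <-].
  exact: continuous_subspaceT.
rewrite /chn big_map -[RHS]freeg_sumE [LHS]big_seq [RHS]big_seq; apply: eq_bigr => s /hz hs /=.
by rewrite (nsimp_id hs) -genZ.
Qed.

Lemma is_cycle_chn T k (c : chain R T k) : is_cycle c <-> bdy (chn c) = 0.
Proof.
case: k c => [|k] c //=; rewrite chn_eq0 chn_bd //.
Qed.

Lemma is_boundary_chn T (A : set T) k (c : chain R T k) :
  is_boundary A c <-> exists y, C A y /\ chn c = sbd y.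
Proof.
split=> [[b [hb /chn_eq e]]|[y [hy e]]].
  by exists (chn b); split; [exact: chn_in | rewrite -chn_bd].
have [b hb eb] := chn_surj hy; exists b; split=> //.
by apply/chn_eq; rewrite chn_bd eb.
Qed.

Lemma rbnd_abs T (A : set T) k (z : Ch R T k) :
  rbnd A set0 z <-> exists y, C A y /\ z = sbd y.
Proof.
split=> [[y [hy /C_set0 /subr0_eq e]]|[y [hy ->]]]; first by exists y.
exact: sbd_rbnd.
Qed.

Lemma homology_isoP T U (A : set T) (B : set U) (f : T -> U) k :
  @hiso (Hrel R A set0 k) (Hrel R B set0 k) (@spush R T U f k) -> homology_iso R A B f k.
Proof.
move=> [inj surj]; split.
- move=> z hz /is_cycle_chn cz /is_boundary_chn bz; apply/is_boundary_chn/rbnd_abs.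
  apply: inj; first by split; [exact: chn_in | rewrite cz; exact: gspan0].
  by rewrite chn_push in bz; apply/rbnd_abs.
- move=> z' hz' /is_cycle_chn cz'.
  have [|x [Ax x0] /rbnd_abs bx] := surj (chn z').
    by split; [exact: chn_in | rewrite cz'; exact: gspan0].
  have [z hz ez] := chn_surj Ax; exists z; split=> //.
    by apply/is_cycle_chn; rewrite ez; exact: C_set0 x0.
  by apply/is_boundary_chn; rewrite chn_sub chn_push ez.
Qed.

End FormalChains.

(** * The slice of tuples divisible by X^n *)

(* The scalar fields R and R[i] over the real field R, uniformly: the embedding
   of R, the real-valued modulus, and the real coordinates. *)
Record kdata (R : realType) (K : numFieldType) := KData {
  kemb : {rmorphism R -> K};
  knrm : K -> R;
  kdim : nat;
  kco : 'I_kdim -> K -> R;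
  kba : 'I_kdim -> K;
  kreal : forall x : K, x \is Num.real -> exists t, x = kemb t;
  kemb_le : {mono kemb : x y / x <= y};
  knrmE : forall z, kemb (knrm z) = `|z|;
  kcoD : forall a z w, kco a (z + w) = kco a z + kco a w;
  kcoZ : forall a t z, kco a (kemb t * z) = t * kco a z;
  kco_le : forall a z, `|kco a z| <= knrm z;
  kco_ba : forall a b, kco a (kba b) = (a == b)%:R;
  kco_eq0 : forall z, (forall a, kco a z = 0) -> z = 0 }.

Arguments kco [R K] k a z.
Arguments kba [R K] k a.
Arguments kcoD [R K] k a z w.
Arguments kcoZ [R K] k a t z.
Arguments kco_le [R K] k a z.
Arguments kco_ba [R K] k a b.
Arguments kco_eq0 [R K] k z.
Arguments knrmE [R K] k z.
Arguments kreal [R K] k x.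
Arguments kemb_le [R K] k.

(** * Real-valued metrics over the scalar field *)

Section KData.
Variables (R : realType) (K : numFieldType) (kd : kdata R K).
Implicit Types (z w : K) (t s : R).
Local Notation emb := (kemb kd).
Local Notation nrm := (knrm kd).

Lemma emb_lt : {mono emb : x y / x < y}.
Proof. exact: leW_mono (kemb_le kd). Qed.

Lemma emb_inj : injective emb.
Proof. exact: fmorph_inj. Qed.

Lemma nrm_ge0 z : 0 <= nrm z.
Proof. by rewrite -(kemb_le kd) knrmE rmorph0. Qed.

Lemma nrm0 : nrm 0 = 0.
Proof. by apply: emb_inj; rewrite knrmE rmorph0 normr0. Qed.

Lemma nrmD z w : nrm (z + w) <= nrm z + nrm w.
Proof. by rewrite -(kemb_le kd) rmorphD !knrmE ler_normD. Qed.

Lemma nrmN z : nrm (- z) = nrm z.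
Proof. by apply: emb_inj; rewrite !knrmE normrN. Qed.

Lemma nrmB z w : nrm (z - w) = nrm (w - z).
Proof. by rewrite -nrmN opprB. Qed.

Lemma nrmM z w : nrm (z * w) = nrm z * nrm w.
Proof. by apply: emb_inj; rewrite rmorphM !knrmE normrM. Qed.

Lemma nrm_emb t : nrm (emb t) = `|t|.
Proof.
apply: emb_inj; rewrite knrmE; case: (leP 0 t) => h.
  by rewrite !ger0_norm // -(rmorph0 emb) kemb_le.
rewrite !ltr0_norm ?rmorphN // -(rmorph0 emb) emb_lt //.
Qed.

Lemma kco0 a : kco kd a 0 = 0 :> R.
Proof. by apply/(addrI (kco kd a 0)); rewrite -kcoD !addr0. Qed.

Lemma kcoN a z : kco kd a (- z) = - kco kd a z.
Proof. by apply/(addrI (kco kd a z)); rewrite -kcoD !subrr kco0. Qed.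

Lemma kcoB a z w : kco kd a (z - w) = kco kd a z - kco kd a w.
Proof. by rewrite kcoD kcoN. Qed.

Lemma nbhs_nrm z (A : set K) : nbhs z A ->
  exists2 e : R, 0 < e & forall w, nrm (z - w) < e -> A w.
Proof.
move=> /nbhs_ballP [e /= e0 h].
have [t et] := kreal kd _ (gtr0_real e0).
exists t; first by rewrite -emb_lt rmorph0 -et.
by move=> w hw; apply: h; rewrite /ball /= -(knrmE kd) et emb_lt.
Qed.

Lemma nrm_nbhs z (e : R) : 0 < e -> \forall w \near z, nrm (z - w) < e.
Proof.
move=> e0; apply/nbhs_ballP; exists (emb e) => /=.
  by rewrite -(rmorph0 emb) emb_lt.
by move=> w; rewrite /ball /= -(knrmE kd) emb_lt.
Qed.

Section MatrixMetric.
Variables (m d : nat).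
Implicit Types M N : 'M[K]_(m, d).

Definition mdist M N : R := \sum_i \sum_j nrm (M i j - N i j).

Lemma mdist_ge0 M N : 0 <= mdist M N.
Proof. by do 2!apply: sumr_ge0 => ? _; exact: nrm_ge0. Qed.

Lemma mdistC M N : mdist M N = mdist N M.
Proof. by apply: eq_bigr => i _; apply: eq_bigr => j _; exact: nrmB. Qed.

Lemma mdist_refl M : mdist M M = 0.
Proof. by rewrite /mdist; under eq_bigr do under eq_bigr do rewrite subrr nrm0; rewrite !big1 // => i _; rewrite big1. Qed.

Lemma mdist_triangle N M P : mdist M P <= mdist M N + mdist N P.
Proof.
rewrite -big_split /=; apply: ler_sum => i _; rewrite -big_split /=.
apply: ler_sum => j _; rewrite -(subrKA (N i j) (M i j)); exact: nrmD.
Qed.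

Lemma mdist_entry M N i j : nrm (M i j - N i j) <= mdist M N.
Proof.
rewrite /mdist (bigD1 i) //= (bigD1 j) //= -addrA lerDl addr_ge0 //.
  by apply: sumr_ge0 => ? _; exact: nrm_ge0.
by do 2!apply: sumr_ge0 => ? _; exact: nrm_ge0.
Qed.

Lemma nbhs_mdist M (A : set 'M[K]_(m, d)) : nbhs M A ->
  exists2 e : R, 0 < e & forall N, mdist M N < e -> A N.
Proof.
move=> [P hP sPA].
have [e he] : exists e : 'I_m -> 'I_d -> R, forall i j, 0 < e i j /\
    forall w, nrm (M i j - w) < e i j -> P i j w.
  have h1 i : exists f : 'I_d -> R, forall j, 0 < f j /\
      forall w, nrm (M i j - w) < f j -> P i j w.
    have h2 j : exists f : R, 0 < f /\ forall w, nrm (M i j - w) < f -> P i j w.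
      by have [f f0 hf] := nbhs_nrm (hP i j); exists f.
    by have [f hf] := choice h2; exists f.
  by have [f hf] := choice h1; exists f.
pose e0 := \big[Num.min/1]_i \big[Num.min/1]_j e i j.
exists e0.
  rewrite /e0; elim/big_ind: _ => [|x y hx hy|i _]; rewrite ?ltr01 ?lt_min ?hx //.
  by elim/big_ind: _ => [|x y hx hy|j _]; rewrite ?ltr01 ?lt_min ?hx //; have [] := he i j.
move=> N hN; apply: sPA => i j; apply: (he i j).2.
apply: le_lt_trans (mdist_entry _ _ i j) _; apply: lt_le_trans hN _.
rewrite /e0 (bigD1 i) //= ge_min; apply/orP; left.
by rewrite (bigD1 j) //= ge_min lexx.
Qed.

Lemma lipschitz_cts (f : 'M[K]_(m, d) -> R) (c : R) :
  (forall M N, `|f M - f N| <= c * mdist M N) -> continuous f.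
Proof.
move=> hf M A /nbhs_ballP [e /= e0 he].
(* Adding 1 here and in [s0] keeps the divisors positive even if [c], [m] or [d] vanishes. *)
have c0 : 0 < `|c| + 1 by rewrite ltr_pwDr.
have [e1 h1] : exists e1 : R, 0 < e1 /\ forall N, (forall i j, nrm (M i j - N i j) < e1) ->
    mdist M N < e / (`|c| + 1).
  have s0 : 0 < (m%:R * d%:R + 1 : R) by rewrite ltr_wpDl // -natrM ler0n.
  pose e' := e / (`|c| + 1) / (m%:R * d%:R + 1).
  have e'0 : 0 < e' by rewrite !divr_gt0.
  exists e'; split=> // N hN.
  apply: le_lt_trans (_ : \sum_(i < m) \sum_(j < d) e' < _).
    by do 2!(apply: ler_sum => ? _); apply: ltW; exact: hN.
  have eX : e / (`|c| + 1) = m%:R * d%:R * e' + e'.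
    transitivity ((m%:R * d%:R + 1) * e'); last by rewrite mulrDl mul1r.
    by rewrite [RHS]mulrC divfK // gt_eqF.
  under eq_bigr do rewrite sumr_const card_ord.
  by rewrite sumr_const card_ord -mulrnA -mulr_natl mulnC natrM eX ltrDl.
have hM : nbhs M [set N : 'M[K]_(m, d) | forall i j, nrm (M i j - N i j) < e1].
  have [e10 _] := h1.
  exists (fun i j => [set w | nrm (M i j - w) < e1]) => // i j; exact: nrm_nbhs.
apply: (filterS _ hM) => N hN; apply: he; rewrite /ball /=.
apply: le_lt_trans (hf _ _) _.
apply: le_lt_trans (_ : `|c| * mdist M N < _).
  by apply: ler_wpM2r; [exact: mdist_ge0 | exact: ler_norm].
apply: le_lt_trans (_ : (`|c| + 1) * mdist M N < _).
  by apply: ler_wpM2r; [exact: mdist_ge0 | rewrite lerDl].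
by rewrite mulrC -ltr_pdivlMr //; exact: h1.2.
Qed.

(* Truncated distance to the complement of W. *)
Definition gap (W : set 'M[K]_(m, d)) M : R :=
  inf ([set 1] `|` [set mdist M N | N in ~` W]).

Lemma gap_has_inf W M : has_inf ([set (1 : R)] `|` [set mdist M N | N in ~` W]).
Proof.
split; first by exists 1; left.
by exists 0 => _ [->|[N _ <-]]; [exact: ler01 | exact: mdist_ge0].
Qed.

Lemma gap_le W M N : ~ W N -> gap W M <= mdist M N.
Proof. by move=> h; apply: ge_inf; [exact: (gap_has_inf W M).2 | right; exists N]. Qed.

Lemma gap_lipschitz1 W M N : gap W M - mdist M N <= gap W N.
Proof.
apply: lb_le_inf; first exact: (gap_has_inf W N).1.
move=> _ [->|[P WP <-]].
  rewrite lerBlDr; apply: le_trans (_ : 1 <= _); last by rewrite lerDl mdist_ge0.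
  by apply: ge_inf; [exact: (gap_has_inf W M).2 | left].
by rewrite lerBlDr addrC; apply: le_trans (gap_le _ WP) _; exact: mdist_triangle.
Qed.

Lemma gap_cts W : continuous (gap W).
Proof.
apply: (@lipschitz_cts _ 1) => M N; rewrite mul1r ler_norml; apply/andP; split.
  by rewrite lerBrDl mdistC; exact: gap_lipschitz1.
by rewrite lerBlDl -lerBlDr; exact: gap_lipschitz1.
Qed.

Lemma gap_gt0 W M : open W -> W M -> 0 < gap W M.
Proof.
move=> oW WM; have : nbhs M W by exact: open_nbhs_nbhs.
move=> /nbhs_mdist [e e0 he].
apply: lt_le_trans (_ : Num.min 1 e <= _); first by rewrite lt_min ltr01.
apply: lb_le_inf; first exact: (gap_has_inf W M).1.
move=> _ [->|[N WN <-]]; first by rewrite ge_min lexx.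
rewrite ge_min; apply/orP; right; rewrite leNgt; apply/negP => hlt; apply: WN; exact: he.
Qed.

Lemma gap_notin W M : ~ W M -> gap W M <= 0.
Proof. by move=> h; rewrite -(mdist_refl M); exact: gap_le. Qed.

End MatrixMetric.

Lemma nrm_lipschitz z w : `|nrm z - nrm w| <= nrm (z - w).
Proof.
rewrite ler_norml; apply/andP; split.
  by rewrite lerBrDl lerBlDr nrmB -{1}(subrK z w) [leRHS]addrC; exact: nrmD.
by rewrite lerBlDr -{1}(subrK w z); exact: nrmD.
Qed.

Lemma nrm_lipschitz_cts (f : K -> R) :
  (forall z w, `|f z - f w| <= nrm (z - w)) -> continuous f.
Proof.
move=> hf z A /nbhs_ballP [e /= e0 he].
apply: (filterS _ (nrm_nbhs z e0)) => w hw; apply: he; rewrite /ball /=.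
exact: le_lt_trans (hf _ _) hw.
Qed.

Lemma nrm_cts : continuous nrm.
Proof. by apply: nrm_lipschitz_cts; exact: nrm_lipschitz. Qed.

Lemma kco_cts a : continuous (kco kd a).
Proof. by apply: nrm_lipschitz_cts => z w; rewrite -kcoB; exact: kco_le. Qed.

Lemma emb_cts : continuous emb.
Proof.
move=> t A /nbhs_nrm [e e0 he].
rewrite nbhs_filterE /=; apply/nbhs_ballP; exists e => // s hs; apply: he.
by rewrite -rmorphB nrm_emb.
Qed.

End KData.

Section Slice.
Variables (R : realType) (K : numFieldType) (kd : kdata R K) (m n : nat).
Local Notation emb := (kemb kd).
Local Notation nrm := (knrm kd).
Local Notation dist := (mdist kd).

Section Tube.
Variable d : nat.
Implicit Types (M : 'M[K]_(m, d)) (W : set 'M[K]_(m, d)).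

(* lowz p: the first p real coordinates of the columns of index < n vanish,
   the coordinates being listed column by column. *)
Definition lowz p : set 'M[K]_(m, d) :=
  [set M | forall (i : 'I_m) (j : 'I_d) (a : 'I_(kdim kd)), (j < n)%N ->
     ((j * m + i) * kdim kd + a < p)%N -> kco kd a (M i j) = 0].

Definition slice : set 'M[K]_(m, d) :=
  [set M | forall (i : 'I_m) (j : 'I_d), (j < n)%N -> M i j = 0].

Definition high M : 'M[K]_(m, d) := \matrix_(i, j) if (j < n)%N then 0 else M i j.

(* A tubular neighbourhood of slice n W inside the open set W. *)
Definition tube W : set 'M[K]_(m, d) :=
  [set M | dist M (high M) < gap kd W (high M)].

Lemma high_cts : continuous high.
Proof.
apply: cts_mx => i j; under eq_fun do rewrite mxE.
by case: (j < n)%N; [exact: cts_cst | exact: coord_continuous].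
Qed.

Lemma high_id M : slice M -> high M = M.
Proof. by move=> h; apply/matrixP => i j; rewrite mxE; case: ifP => // /h ->. Qed.

Lemma high_slice M : slice (high M).
Proof. by move=> i j jn; rewrite mxE jn. Qed.

Lemma lowz_slice : slice = lowz (n * m * kdim kd).
Proof.
apply/seteqP; split=> M hM i j.
  by move=> a jn _; rewrite hM // kco0.
move=> jn; apply: (kco_eq0 kd) => a; apply: hM => //.
have h1 : (j * m + i < n * m)%N.
  by rewrite (@leq_trans (j.+1 * m)) ?leq_mul2r ?jn ?orbT // mulSn addnC ltn_add2r.
rewrite (@leq_trans ((j * m + i).+1 * kdim kd)) ?leq_mul2r ?h1 ?orbT //.
by rewrite mulSn addnC ltn_add2r.
Qed.

Lemma lowz0 : lowz 0 = setT.
Proof. by apply/seteqP; split. Qed.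

Lemma closed_lowz p : closed (lowz p).
Proof.
rewrite (_ : lowz p = \bigcap_(x in [set x : 'I_m * 'I_d * 'I_(kdim kd) |
    (x.1.2 < n)%N && ((x.1.2 * m + x.1.1) * kdim kd + x.2 < p)%N])
    [set M | kco kd x.2 (M x.1.1 x.1.2) = 0]); last first.
  apply/seteqP; split=> M hM.
    by move=> [[i j] a] /= /andP [h1 h2]; exact: hM.
  by move=> i j a h1 h2; apply: (hM (i, j, a)); rewrite /= h1.
apply: closed_bigI => -[[i j] a] _ /=.
have c : continuous (fun M : 'M[K]_(m, d) => kco kd a (M i j)).
  by apply: cts_comp; [exact: kco_cts | exact: coord_continuous].
exact: (cts_closed c (@closed_eq R 0)).
Qed.

Lemma closed_slice : closed slice.
Proof. by rewrite lowz_slice; exact: closed_lowz. Qed.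

Lemma dist_high_cts : continuous (fun M => dist M (high M)).
Proof.
apply: cts_sum => i _; apply: cts_sum => j _.
apply: (cts_comp (f := nrm)); first exact: nrm_cts.
apply: ctsB; first exact: coord_continuous.
by apply: cts_entry; exact: high_cts.
Qed.

Lemma gap_high_cts W : continuous (fun M => gap kd W (high M)).
Proof. by apply: cts_comp; [exact: gap_cts | exact: high_cts]. Qed.

Lemma open_tube W : open (tube W).
Proof.
have c : continuous (fun M => gap kd W (high M) - dist M (high M)).
  by apply: ctsB; [exact: gap_high_cts | exact: dist_high_cts].
rewrite (_ : tube W = (fun M => gap kd W (high M) - dist M (high M)) @^-1` [set x | 0 < x]).
  exact: (cts_open c (@open_gt R 0)).
by apply/seteqP; split=> M; rewrite /tube /= subr_gt0.
Qed.

Lemma tube_sub W : tube W `<=` W.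
Proof.
move=> M hM; apply: contrapT => /(@gap_le _ _ kd _ _ W (high M)).
by rewrite mdistC leNgt => /negP; apply.
Qed.

Lemma tube_gap W M : tube W M -> 0 < gap kd W (high M).
Proof. by apply: le_lt_trans; exact: mdist_ge0. Qed.

Lemma tube_high W M : tube W M -> W (high M).
Proof.
move=> /tube_gap h; apply: contrapT => /(gap_notin kd).
by rewrite leNgt h.
Qed.

Lemma tube_slice W : open W -> tube W `&` slice = W `&` slice.
Proof.
move=> oW; apply/seteqP; split=> M [hM sM]; split=> //; first exact: tube_sub hM.
by rewrite /tube /= high_id // mdist_refl; exact: gap_gt0.
Qed.

(* Contract the low columns and push along the (i0, j0) entry. *)
Definition push_low (c : 'M[K]_(m, d) -> K) (i0 : 'I_m) (j0 : 'I_d) (s : R) M : 'M[K]_(m, d) :=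
  \matrix_(i, j) (M i j - emb s * (M i j - high M i j)
                  + emb s * (c M * ((i == i0) && (j == j0))%:R)).

Lemma push_low_cts c i0 j0 : continuous c ->
  continuous (fun p : R * 'M[K]_(m, d) => push_low c i0 j0 p.1 p.2).
Proof.
move=> cc; apply: cts_mx => i j; rewrite /push_low; under eq_fun do rewrite mxE.
have ce : continuous (fun p : R * 'M[K]_(m, d) => emb p.1).
  by apply: cts_comp; [exact: emb_cts | exact: cts_fst].
have cM : continuous (fun p : R * 'M[K]_(m, d) => p.2 i j).
  by apply: cts_entry; exact: cts_snd.
have ch : continuous (fun p : R * 'M[K]_(m, d) => high p.2 i j).
  apply: cts_entry; apply: cts_comp; [exact: high_cts | exact: cts_snd].
apply: ctsD; first by apply: ctsB => //; apply: ctsM => //; exact: ctsB.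
apply: ctsM => //; apply: ctsM; last exact: cts_cst.
by apply: cts_comp => //; exact: cts_snd.
Qed.

Lemma high_push_low c i0 (j0 : 'I_d) s M : (j0 < n)%N -> high (push_low c i0 j0 s M) = high M.
Proof.
move=> jn; apply/matrixP => i j; rewrite !mxE; case: ifP => // nj.
rewrite nj subrr mulr0 subr0; case: (j =P j0) => [e|]; last by rewrite andbF !mulr0 addr0.
by rewrite e jn in nj.
Qed.

Lemma push_low_low c i0 (j0 : 'I_d) s M i (j : 'I_d) : (j < n)%N ->
  push_low c i0 j0 s M i j = emb (1 - s) * M i j + emb s * (c M * ((i == i0) && (j == j0))%:R).
Proof. by move=> jn; rewrite !mxE jn subr0 rmorphB rmorph1 mulrBl mul1r. Qed.

Lemma push_low_dist c i0 (j0 : 'I_d) s M : 0 <= s <= 1 ->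
  dist (push_low c i0 j0 s M) (high M) <= (1 - s) * dist M (high M) + s * nrm (c M).
Proof.
move=> /andP [s0 s1].
apply: le_trans (_ : \sum_i \sum_j ((1 - s) * nrm (M i j - high M i j)
    + s * (nrm (c M) * ((i == i0) && (j == j0))%:R)) <= _).
  apply: ler_sum => i _; apply: ler_sum => j _.
  have -> : push_low c i0 j0 s M i j - high M i j =
      emb (1 - s) * (M i j - high M i j) + emb s * (c M * ((i == i0) && (j == j0))%:R).
    by rewrite [push_low _ _ _ _ _ _ _]mxE rmorphB rmorph1; ring.
  apply: le_trans (nrmD kd _ _) _; rewrite !nrmM !nrm_emb !ger0_norm ?subr_ge0 //.
  apply: lerD => //; apply: ler_wpM2l => //; apply: ler_wpM2l; first exact: nrm_ge0.
  by case: (_ && _); rewrite ?nrm0 // -(rmorph1 emb) nrm_emb normr1.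
under eq_bigr do rewrite big_split /=.
rewrite big_split /=; apply: lerD.
  rewrite /mdist mulr_sumr; apply: ler_sum => i _; rewrite mulr_sumr.
  by apply: ler_sum => j _.
rewrite (bigD1 i0) //= (bigD1 j0) //= !eqxx mulr1 !big1 ?addr0 //.
- by move=> i /negPf ->; rewrite big1 // => j _; rewrite !mulr0.
- by move=> j /negPf ->; rewrite andbF !mulr0.
Qed.

End Tube.
End Slice.

(** * Deformations of the tube around the slice *)

Section SliceIso.
Variables (R : realType) (K : numFieldType) (kd : kdata R K) (m n : nat).
Local Notation emb := (kemb kd).
Local Notation nrm := (knrm kd).
Local Notation dist := (mdist kd).
Local Notation lowz := (@lowz R K kd m n _).
Local Notation slice := (@slice K m n _).
Local Notation tube := (@tube R K kd m n _).

Section Tube.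
Variable d : nat.
Implicit Types (M : 'M[K]_(m, d)) (W : set 'M[K]_(m, d)).

(** The push leaves [high M], hence the gap, unchanged. The distance to it stays below a convex
    combination of the old distance and half the gap. *)
Lemma push_low_tube W c i0 (j0 : 'I_d) s M : (j0 < n)%N -> 0 <= s <= 1 ->
  nrm (c M) <= gap kd W (high n M) / 2 -> tube W M -> tube W (push_low kd n c i0 j0 s M).
Proof.
move=> jn hs hc hM; rewrite /tube /= high_push_low //.
apply: le_lt_trans (push_low_dist kd n c i0 j0 M hs) _.
have g0 := tube_gap hM; move: hM hs; rewrite /tube /=.
set g := gap _ _ _ in hc g0 *; set x := dist _ _ => xg /andP [s0 s1].
have h1 : s * nrm (c M) <= s * (g / 2) by exact: ler_wpM2l.
have h2 : (1 - s) * x <= (1 - s) * g by apply: ler_wpM2l; [rewrite subr_ge0 | exact: ltW].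
have [s0'|s0'] := eqVneq s 0; first by rewrite s0' subr0 mul1r mul0r addr0.
have sp : 0 < s by rewrite lt_neqAle eq_sym s0'.
apply: le_lt_trans (lerD h2 h1) _.
have : 0 < s * g by rewrite mulr_gt0.
by rewrite mulrBl mul1r mulrA; set y := s * g; lra.
Qed.

Lemma tube_deform W : open W -> acyc R (tube W) (W `&` slice).
Proof.
move=> oW.
(* If the matrix has no entry in a column of index below [n], the slice is everything and there is
   nothing to contract. *)
have [[[i0 j0] /= jn]|none] := pselect (exists p : 'I_m * 'I_d, (p.2 < n)%N); last first.
  move=> k z [hz _]; apply: C_rbnd; apply: sub_C hz => N hN; split; first exact: tube_sub hN.
  by move=> i j jn; case: none; exists (i, j).
pose h := push_low kd n (fun _ : 'M[K]_(m, d) => 0) i0 j0.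
apply: (homotopy_acyc (h := h)).
- by apply: push_low_cts; exact: cts_cst.
- by move=> M; apply/matrixP => i j; rewrite mxE rmorph0 !mul0r subr0 addr0.
- move=> s M hs hM; apply: push_low_tube => //.
  by rewrite nrm0 divr_ge0 // ltW // (tube_gap hM).
- move=> s M hs [WM sM]; suff -> : h s M = M by [].
  by apply/matrixP => i j; rewrite mxE (high_id sM) subrr mul0r !mulr0 subr0 addr0.
- move=> M hM; suff -> : h 1 M = high n M by split; [exact: tube_high hM | exact: high_slice].
  by apply/matrixP => i j; rewrite mxE rmorph1 mul0r !mul1r addr0 subKr.
Qed.

(** When [p] is the index of the coordinate (i0, j0, a0), the halves for [sg] and [- sg] cover
    [lowz p] and meet in [lowz p.+1]: one step of the Thom isomorphism. *)
Definition side p (i0 : 'I_m) (j0 : 'I_d) (a0 : 'I_(kdim kd)) (sg : R) : set 'M[K]_(m, d) :=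
  [set M | lowz p M /\ 0 <= sg * kco kd a0 (M i0 j0)].

Lemma closed_side p i0 j0 a0 sg : closed (side p i0 j0 a0 sg).
Proof.
apply: closedI; first exact: closed_lowz.
have c : continuous (fun M : 'M[K]_(m, d) => sg * kco kd a0 (M i0 j0)).
  apply: ctsM; first exact: cts_cst.
  by apply: cts_comp; [exact: kco_cts | exact: coord_continuous].
exact: (cts_closed c (@closed_ge R 0)).
Qed.

Lemma nrm_kba a : 1 <= nrm (kba kd a).
Proof. by apply: le_trans (kco_le kd a _); rewrite kco_ba eqxx ger0_norm. Qed.

Lemma index_inj (i i0 : 'I_m) (a a0 : 'I_(kdim kd)) (j j0 : nat) :
  ((j * m + i) * kdim kd + a = (j0 * m + i0) * kdim kd + a0)%N -> [/\ j = j0, i = i0 & a = a0].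
Proof.
have k0 : (0 < kdim kd)%N by apply: leq_ltn_trans (ltn_ord a).
have m0 : (0 < m)%N by apply: leq_ltn_trans (ltn_ord i).
move=> e.
have ea : a = a0 :> nat.
  by have := congr1 (fun x => x %% kdim kd)%N e; rewrite !modnMDl !modn_small.
have eq : (j * m + i = j0 * m + i0)%N.
  by have := congr1 (fun x => x %/ kdim kd)%N e; rewrite !divnMDl // !divn_small // !addn0.
have ei : i = i0 :> nat.
  by have := congr1 (fun x => x %% m)%N eq; rewrite !modnMDl !modn_small.
have ej : j = j0.
  by have := congr1 (fun x => x %/ m)%N eq; rewrite !divnMDl // !divn_small // !addn0.
by split=> //; exact: val_inj.
Qed.

(** Pushing the coordinate (i0, j0, a0) against the sign [sg] leaves the closed half-space, and a
    point outside never enters it: the other low coordinates are only rescaled and this one only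
    moves away. *)
Lemma tube_push W p (i0 : 'I_m) (j0 : 'I_d) (a0 : 'I_(kdim kd)) (sg : R) : open W -> (j0 < n)%N ->
  sg = 1 \/ sg = -1 -> p = ((j0 * m + i0) * kdim kd + a0)%N ->
  acyc R (tube W) (tube W `\` side p i0 j0 a0 sg).
Proof.
move=> oW jn hsg ep.
have sg2 : sg * sg = 1 by case: hsg => ->; rewrite ?mulr1 ?mulrNN ?mulr1.
have sgn : `|sg| = 1 by case: hsg => ->; rewrite ?normrN normr1.
set e := kba kd a0; have e1 := nrm_kba a0; rewrite -/e in e1.
have e0 : 0 < nrm e by apply: lt_le_trans e1.
(* A multiple of the basis vector [e] of modulus exactly half the gap, the largest that
   [push_low_tube] admits. *)
pose c M := emb (- sg * (gap kd W (high n M) / 2 / nrm e)) * e.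
have cc : continuous c.
  apply: ctsM; last exact: cts_cst.
  apply: (cts_comp (f := emb)); first exact: emb_cts.
  apply: ctsM; first exact: cts_cst.
  apply: ctsM; last exact: cts_cst.
  by apply: ctsM; [exact: gap_high_cts | exact: cts_cst].
pose h := push_low kd n c i0 j0.
have hT s M : 0 <= s <= 1 -> tube W M -> tube W (h s M).
  move=> hs hM; apply: push_low_tube => //.
  have g0 := tube_gap hM.
  rewrite nrmM nrm_emb normrM normrN sgn mul1r ger0_norm ?divr_ge0 ?(ltW g0) ?(ltW e0) //.
  by rewrite divfK // gt_eqF.
have kc M : kco kd a0 (c M) = - sg * (gap kd W (high n M) / 2 / nrm e).
  by rewrite kcoZ kco_ba eqxx mulr1.
have h00 s M : sg * kco kd a0 (h s M i0 j0) =
    (1 - s) * (sg * kco kd a0 (M i0 j0)) - s * (gap kd W (high n M) / 2 / nrm e).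
  rewrite push_low_low // !eqxx mulr1 kcoD 2!kcoZ kc; set G := _ / nrm e.
  by case: hsg => ->; ring.
have h1 M : tube W M -> ~ side p i0 j0 a0 sg (h 1 M).
  move=> hM [_]; rewrite h00 subrr mul0r mul1r add0r oppr_ge0.
  by rewrite leNgt !divr_gt0 // (tube_gap hM).
apply: (homotopy_acyc (h := h)).
- exact: push_low_cts.
- by move=> M; apply/matrixP => i j; rewrite mxE rmorph0 !mul0r subr0 addr0.
- exact: hT.
- move=> s M hs [hM nM]; split; first exact: hT.
  (* At [s = 1] the factor [1 - s] vanishes and the low coordinates of [M] are lost; there the sign
     of the pushed coordinate decides. *)
  have [->|s1] := eqVneq s 1; first exact: h1.
  have {}s1 : 0 < 1 - s by move/andP: hs => [_ s1']; rewrite subr_gt0 lt_neqAle s1.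
  move=> [hlow hge]; apply: nM; split.
    move=> i j a jn' hidx; have := hlow i j a jn' hidx.
    rewrite push_low_low // kcoD !kcoZ.
    have -> : kco kd a (c M * ((i == i0) && (j == j0))%:R) = 0.
      case: eqP => [ei|]; last by rewrite mulr0 kco0.
      case: eqP => [ej|]; last by rewrite mulr0 kco0.
      rewrite mulr1 kcoZ kco_ba; case: eqP => [ea|]; last by rewrite mulr0.
      by move: hidx; rewrite ep ei ej ea ltnn.
    by rewrite mulr0 addr0 => /eqP; rewrite mulf_eq0 gt_eqF //= => /eqP.
  move: hge; rewrite h00 subr_ge0 => hge.
  rewrite -(pmulr_rge0 _ s1); apply: le_trans hge.
  by move/andP: hs => [s0 _]; rewrite mulr_ge0 // !divr_ge0 ?(ltW e0) ?(ltW (tube_gap hM)).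
- move=> M hM; split; last exact: h1.
  by apply: hT => //; rewrite ler01 lexx.
Qed.

Lemma side_setI p (i0 : 'I_m) (j0 : 'I_d) (a0 : 'I_(kdim kd)) : (j0 < n)%N ->
  p = ((j0 * m + i0) * kdim kd + a0)%N ->
  side p i0 j0 a0 1 `&` side p i0 j0 a0 (-1) = lowz p.+1.
Proof.
move=> jn ep; apply/seteqP; split=> M.
  move=> [[lM h1] [_ h2]] i j a jn'; rewrite ltnS leq_eqVlt => /orP [/eqP e|]; last exact: lM.
  have [ej -> ->] := index_inj (etrans e ep); rewrite (val_inj ej : j = j0).
  by apply/eqP; rewrite eq_le -[X in X && _]oppr_ge0 -mulN1r h2 -[X in _ <= X]mul1r h1.
move=> lM; have l p' M' : lowz p'.+1 M' -> lowz p' M'.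
  by move=> h i j a jn' hi; apply: h => //; exact: ltnW.
have z : kco kd a0 (M i0 j0) = 0 by apply: lM => //; rewrite ep.
by split; split; rewrite ?z ?mulr0 //; exact: l.
Qed.

Lemma side_setU p (i0 : 'I_m) (j0 : 'I_d) (a0 : 'I_(kdim kd)) :
  side p i0 j0 a0 1 `|` side p i0 j0 a0 (-1) = lowz p.
Proof.
apply/seteqP; split=> M; first by move=> [[]|[]].
move=> lM; have [h|h] := leP 0 (kco kd a0 (M i0 j0)).
  by left; split=> //; rewrite mul1r.
by right; split=> //; rewrite mulN1r oppr_ge0 ltW.
Qed.

End Tube.
End SliceIso.

(** * The Thom isomorphism of the slice and its naturality *)

Section SliceMap.
Variables (R : realType) (K : numFieldType) (kd : kdata R K) (m n : nat).
Local Notation emb := (kemb kd).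
Local Notation lowz := (@lowz R K kd m n _).
Local Notation slice := (@slice K m n _).
Local Notation tube := (@tube R K kd m n _).
Local Notation side := (@side R K kd m n _).

Lemma sideI d p (i0 : 'I_m) (j0 : 'I_d) (a0 : 'I_(kdim kd)) (sg : R) : (j0 < n)%N ->
  p = ((j0 * m + i0) * kdim kd + a0)%N -> sg = 1 \/ sg = -1 ->
  side p i0 j0 a0 sg `&` side p i0 j0 a0 (- sg) = lowz p.+1.
Proof.
move=> jn ep [->|->]; first exact: side_setI.
by rewrite opprK setIC; exact: side_setI.
Qed.

Lemma sideU d p (i0 : 'I_m) (j0 : 'I_d) (a0 : 'I_(kdim kd)) (sg : R) :
  sg = 1 \/ sg = -1 -> side p i0 j0 a0 sg `|` side p i0 j0 a0 (- sg) = lowz p.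
Proof. by move=> [->|->]; rewrite ?opprK ?(setUC (side _ _ _ _ (-1))); exact: side_setU. Qed.

(** The complements of the two half-spaces intersect in the complement of [lowz p] and cover that of
    [lowz p.+1]. Both are acyclic relative to the tube by [tube_push], so the connecting map trades
    one coordinate for one degree. *)
Lemma tube_connecting d (W : set 'M[K]_(m, d)) p (i0 : 'I_m) (j0 : 'I_d) (a0 : 'I_(kdim kd))
    (sg : R) k : open W -> (j0 < n)%N ->
  p = ((j0 * m + i0) * kdim kd + a0)%N -> sg = 1 \/ sg = -1 ->
  @isorel (Hrel R (tube W) (tube W `\` lowz p) k) (Hrel R (tube W) (tube W `\` lowz p.+1) k.+1)
    (connecting (tube W) (tube W `\` side p i0 j0 a0 sg) (tube W `\` side p i0 j0 a0 (- sg)) (k := k))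
  /\ hzero (Hrel R (tube W) (tube W `\` lowz p.+1) 0).
Proof.
move=> oW jn ep hsg.
have hsg' : - sg = 1 \/ - sg = -1 by case: hsg => ->; [right | left; rewrite opprK].
rewrite -(sideU p i0 j0 a0 hsg) -(sideI jn ep hsg) setDUr setDIr.
set G1 := _ `\` side _ _ _ _ sg; set G2 := _ `\` side _ _ _ _ (- sg).
have oC s : open (~` side p i0 j0 a0 s) by apply: closed_openC; exact: closed_side.
have e1 : G1 = (G1 `|` G2) `&` ~` side p i0 j0 a0 sg.
  by apply/seteqP; split=> M; [move=> [h1 h2]; split=> //; left | move=> [[|[]] ]].
have e2 : G2 = (G1 `|` G2) `&` ~` side p i0 j0 a0 (- sg).
  by apply/seteqP; split=> M; [move=> [h1 h2]; split=> //; right | move=> [[[]|] ]].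
have a1 := tube_push oW jn hsg ep; have a2 := tube_push oW jn hsg' ep.
split; last exact: union_H0 a1.
by apply: (connecting_isorel (oC sg) (oC (- sg)) e1 e2 _ _ a1 a2) => M [].
Qed.

Variables (d d' : nat) (phi : 'M[K]_(m, d) -> 'M[K]_(m, d')).
Variables (sg : R) (lam : 'M[K]_(m, d) -> 'I_m -> R).
Hypotheses (nd : (n <= d)%N) (nd' : (n <= d')%N) (cphi : continuous phi).
Hypotheses (hsg : sg = 1 \/ sg = -1) (lam0 : forall M i, 0 < lam M i).
(** A triangularity condition: once the earlier columns vanish, the next one is rescaled by factors
    of the common sign [sg]. It holds for [stab] with [sg = -1] and for inclusions with [sg = 1]. *)
Hypothesis phi_low : forall (M : 'M[K]_(m, d)) (j : 'I_d) (j' : 'I_d'), j = j' :> nat -> (j < n)%N ->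
  (forall i (j2 : 'I_d), (j2 < j)%N -> M i j2 = 0) ->
  forall i, phi M i j' = emb (sg * lam M i) * M i j.

Lemma index_lt (i i2 : 'I_m) (a a2 : 'I_(kdim kd)) (j2 j : nat) : (j2 < j)%N ->
  ((j2 * m + i2) * kdim kd + a2 < (j * m + i) * kdim kd + a)%N.
Proof.
move=> j20; apply: leq_trans (leq_addr _ _).
apply: (@leq_trans ((j2 * m + i2).+1 * kdim kd)); first by rewrite mulSn addnC ltn_add2r.
rewrite leq_mul2r; apply/orP; right; apply: leq_trans (leq_addr _ _).
apply: (@leq_trans (j2.+1 * m)); first by rewrite mulSn addnC ltn_add2r.
by rewrite leq_mul2r j20 orbT.
Qed.

Lemma lowz_columns p (M : 'M[K]_(m, d)) (i0 : 'I_m) (j0 : 'I_d) (a0 : 'I_(kdim kd)) : (j0 < n)%N ->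
  (((j0 * m + i0) * kdim kd + a0)%N <= p)%N -> lowz p M ->
  forall i (j2 : 'I_d), (j2 < j0)%N -> M i j2 = 0.
Proof.
move=> jn hp lM i j2 j20; apply: (kco_eq0 kd) => a.
by apply: lM; [exact: ltn_trans jn | apply: leq_trans hp; exact: index_lt].
Qed.

Lemma sg2 : sg * sg = 1.
Proof. by case: hsg => ->; rewrite ?mulr1 // mulrNN mulr1. Qed.

Lemma phi_lowz p M : lowz p (phi M) -> lowz p M.
Proof.
move=> lphi; suff h x : forall (j : 'I_d), j = x :> nat -> forall (i : 'I_m) (a : 'I_(kdim kd)), (j < n)%N ->
    ((j * m + i) * kdim kd + a < p)%N -> kco kd a (M i j) = 0.
  by move=> i j a; exact: h.
elim/ltn_ind: x => x IH j jx i a jn hp.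
have jd : (j < d')%N by apply: leq_trans nd'.
have cols i2 (j2 : 'I_d) : (j2 < j)%N -> M i2 j2 = 0.
  move=> j2j; apply: (kco_eq0 kd) => a2; apply: (IH j2) => //.
  - by rewrite -jx.
  - exact: ltn_trans jn.
  - by apply: ltn_trans hp; exact: index_lt.
have := lphi i (Ordinal jd) a jn hp.
rewrite (@phi_low M j (Ordinal jd)) // kcoZ => /eqP; rewrite mulf_eq0.
case/orP => [|/eqP //]; rewrite mulf_eq0 (gt_eqF (lam0 M i)) orbF => /eqP e.
by move: sg2; rewrite e mul0r => /eqP; rewrite eq_sym oner_eq0.
Qed.

Lemma phi_side p (i0 : 'I_m) (j0 : 'I_d) (j0' : 'I_d') (a0 : 'I_(kdim kd)) (s : R) M :
  j0 = j0' :> nat -> (j0 < n)%N -> p = ((j0 * m + i0) * kdim kd + a0)%N ->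
  side p i0 j0' a0 (sg * s) (phi M) -> side p i0 j0 a0 s M.
Proof.
move=> ej jn ep [/phi_lowz lM h]; split=> //; move: h.
rewrite (phi_low ej jn) ?kcoZ; last by apply: (lowz_columns jn _ lM); rewrite ep.
have -> : sg * s * (sg * lam M i0 * kco kd a0 (M i0 j0)) =
    lam M i0 * (s * kco kd a0 (M i0 j0)) by rewrite -[RHS]mul1r -sg2; ring.
by rewrite pmulr_rge0.
Qed.

Lemma lowz_step W W' p k : open W -> open W' -> (p < n * m * kdim kd)%N ->
  (forall M, tube W M -> tube W' (phi M)) ->
  @hiso (Hrel R (tube W) (tube W `\` lowz p) k) (Hrel R (tube W') (tube W' `\` lowz p) k)
    (@spush R _ _ phi k) ->
  @hiso (Hrel R (tube W) (tube W `\` lowz p.+1) k.+1) (Hrel R (tube W') (tube W' `\` lowz p.+1) k.+1)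
    (@spush R _ _ phi k.+1).
Proof.
move=> oW oW' pN TT' hk.
have k0 : (0 < kdim kd)%N by move: pN; case: (kdim kd) => [|//]; rewrite muln0.
have pq : (p %/ kdim kd < n * m)%N by rewrite ltn_divLR.
have m0 : (0 < m)%N by move: pq; case: (m) => [|//]; rewrite muln0.
have qn : (p %/ kdim kd %/ m < n)%N by rewrite ltn_divLR.
pose a0 := Ordinal (ltn_pmod p k0).
pose i0 := Ordinal (ltn_pmod (p %/ kdim kd) m0).
pose j0 := Ordinal (leq_trans qn nd); pose j0' := Ordinal (leq_trans qn nd').
have ep : p = ((j0 * m + i0) * kdim kd + a0)%N by rewrite /= -!divn_eq.
have ep' : p = ((j0' * m + i0) * kdim kd + a0)%N by rewrite /= -!divn_eq.
have [c _] := tube_connecting k oW (qn : (j0 < n)%N) ep (or_introl erefl).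
(* In the target the first half-space is the one of sign [sg]. With this labelling [phi] preserves
   the order of the two halves, and the square commutes without a sign. *)
have [c' _] := tube_connecting k oW' (qn : (j0' < n)%N) ep' hsg.
have mside s M : (tube W `\` side p i0 j0 a0 s) M -> (tube W' `\` side p i0 j0' a0 (sg * s)) (phi M).
  move=> [hM nM]; split; first exact: TT'.
  by move/(phi_side (erefl : j0 = j0' :> nat) qn ep).
have mlow q M : (tube W `\` lowz q) M -> (tube W' `\` lowz q) (phi M).
  by move=> [hM nM]; split; [exact: TT' | move/phi_lowz].
have mf := spush_hmor R k cphi TT' (mlow p).
have mg := spush_hmor R k.+1 cphi TT' (mlow p.+1).
refine (proj1 (isorel_transfer c c' mf mg _) hk).
move=> w z [x1 [x2 [h1 h2 h3 h4 ->]]].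
exists (spush phi x1), (spush phi x2); split.
- exact: (spush_in cphi TT').
- exact: (spush_in cphi TT').
- rewrite sbd_spush -linearB; apply: (spush_in cphi _ h3) => M /mside.
  by rewrite mulr1.
- rewrite sbd_spush -linearB; apply: (spush_in cphi _ h4) => M /mside.
  by rewrite mulrN1.
- exact: (linearB (@spush R _ _ phi k.+1)).
Qed.

Lemma lowz_zero d0 (W : set 'M[K]_(m, d0)) p : (n <= d0)%N -> open W ->
  (p < n * m * kdim kd)%N -> hzero (Hrel R (tube W) (tube W `\` lowz p.+1) 0).
Proof.
move=> nd0 oW pN.
have k0 : (0 < kdim kd)%N by move: pN; case: (kdim kd) => [|//]; rewrite muln0.
have pq : (p %/ kdim kd < n * m)%N by rewrite ltn_divLR.
have m0 : (0 < m)%N by move: pq; case: (m) => [|//]; rewrite muln0.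
have qn : (p %/ kdim kd %/ m < n)%N by rewrite ltn_divLR.
pose a0 := Ordinal (ltn_pmod p k0).
pose i0 := Ordinal (ltn_pmod (p %/ kdim kd) m0).
pose j0 := Ordinal (leq_trans qn nd0).
have ep : p = ((j0 * m + i0) * kdim kd + a0)%N by rewrite /= -!divn_eq.
by have [_] := tube_connecting 0 oW (qn : (j0 < n)%N) ep (or_introl erefl).
Qed.

(** The connecting isomorphisms are composed coordinate by coordinate, down to [lowz 0], which is
    everything. If the degree reaches 0 first, both groups vanish. *)
Lemma lowz_iso W W' p k : open W -> open W' -> (p <= n * m * kdim kd)%N ->
  (forall M, tube W M -> tube W' (phi M)) ->
  ((p <= k)%N -> @hiso (Hrel R (tube W) set0 (k - p)) (Hrel R (tube W') set0 (k - p))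
    (@spush R _ _ phi (k - p))) ->
  @hiso (Hrel R (tube W) (tube W `\` lowz p) k) (Hrel R (tube W') (tube W' `\` lowz p) k)
    (@spush R _ _ phi k).
Proof.
move=> oW oW' + TT'; elim: p k => [|p IH] k pN h.
  by move: h; rewrite subn0 !lowz0 !setDT; apply.
case: k h => [|k] h.
  apply: (@hzero_iso (Hrel R _ _ 0) (Hrel R _ _ 0) (@spush R _ _ phi 0)).
  - by exists 0; exact: rcyc0.
  - exact: lowz_zero.
  - exact: lowz_zero.
apply: lowz_step => //; apply: IH; first exact: ltnW.
by move=> pk; apply: h.
Qed.

(* Naturality of the Thom isomorphism of the slice; degrees below the
   codimension need no hypothesis. *)
Lemma slice_iso W W' k : open W -> open W' -> (forall M, W M -> W' (phi M)) ->
  ((n * m * kdim kd <= k)%N ->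
    @hiso (Hrel R (W `&` slice) set0 (k - n * m * kdim kd))
          (Hrel R (W' `&` slice) set0 (k - n * m * kdim kd)) (@spush R _ _ phi (k - n * m * kdim kd))) ->
  @hiso (Hrel R W (W `\` slice) k) (Hrel R W' (W' `\` slice) k) (@spush R _ _ phi k).
Proof.
move=> oW oW' WW' h.
pose N := (n * m * kdim kd)%N.
(* [phi] need not map the tube of [W] into the tube of [W']. Shrinking [W] to [W1] ensures this and
   keeps the intersection with the slice. *)
pose W1 := W `&` phi @^-1` (tube W').
have oW1 : open W1 by apply: openI => //; apply: cts_open => //; exact: open_tube.
have slice_phi M : slice M -> slice (phi M).
  move=> sM i j' jn; have jd : (j' < d)%N by apply: leq_trans nd.
  rewrite (@phi_low M (Ordinal jd) j') // ?sM ?mulr0 //.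
  by move=> i2 j2 hj; apply: sM; exact: ltn_trans jn.
have sW1 : W1 `&` slice = W `&` slice.
  apply/seteqP; split=> M [hM sM]; split=> //; first by case: hM.
  split=> //=; have : (tube W' `&` slice) (phi M) by rewrite tube_slice //; split; [exact: WW' | exact: slice_phi].
  by case.
have TT' M : tube W1 M -> tube W' (phi M) by move=> /tube_sub [].
(* Excision: a tube around the slice carries the homology of the pair, even if it is built from a
   smaller open set with the same slice. *)
have exc d0 (V U : set 'M[K]_(m, d0)) q : open V -> open U -> U `<=` V -> U `&` slice = V `&` slice ->
    @hiso (Hrel R (tube U) (tube U `\` slice) q) (Hrel R V (V `\` slice) q) id.
  move=> oV oU UV eUV.
  have e1 : tube U `&` (V `\` slice) = tube U `\` slice.
    apply/seteqP; split=> M; first by move=> [h1 [_ h2]].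
    by move=> [h1 h2]; split=> //; split=> //; apply: UV; exact: tube_sub h1.
  have e2 : tube U `|` (V `\` slice) = V.
    apply/seteqP; split=> M; first by move=> [/tube_sub /UV|[]].
    move=> VM; have [sM|nM] := pselect (slice M); last by right.
    have vM : (V `&` slice) M by split.
    by left; move: vM; rewrite -eUV -(tube_slice kd n oU) => -[].
  have oS : open (~` slice : set 'M[K]_(m, d0)) by apply: closed_openC; exact: (closed_slice kd).
  have := @excision R _ (tube U) (V `\` slice) (tube U) (~` slice) (@open_tube R K kd m n d0 U) oS _ _ q.
  rewrite e1 e2; apply.
  - by apply/seteqP; split=> M; [move=> hM; split=> //; apply: UV; exact: tube_sub hM | case].
  - by [].
have def d0 (U : set 'M[K]_(m, d0)) q : open U ->
    @hiso (Hrel R (U `&` slice) set0 q) (Hrel R (tube U) set0 q) id.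
  move=> oU; apply: triple_iso => //; last exact: tube_deform.
  by rewrite -(tube_slice kd n oU) => M [].
have W1W : W1 `<=` W by move=> M [].
have tl d0 (U : set 'M[K]_(m, d0)) : tube U `\` slice `<=` U `\` slice.
  by move=> M [/tube_sub h1 h2].
have sl M : slice (phi M) -> slice M by rewrite !(lowz_slice kd); exact: phi_lowz.
have Ws M : (W `\` slice) M -> (W' `\` slice) (phi M).
  by move=> [h1 h2]; split; [exact: WW' | move/sl].
apply/(incl_square (D1 := tube W1) (G1 := tube W1 `\` slice) (D1' := tube W')
  (G1' := tube W' `\` slice)) => //.
- by move=> M /tube_sub /W1W.
- by move=> M [/tube_sub /W1W h1 h2].
- exact: tube_sub.
- exact: tl.
- by move=> M [hM nM]; split; [exact: TT' | move/sl].
- exact: exc.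
- exact: exc.
rewrite !(lowz_slice kd); apply: lowz_iso => // Nk.
apply/(incl_square (D1 := W1 `&` slice) (G1 := set0) (D1' := W' `&` slice) (G1' := set0)) => //.
- by rewrite -(tube_slice kd n oW1) => M [].
- by rewrite -(tube_slice kd n oW') => M [].
- by move=> M [[h1 _] h2]; split; [exact: WW' | exact: slice_phi].
- exact: def.
- exact: def.
by rewrite sW1; exact: h.
Qed.

End SliceMap.

(** * Common roots of polynomial tuples *)

Section PolynomialTuples.
Variables (R : realType) (K : numFieldType) (kd : kdata R K) (m n : nat).
Local Notation emb := (kemb kd).
Implicit Types (d k : nat) (t : R) (ts : seq R) (F : 'I_m -> {poly K}).

Lemma coef_rowpoly d (M : 'M[K]_(m, d)) i (j : 'I_d) : (rowpoly M i)`_j = M i j.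
Proof.
rewrite /rowpoly coefD coefXn (ltn_eqF (ltn_ord j)) add0r coef_sum (bigD1 j) //=.
rewrite coefCM coefXn eqxx mulr1 big1 ?addr0 // => x xj.
by rewrite coefCM coefXn (inj_eq val_inj) eq_sym (negPf xj) mulr0.
Qed.

Lemma coef_rowpoly_ge d (M : 'M[K]_(m, d)) i j : (d <= j)%N ->
  (rowpoly M i)`_j = (j == d)%:R.
Proof.
move=> dj; rewrite /rowpoly coefD coefXn coef_sum big1 ?addr0 // => x _.
by rewrite coefCM coefXn gtn_eqF ?mulr0 // (leq_trans (ltn_ord x)).
Qed.

Lemma size_rowpoly d (M : 'M[K]_(m, d)) i : size (rowpoly M i) = d.+1.
Proof.
apply/eqP; rewrite eqn_leq; apply/andP; split.
  by apply/leq_sizeP => j dj; rewrite coef_rowpoly_ge ?gtn_eqF // ltnW.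
by rewrite ltnNge; apply/negP => /leq_sizeP /(_ d (leqnn d)) /eqP; rewrite coef_rowpoly_ge // eqxx oner_eq0.
Qed.

Lemma monic_rowpoly d (M : 'M[K]_(m, d)) i : rowpoly M i \is monic.
Proof. by rewrite monicE lead_coefE size_rowpoly coef_rowpoly_ge ?eqxx. Qed.

Lemma rowpoly_inj d (M N : 'M[K]_(m, d)) : (forall i, rowpoly M i = rowpoly N i) -> M = N.
Proof. by move=> h; apply/matrixP => i j; rewrite -!coef_rowpoly h. Qed.

Definition ofpoly d F : 'M[K]_(m, d) := \matrix_(i, j) (F i)`_j.

Lemma rowpoly_ofpoly d F i : F i \is monic -> size (F i) = d.+1 -> rowpoly (ofpoly d F) i = F i.
Proof.
move=> mF sF; apply/polyP => j; have [jd|dj] := ltnP j d.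
  by rewrite -[j]/(val (Ordinal jd)) coef_rowpoly mxE.
rewrite coef_rowpoly_ge //; case: eqP => [->|/eqP jd].
  by move/monicP: mF; rewrite lead_coefE sF.
by rewrite nth_default // sF ltn_neqAle eq_sym jd.
Qed.

Definition rootpoly ts : {poly K} := \prod_(a <- map emb ts) ('X - a%:P).

(* ts is a multiset of real roots counted with multiplicity n, common to F. *)
Definition nroots F ts := forall i, rootpoly ts ^+ n %| F i.

Lemma rootpoly_cons t ts : rootpoly (t :: ts) = ('X - (emb t)%:P) * rootpoly ts.
Proof. by rewrite /rootpoly big_cons. Qed.

Lemma rootpoly1 t : rootpoly [:: t] = 'X - (emb t)%:P.
Proof. by rewrite rootpoly_cons /rootpoly big_nil mulr1. Qed.

Lemma rootpoly_perm ts ts' : perm_eq ts ts' -> rootpoly ts = rootpoly ts'.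
Proof. by move=> h; apply: perm_big; exact: perm_map. Qed.

Lemma root_rootpoly ts t : root (rootpoly ts) (emb t) = (t \in ts).
Proof. by rewrite root_prod_XsubC mem_map //; exact: fmorph_inj. Qed.

Lemma nroots_perm F ts ts' : perm_eq ts ts' -> nroots F ts -> nroots F ts'.
Proof. by move=> /rootpoly_perm h hF i; rewrite -h. Qed.

Lemma nroots_nil F : nroots F [::].
Proof. by move=> i; rewrite /rootpoly big_nil expr1n dvd1p. Qed.

Lemma nroots_behead F t ts : nroots F (t :: ts) -> nroots F ts.
Proof.
by move=> h i; apply: dvdp_trans (h i); rewrite rootpoly_cons exprMn dvdp_mull.
Qed.

Lemma nroots_head F t ts : nroots F (t :: ts) -> nroots F [:: t].
Proof.
by move=> h i; apply: dvdp_trans (h i); rewrite rootpoly1 rootpoly_cons exprMn dvdp_mulr.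
Qed.

Lemma nroots_mem F t ts : t \in ts -> nroots F ts -> nroots F [:: t].
Proof. by move=> /perm_to_rem h /(nroots_perm h) /nroots_head. Qed.

Lemma coprime_rootpoly t ts : t \notin ts ->
  coprimep (('X - (emb t)%:P) ^+ n) (rootpoly ts ^+ n).
Proof.
move=> h; apply: coprimep_expl; apply: coprimep_expr.
by rewrite coprimep_sym coprimep_XsubC root_rootpoly.
Qed.

Lemma nroots_cons_notin F t ts : t \notin ts ->
  nroots F [:: t] -> nroots F ts -> nroots F (t :: ts).
Proof.
move=> tts h h' i; rewrite rootpoly_cons exprMn Gauss_dvdp ?coprime_rootpoly //.
by rewrite h' andbT -rootpoly1.
Qed.

Lemma nroots_root F t i : (0 < n)%N -> nroots F [:: t] -> root (F i) (emb t).
Proof.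
move=> n0 h; rewrite -dvdp_XsubCl; apply: dvdp_trans (h i).
by rewrite rootpoly1 -{1}['X - _]expr1 dvdp_exp2l.
Qed.

Lemma emb_rootbound d (M : 'M[K]_(m, d)) :
  rootbound M = emb (1 + \sum_i \sum_j knrm kd (M i j)).
Proof.
rewrite /rootbound rmorphD rmorph1 rmorph_sum; congr (_ + _); apply: eq_bigr => i _.
by rewrite rmorph_sum; apply: eq_bigr => j _; rewrite /= knrmE.
Qed.

Definition rbound d (M : 'M[K]_(m, d)) : R := 1 + \sum_i \sum_j knrm kd (M i j).

Lemma rbound_ge1 d (M : 'M[K]_(m, d)) : 1 <= rbound M.
Proof. by rewrite lerDl; do 2!apply: sumr_ge0 => ? _; exact: nrm_ge0. Qed.

(** Cauchy's estimate: a root with modulus at least [rbound M], hence at least 1, would have its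
    leading term exceed the sum of the others. *)
Lemma root_bound d (M : 'M[K]_(m, d)) i t : root (rowpoly M i) (emb t) -> `|t| < rbound M.
Proof.
move=> /rootP; rewrite /rowpoly hornerD hornerXn horner_sum => e.
rewrite ltNge; apply/negP => hB.
have t1 : 1 <= `|t| := le_trans (rbound_ge1 M) hB.
have e2 : `|t| ^+ d = knrm kd (\sum_(j < d) M i j * emb t ^+ j).
  have -> : \sum_(j < d) M i j * emb t ^+ j = - emb (t ^+ d).
    rewrite rmorphXn; apply/eqP; rewrite -addr_eq0 addrC -{2}e; apply/eqP; congr (_ + _).
    by apply: eq_bigr => j _; rewrite hornerM hornerC hornerXn.
  by rewrite nrmN nrm_emb normrX.
case: d M i e e2 hB => [|d] M i e e2 hB.
  by move: e2; rewrite big_ord0 nrm0 expr0 => /eqP; rewrite oner_eq0.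
have : `|t| ^+ d.+1 <= (rbound M - 1) * `|t| ^+ d.
  rewrite e2 /rbound addrC addKr.
  have sumle : knrm kd (\sum_(j < d.+1) M i j * emb t ^+ j) <=
      \sum_(j < d.+1) knrm kd (M i j) * `|t| ^+ d.
    apply: (big_ind2 (fun x y => knrm kd x <= y)).
    - by rewrite nrm0.
    - move=> x1 x2 y1 y2 h1 h2; apply: le_trans (nrmD kd _ _) _; exact: lerD.
    - move=> j _; rewrite nrmM -rmorphXn nrm_emb normrX; apply: ler_wpM2l; first exact: nrm_ge0.
      by apply: ler_weXn2l => //; rewrite -ltnS.
  apply: le_trans sumle _; rewrite -mulr_suml; apply: ler_wpM2r.
    by rewrite exprn_ge0.
  rewrite (bigD1 i) //= lerDl; do 2!apply: sumr_ge0 => ? _; exact: nrm_ge0.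
rewrite exprS leNgt => /negP; apply; rewrite ltr_pM2r ?exprn_gt0 ?(lt_le_trans ltr01) //.
by apply: lt_le_trans hB; rewrite ltrBlDr ltrDl.
Qed.

Lemma nroots_bound d (M : 'M[K]_(m, d)) ts t : (0 < m)%N -> (0 < n)%N ->
  nroots (rowpoly M) ts -> t \in ts -> `|t| < rbound M.
Proof.
move=> m0 n0 h tts; apply: (@root_bound _ _ (Ordinal m0)).
by apply: nroots_root => //; exact: nroots_mem h.
Qed.

End PolynomialTuples.

(** * Limits of polynomials with prescribed roots *)

Section Limits.
Variables (K : numFieldType) (T : Type) (F : set_system T).
Hypothesis FF : ProperFilter F.

Lemma cvg_uniq (f : T -> K) (a b : K) : f @ F --> a -> f @ F --> b -> a = b.
Proof. by move=> h1 h2; apply: cvg_unique h1 h2; exact: norm_hausdorff. Qed.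

(** Division by a linear factor determines the coefficients of the quotient from the top down, by
    [rec], as continuous functions of [p] and [r]. The limits follow by descending induction from
    [D]. *)
Lemma quotient_cvg D (p q : T -> {poly K}) (r : T -> K) (p0 : {poly K}) (r0 : K) :
  (forall x, p x = q x * ('X - (r x)%:P)) -> (forall x, size (q x) <= D)%N ->
  (forall j, (p x)`_j @[x --> F] --> p0`_j) -> r @ F --> r0 ->
  exists q0 : {poly K}, [/\ forall j, (q x)`_j @[x --> F] --> q0`_j,
    p0 = q0 * ('X - r0%:P) & (size q0 <= D)%N].
Proof.
move=> epq sq cp cr.
have rec x j : (q x)`_j = (p x)`_j.+1 + r x * (q x)`_j.+1.
  by rewrite epq mulrBr coefB coefMX coefMC /= mulrC subrK.
have low x : (p x)`_0 = - (r x * (q x)`_0).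
  by rewrite epq mulrBr coefB coefMX coefMC /= sub0r mulrC.
have [L hL] : exists L : nat -> K, forall j, (q x)`_j @[x --> F] --> L j.
  suff h j : exists l : K, (q x)`_j @[x --> F] --> l by have [L hL] := choice h; exists L.
  have [jD|] := leqP D j.
    exists 0; rewrite (_ : (fun _ => _) = fun=> 0); first exact: cvg_cst.
    by apply: funext => x; rewrite nth_default // (leq_trans (sq x)).
  move=> /ltnW /subnKC; move: (D - j)%N => e; elim: e j => [|e IH] j ej.
    exists 0; rewrite (_ : (fun _ => _) = fun=> 0); first exact: cvg_cst.
    by apply: funext => x; rewrite nth_default // (leq_trans (sq x)) // -ej addn0.
  have [l hl] := IH j.+1 (etrans (addSnnS j e) ej).
  exists (p0`_j.+1 + r0 * l); under eq_fun do rewrite rec.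
  by apply: cvgD; [exact: cp | exact: cvgM].
have L0 j : (D <= j)%N -> L j = 0.
  move=> Dj; apply: (cvg_uniq (hL j)); rewrite (_ : (fun _ => _) = fun=> 0); first exact: cvg_cst.
  by apply: funext => x; rewrite nth_default // (leq_trans (sq x)).
have cq j : (\poly_(j < D) L j)`_j = L j.
  by rewrite coef_poly; case: ltnP => // /L0 ->.
exists (\poly_(j < D) L j); split; last exact: size_poly.
  by move=> j; rewrite cq; exact: hL.
apply/polyP => j; rewrite mulrBr coefB coefMX coefMC; case: j => [|j] /=.
  rewrite sub0r cq; apply: (cvg_uniq (cp 0%N)).
  under eq_fun do rewrite low; apply: cvgN; rewrite mulrC; exact: cvgM.
rewrite !cq; apply: (cvg_uniq (cp j.+1)).
rewrite (_ : (fun _ => _) = fun x => (q x)`_j - r x * (q x)`_j.+1).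
  by apply: cvgB; [exact: hL | rewrite mulrC; exact: cvgM].
by apply: funext => x; rewrite rec addrK.
Qed.

(** The factors are divided out one at a time, so roots that collide in the limit keep their total
    multiplicity. *)
Lemma dvdp_cvg D (rs : seq ((T -> K) * K)) (p : T -> {poly K}) (p0 : {poly K}) :
  (forall r, r \in rs -> r.1 @ F --> r.2) ->
  (forall x, \prod_(r <- rs) ('X - (r.1 x)%:P) %| p x) -> (forall x, size (p x) <= D)%N ->
  (forall j, (p x)`_j @[x --> F] --> p0`_j) ->
  \prod_(r <- rs) ('X - (r.2)%:P) %| p0.
Proof.
elim: rs p p0 => [|r rs IH] p p0 cr dp sp cp; first by rewrite big_nil dvd1p.
pose q x := p x %/ ('X - (r.1 x)%:P).
have epq x : p x = q x * ('X - (r.1 x)%:P).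
  by rewrite divpK //; apply: dvdp_trans (dp x); rewrite big_cons dvdp_mulr.
have sq x : (size (q x) <= D)%N by apply: leq_trans (leq_divp _ _) (sp x).
have [|q0 [cq -> _]] := quotient_cvg epq sq cp (r0 := r.2).
  by apply: cr; rewrite mem_head.
rewrite big_cons mulrC dvdp_mul //.
apply: (IH q) => // [s hs|x].
  by apply: cr; rewrite inE hs orbT.
by have := dp x; rewrite big_cons epq mulrC dvdp_mul2r ?polyXsubC_eq0.
Qed.

End Limits.

Lemma rbound_cts (R : realType) (K : numFieldType) (kd : kdata R K) m d :
  continuous (@rbound R K kd m d).
Proof.
rewrite (_ : @rbound R K kd m d = fun M => 1 + \sum_i \sum_j knrm kd (M i j)) //.
apply: ctsD; first exact: cts_cst.
apply: cts_sum => i _; apply: cts_sum => j _.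
by apply: (cts_comp (f := knrm kd)); [exact: nrm_cts | exact: coord_continuous].
Qed.

Section ClosedRoots.
Variables (R : realType) (K : numFieldType) (kd : kdata R K) (m n d k : nat).
Local Notation emb := (kemb kd).
Local Notation nroots := (nroots kd n).

(** Near [M0] the roots are bounded by a continuous function, so they have limits along an
    ultrafilter; these stay in the closed sets [I l] and remain common roots by [dvdp_cvg]. *)
Lemma closed_nroots (I : nat -> set R) : (0 < m)%N -> (0 < n)%N ->
  (forall l, closed (I l)) ->
  closed [set M : 'M[K]_(m, d) | exists f : nat -> R,
     (forall l, (l < k)%N -> I l (f l)) /\ nroots (rowpoly M) (mkseq f k)].
Proof.
move=> m0 n0 cI; set Z := [set M | _] => M0 cM0.
pose T := {M : 'M[K]_(m, d) | Z M}.
(* The neighbourhoods of [M0], traced on the set whose closure is studied. *)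
pose F0 : set_system T := filter_from (nbhs M0) (fun B => [set x | B (sval x)]).
have F0F : ProperFilter F0.
  apply: filter_from_proper; last first.
    by move=> B /cM0 [M [ZM BM]]; exists (exist _ M ZM).
  apply: filter_from_filter; first by exists setT; exact: filterT.
  by move=> A B hA hB; exists (A `&` B); first exact: filterI.
(* An ultrafilter makes all [k] root functions converge at once, with no successive extraction. *)
have [U [UU F0U]] := ultraFilterLemma F0F.
have UF : ProperFilter U := @ultra_proper _ _ UU.
pose v (x : T) : 'M[K]_(m, d) := sval x.
have cval : v @ U --> M0.
  by move=> B hB; apply: F0U; exists B.
have [f hf] : exists f : T -> nat -> R, forall x, (forall l, (l < k)%N -> I l (f x l)) /\
    nroots (rowpoly (v x)) (mkseq (f x) k).
  have h (x : T) : exists g : nat -> R, (forall l, (l < k)%N -> I l (g l)) /\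
      nroots (rowpoly (v x)) (mkseq g k) := svalP x.
  by have [f hf] := choice h; exists f.
have cnt i j : (v x) i j @[x --> U] --> M0 i j.
  exact: (cvg_comp _ _ cval (@coord_continuous K m d i j M0)).
have cbound : rbound kd (v x) @[x --> U] --> rbound kd M0.
  suff c : continuous (rbound kd (m := m) (d := d)) by exact: (cvg_comp _ _ cval (c M0)).
  exact: rbound_cts.
pose B := rbound kd M0 + 1.
have Ubound : U [set x | rbound kd (v x) < B].
  have nb : nbhs (rbound kd M0) [set y : R | y < B].
    by apply: open_nbhs_nbhs; split; [exact: open_lt | rewrite /= ltrDl].
  exact: (cbound _ nb).
have [g hg] : exists g : nat -> R, forall l, (l < k)%N ->
    I l (g l) /\ f x l @[x --> U] --> g l.
  suff h l : exists y : R, (l < k)%N -> I l y /\ f x l @[x --> U] --> y.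
    by have [g hg] := choice h; exists g.
  have [lk|kl] := ltnP l k; last by exists 0.
  have cK : compact (`[- B, B]%classic `&` I l).
    by apply: compact_closedI; [exact: segment_compact | exact: cI].
  have UfK : (f x l @[x --> U]) (`[- B, B]%classic `&` I l).
    rewrite /= nbhs_filterE /=; apply: filterS Ubound => x xB /=; split; last exact: (hf x).1.
    rewrite in_itv /= -ler_norml; apply: ltW; apply: lt_trans xB.
    by apply: nroots_bound (hf x).2 _ => //; apply: map_f; rewrite mem_iota.
  have [y [[_ Iy] cly]] := cK _ _ UfK.
  exists y => _; split=> // V hV.
  have [//|hC] := in_ultra_setVsetC (f^~ l @^-1` V) UU.
  have [z [zV zC]] := cly (~` V) V hC hV.
  by [].
exists g; split; first by move=> l /hg [].
move=> i.
(* Each root function is listed [n] times, to turn an n-th power into a product of linear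
   factors. *)
pose rs := flatten [seq nseq n (fun x : T => emb (f x l), emb (g l)) | l <- iota 0 k].
have prodE (h : ((T -> K) * K) -> {poly K}) :
    \prod_(r <- rs) h r = (\prod_(l <- iota 0 k) h (fun x : T => emb (f x l), emb (g l))) ^+ n.
  rewrite /rs big_flatten big_map -prodrXl; apply: eq_bigr => l _.
  by rewrite big_nseq; elim: (n) => [|n' IHn] /=; rewrite ?expr0 // exprS IHn.
have -> : rootpoly kd (mkseq g k) ^+ n = \prod_(r <- rs) ('X - (r.2)%:P).
  by rewrite prodE /rootpoly big_map /mkseq big_map.
apply: (@dvdp_cvg K T U UF d.+1 rs (fun x => rowpoly (v x) i)).
- move=> r /flatten_mapP [l]; rewrite mem_iota /= => lk /nseqP [-> _] /=.
  by apply: (cvg_comp _ _ (hg l lk).2); exact: emb_cts.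
- move=> x; rewrite prodE; have := (hf x).2 i.
  by rewrite /rootpoly /mkseq !big_map.
- by move=> x; rewrite size_rowpoly.
- move=> j; have [jd|dj] := ltnP j d.
    rewrite -[j]/(val (Ordinal jd)) coef_rowpoly.
    by under eq_fun do rewrite coef_rowpoly; exact: cnt.
  rewrite coef_rowpoly_ge //; under eq_fun do rewrite coef_rowpoly_ge //.
  exact: cvg_cst.
Qed.

End ClosedRoots.

(** * The filtration by the number of common real roots *)

Section RootSpaces.
Variables (R : realType) (K : numFieldType) (kd : kdata R K) (m n : nat).
Local Notation emb := (kemb kd).
Local Notation nroots := (nroots kd n).
Local Notation rbound := (@rbound R K kd m _).
Implicit Types (d k : nat) (t : R) (ts : seq R).

(* U_k of the header: a common real root of multiplicity e counts e %/ n times. *)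
Definition atmost k d : set 'M[K]_(m, d) :=
  [set M | ~ exists ts, size ts = k.+1 /\ nroots (rowpoly M) ts].

Definition nonneg_roots k d : set 'M[K]_(m, d) :=
  [set M | exists ts, [/\ size ts = k, forall t, t \in ts -> 0 <= t & nroots (rowpoly M) ts]].

Definition nonpos_root k d : set 'M[K]_(m, d) :=
  [set M | exists t ts, [/\ size ts = k, t <= 0 & nroots (rowpoly M) (t :: ts)]].

Arguments atmost k d : clear implicits.
Arguments nonneg_roots k d : clear implicits.
Arguments nonpos_root k d : clear implicits.

(** G- and, below, G+ of the overview. Each removes a closed condition on multisets of [k.+1] roots
    from an open set: all members nonnegative, respectively some member not positive. *)
Definition notright k d := atmost k.+1 d `\` nonneg_roots k.+1 d.
Definition notleft k d := atmost k.+1 d `\` nonpos_root k d.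

Arguments notright k d : clear implicits.
Arguments notleft k d : clear implicits.

Hypotheses (m0 : (0 < m)%N) (n0 : (0 < n)%N).

Lemma open_atmost k d : open (atmost k d).
Proof.
rewrite (_ : atmost k d = ~` [set M | exists f : nat -> R,
    (forall l, (l < k.+1)%N -> setT (f l)) /\ nroots (rowpoly M) (mkseq f k.+1)]).
  by apply: closed_openC; apply: (closed_nroots (I := fun=> setT)) => // _; exact: closedT.
apply/seteqP; split=> M hM; apply: contra_not hM.
  by move=> [f [_ h]]; exists (mkseq f k.+1); rewrite size_mkseq.
by move=> [ts [<- h]]; exists (nth 0 ts); rewrite mkseq_nth.
Qed.

Lemma closed_nonneg_roots k d : closed (nonneg_roots k d).
Proof.
rewrite (_ : nonneg_roots k d = [set M | exists f : nat -> R,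
    (forall l, (l < k)%N -> [set x : R | 0 <= x] (f l)) /\ nroots (rowpoly M) (mkseq f k)]).
  by apply: (closed_nroots (I := fun=> [set x : R | 0 <= x])) => // _; exact: closed_ge.
apply/seteqP; split=> M.
  move=> [ts [<- h h']]; exists (nth 0 ts); rewrite mkseq_nth; split=> // l hl.
  by apply: h; exact: mem_nth.
move=> [f [h h']]; exists (mkseq f k); rewrite size_mkseq; split=> // t.
by move=> /mapP [l]; rewrite mem_iota => lk ->; exact: h.
Qed.

Lemma closed_nonpos_root k d : closed (nonpos_root k d).
Proof.
rewrite (_ : nonpos_root k d = [set M | exists f : nat -> R,
    (forall l, (l < k.+1)%N -> (if l is 0 then [set x : R | x <= 0] else setT) (f l)) /\
    nroots (rowpoly M) (mkseq f k.+1)]).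
  apply: (closed_nroots (I := fun l => if l is 0 then [set x : R | x <= 0] else setT)) => //.
  by move=> [|l]; [exact: closed_le | exact: closedT].
apply/seteqP; split=> M.
  move=> [t [ts [<- h h']]]; exists (nth 0 (t :: ts)).
  by rewrite -[(size ts).+1]/(size (t :: ts)) mkseq_nth; split=> // -[|l].
move=> [f [h h']]; exists (f 0%N), (mkseq (f \o S) k); rewrite size_mkseq; split=> //.
  exact: (h 0%N).
suff -> : f 0%N :: mkseq (f \o S) k = mkseq f k.+1 by [].
by rewrite /mkseq /= (iotaDl 1 0 k) -map_comp.
Qed.

Lemma open_notright k d : open (notright k d).
Proof. by apply: openI; [exact: open_atmost | apply: closed_openC; exact: closed_nonneg_roots]. Qed.

Lemma open_notleft k d : open (notleft k d).
Proof. by apply: openI; [exact: open_atmost | apply: closed_openC; exact: closed_nonpos_root]. Qed.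

Lemma atmostS k d : atmost k d `<=` atmost k.+1 d.
Proof.
move=> M hM [[|t ts] [] // [sz] h]; apply: hM; exists ts; split=> //; exact: nroots_behead h.
Qed.

(** A multiset of [k.+1] roots either is entirely nonnegative or has a negative member, so it is
    excluded on one of the two sides. *)
Lemma notright_notleft k d : notright k d `&` notleft k d = atmost k d.
Proof.
apply/seteqP; split=> M.
  move=> [[UM nr] [_ nl]] [ts [sz h]].
  have [hall|/existsNP [t /not_implyP [tts /negP]]] := pselect (forall t, t \in ts -> 0 <= t).
    by apply: nr; exists ts.
  rewrite -ltNge => t0; apply: nl; exists t, (rem t ts).
  rewrite size_rem // sz; split=> //; first exact: ltW.
  by apply: nroots_perm h; exact: perm_to_rem.
move=> UM; have UM' := atmostS UM; split; split=> //.
  by move=> [ts [sz _ h]]; apply: UM; exists ts.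
by move=> [t [ts [sz _ h]]]; apply: UM; exists (t :: ts); rewrite /= sz.
Qed.

Section Shift.
Variable d : nat.
Implicit Types M : 'M[K]_(m, d).

(** The substitution moves every root by [- t]. *)
Definition shift t M : 'M[K]_(m, d) :=
  ofpoly d (fun i => rowpoly M i \Po ('X + (emb t)%:P)).

Lemma rowpoly_shift t M i : rowpoly (shift t M) i = rowpoly M i \Po ('X + (emb t)%:P).
Proof.
rewrite rowpoly_ofpoly //; last by rewrite size_comp_poly2 ?size_rowpoly // size_XaddC.
rewrite monicE lead_coef_comp ?size_XaddC // (monicP (monic_rowpoly M i)).
by rewrite lead_coefXaddC expr1n mulr1.
Qed.

Lemma compXK (c : K) (p : {poly K}) : (p \Po ('X + c%:P)) \Po ('X - c%:P) = p.
Proof.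
by rewrite -comp_polyA comp_polyD comp_polyX comp_polyC subrK comp_polyXr.
Qed.

Lemma rootpoly_shift t ts : rootpoly kd (map (+%R^~ t) ts) \Po ('X + (emb t)%:P) = rootpoly kd ts.
Proof.
rewrite /rootpoly !big_map rmorph_prod; apply: eq_bigr => x _.
by rewrite /= comp_polyB comp_polyX comp_polyC rmorphD polyCD opprD addrA addrAC addrK.
Qed.

Lemma nroots_shift t M ts : nroots (rowpoly (shift t M)) ts <->
  nroots (rowpoly M) (map (+%R^~ t) ts).
Proof.
split=> h i.
  have := dvdp_comp_poly ('X - (emb t)%:P) (h i).
  by rewrite rowpoly_shift compXK -(rootpoly_shift t) -rmorphXn /= compXK.
have := dvdp_comp_poly ('X + (emb t)%:P) (h i).
by rewrite rowpoly_shift rmorphXn /= rootpoly_shift.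
Qed.

Lemma shift0 M : shift 0 M = M.
Proof. by apply: rowpoly_inj => i; rewrite rowpoly_shift rmorph0 addr0 comp_polyXr. Qed.

Lemma coef_rowpoly_cts i j : continuous (fun M => (rowpoly M i)`_j).
Proof.
have [jd|dj] := ltnP j d.
  rewrite (_ : (fun _ => _) = fun M => M i (Ordinal jd)); first exact: coord_continuous.
  by apply: funext => M; rewrite -coef_rowpoly.
by under eq_fun do rewrite coef_rowpoly_ge //; exact: cts_cst.
Qed.

Lemma coef_XaddC_exp_cts l j : continuous (fun c : K => (('X + c%:P) ^+ l)`_j).
Proof.
elim: l j => [|l IH] j; first by under eq_fun do rewrite expr0; exact: cts_cst.
rewrite (_ : (fun _ => _) = fun c : K => (if (j == 0)%N then 0 else (('X + c%:P) ^+ l)`_j.-1)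
    + c * (('X + c%:P) ^+ l)`_j).
  apply: ctsD; first by case: (j == 0)%N; [exact: cts_cst | exact: IH].
  by apply: ctsM; [exact: cts_id | exact: IH].
by apply: funext => c; rewrite exprS mulrDl coefD coefXM coefCM.
Qed.

Lemma shift_cts (f : R * 'M[K]_(m, d) -> R) : continuous f ->
  continuous (fun p : R * 'M[K]_(m, d) => shift (f p) p.2).
Proof.
move=> cf; apply: cts_mx => i j; under eq_fun do rewrite mxE coef_comp_poly size_rowpoly.
apply: cts_sum => l _; apply: ctsM.
  by apply: (cts_comp (f := fun M : 'M[K]_(m, d) => (rowpoly M i)`_l)); [exact: coef_rowpoly_cts | exact: cts_snd].
apply: (cts_comp (f := fun c : K => (('X + c%:P) ^+ l)`_j)); first exact: coef_XaddC_exp_cts.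
by apply: cts_comp; [exact: emb_cts | exact: cf].
Qed.

Lemma atmost_shift k t M : atmost k d M -> atmost k d (shift t M).
Proof.
by move=> hM [ts [sz /nroots_shift h]]; apply: hM; exists (map (+%R^~ t) ts); rewrite size_map.
Qed.

Lemma scaled_bound_cts : continuous (fun p : R * 'M[K]_(m, d) => p.1 * rbound p.2).
Proof.
apply: ctsM; first exact: cts_fst.
by apply: (cts_comp (f := rbound)); [exact: rbound_cts | exact: cts_snd].
Qed.

(** Moving the roots left never creates nonnegative ones, and a move by [rbound M], which exceeds
    their moduli, makes all of them negative. *)
Lemma acyc_notright k : acyc R (atmost k.+1 d) (notright k d).
Proof.
apply: (homotopy_acyc (h := fun s M => shift (s * rbound M) M)).
- by apply: (shift_cts (f := fun p => p.1 * rbound p.2)); exact: scaled_bound_cts.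
- by move=> M; rewrite mul0r shift0.
- by move=> s M _; exact: atmost_shift.
- move=> s M /andP [s0 _] [UM nM]; split; first exact: atmost_shift.
  apply: contra_not nM => -[ts [sz h /nroots_shift h']].
  exists (map (+%R^~ (s * rbound M)) ts); rewrite size_map; split=> // _ /mapP [t tts ->].
  by apply: addr_ge0; [exact: h | apply: mulr_ge0 => //; exact: le_trans ler01 (rbound_ge1 kd M)].
- move=> M UM; split; first exact: atmost_shift.
  rewrite mul1r => -[[|t ts] [] // _ h /nroots_shift h'].
  have := nroots_bound m0 n0 h' (mem_head _ _); have t0 := h t (mem_head _ _).
  by rewrite ltr_norml => /andP [_]; rewrite gtrDr ltNge t0.
Qed.

Lemma acyc_notleft k : acyc R (atmost k.+1 d) (notleft k d).
Proof.
apply: (homotopy_acyc (h := fun s M => shift (- (s * rbound M)) M)).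
- apply: (shift_cts (f := fun p => - (p.1 * rbound p.2))); apply: ctsN; exact: scaled_bound_cts.
- by move=> M; rewrite mul0r oppr0 shift0.
- by move=> s M _; exact: atmost_shift.
- move=> s M /andP [s0 _] [UM nM]; split; first exact: atmost_shift.
  apply: contra_not nM => -[t [ts [sz h /nroots_shift h']]].
  exists (t - s * rbound M), (map (+%R^~ (- (s * rbound M))) ts); rewrite size_map; split=> //.
  rewrite subr_le0; apply: le_trans h _; apply: mulr_ge0 => //.
  exact: le_trans ler01 (rbound_ge1 kd M).
- move=> M UM; split; first exact: atmost_shift.
  rewrite mul1r => -[t [ts [_ h /nroots_shift h']]].
  have := nroots_bound m0 n0 h' (mem_head _ _).
  by rewrite ltr_norml ltrBrDr addNr ltNge h.
Qed.

End Shift.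
End RootSpaces.

(** * Stabilization and multiplication by X^n *)

Section Maps.
Variables (R : realType) (K : numFieldType) (kd : kdata R K) (m n : nat).
Local Notation emb := (kemb kd).
Local Notation nroots := (nroots kd n).
Local Notation rbound := (@rbound R K kd m _).
Local Notation atmost k d := (@atmost R K kd m n k d).
Local Notation nonneg_roots k d := (@nonneg_roots R K kd m n k d).
Local Notation nonpos_root k d := (@nonpos_root R K kd m n k d).
Local Notation notright k d := (@notright R K kd m n k d).
Local Notation notleft k d := (@notleft R K kd m n k d).
Local Notation slice := (@slice K m n _).
Local Notation stab := (stab K m _).
Implicit Types (d k : nat) (t : R) (ts : seq R).
Hypotheses (m0 : (0 < m)%N) (n0 : (0 < n)%N) (mn : (m, n) != (1%N, 1%N)).

Definition newroot d (M : 'M[K]_(m, d)) (i : 'I_m) : R := rbound M + i%:R.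

Lemma rowpoly_stab d (M : 'M[K]_(m, d)) i :
  rowpoly (stab M) i = rowpoly M i * ('X - (emb (newroot M i))%:P).
Proof.
have e : emb (newroot M i) = rootbound M + (i : nat)%:R.
  by rewrite /newroot rmorphD rmorph_nat -emb_rootbound.
rewrite e /stab -[X in rowpoly X]/(ofpoly d.+1 (fun i => rowpoly M i * ('X - (rootbound M + (i : nat)%:R)%:P))).
rewrite rowpoly_ofpoly //; first by rewrite monicMl ?monic_rowpoly ?monicXsubC.
by rewrite size_Mmonic ?monicXsubC ?monic_neq0 ?monic_rowpoly // size_rowpoly size_XsubC addn2.
Qed.

Lemma newroot_ge d (M : 'M[K]_(m, d)) i : rbound M <= newroot M i.
Proof. by rewrite lerDl ler0n. Qed.

Lemma newroot_not_root d (M : 'M[K]_(m, d)) i i' : ~~ root (rowpoly M i) (emb (newroot M i')).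
Proof.
apply/negP => /root_bound; rewrite ltNge => /negP; apply.
exact: le_trans (newroot_ge M i') (ler_norm _).
Qed.

(** Here (m, n) = (1, 1) must be excluded. For [n > 1] the new root is simple in its row; for
    [n = 1] there is another row, whose new root is different. *)
Lemma newroot_notin d (M : 'M[K]_(m, d)) i ts : nroots (rowpoly (stab M)) ts -> newroot M i \notin ts.
Proof.
move=> h; apply/negP => /nroots_mem /(_ h) {}h.
set t := newroot M i in h.
have [n1|n1] := eqVneq n 1%N.
  have m2 : (1 < m)%N.
    by rewrite ltn_neqAle m0 andbT eq_sym; apply: contra mn => /eqP ->; rewrite n1.
  have [i' ii'] : exists i' : 'I_m, i' != i.
    have [i0|i0] := eqVneq (i : nat) 0%N.
      by exists (Ordinal m2); rewrite -val_eqE /= i0.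
    by exists (Ordinal m0); rewrite -val_eqE /= eq_sym.
  have := nroots_root i' n0 h; rewrite rowpoly_stab rootM => /orP [|].
    by apply/negP; exact: newroot_not_root.
  rewrite root_XsubC (inj_eq (fmorph_inj _)) /t /newroot (inj_eq (addrI _)) eqr_nat.
  by rewrite val_eqE eq_sym (negPf ii').
have n2 : (1 < n)%N by rewrite ltn_neqAle eq_sym n1.
have := h i; rewrite rootpoly1 rowpoly_stab -/t -(ltn_predK n2) exprSr.
rewrite dvdp_mul2r ?polyXsubC_eq0 // => hd.
have := newroot_not_root M i i; rewrite -/t -dvdp_XsubCl => /negP; apply.
apply: dvdp_trans hd; rewrite -{1}['X - _]expr1 dvdp_exp2l //.
by rewrite -ltnS (ltn_predK n2).
Qed.

Lemma nroots_stab d (M : 'M[K]_(m, d)) ts : nroots (rowpoly (stab M)) ts <-> nroots (rowpoly M) ts.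
Proof.
split=> h i; last by rewrite rowpoly_stab dvdp_mulr.
have := h i; rewrite rowpoly_stab Gauss_dvdpl //.
apply: coprimep_expl; rewrite coprimep_XsubC root_rootpoly.
exact: newroot_notin.
Qed.

Lemma stab_cts d : continuous (stab : 'M[K]_(m, d) -> _).
Proof.
have cr : continuous (fun M : 'M[K]_(m, d) => rootbound M).
  rewrite (_ : (fun _ => _) = fun M => emb (rbound M)).
    by apply: (cts_comp (f := emb)); [exact: emb_cts | exact: rbound_cts].
  by apply: funext => M; exact: emb_rootbound.
apply: cts_mx => i j.
rewrite (_ : (fun _ => _) = fun M : 'M[K]_(m, d) =>
  (if (j == 0 :> nat)%N then 0 else (rowpoly M i)`_(j.-1)) - (rowpoly M i)`_j * (rootbound M + (i : nat)%:R)).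
  apply: ctsB; first by case: (j == 0 :> nat)%N; [exact: cts_cst | exact: coef_rowpoly_cts].
  by apply: ctsM; [exact: coef_rowpoly_cts | apply: ctsD => //; exact: cts_cst].
by apply: funext => M; rewrite mxE mulrBr coefB coefMX coefMC.
Qed.

Lemma stab_low d (M : 'M[K]_(m, d)) (j : 'I_d) (j' : 'I_d.+1) : j = j' :> nat ->
  (forall i (j2 : 'I_d), (j2 < j)%N -> M i j2 = 0) ->
  forall i, stab M i j' = emb (-1 * newroot M i) * M i j.
Proof.
move=> ej h i; rewrite -coef_rowpoly rowpoly_stab mulrBr coefB coefMX coefMC -ej coef_rowpoly.
rewrite mulN1r rmorphN mulNr mulrC; case: eqP => [_|/eqP j0]; first by rewrite sub0r.
have jl : (j.-1 < j)%N by rewrite prednK // lt0n.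
have jd : (j.-1 < d)%N by apply: ltn_trans jl _.
by rewrite -[j.-1]/(val (Ordinal jd)) coef_rowpoly h // sub0r.
Qed.

Lemma newroot_gt0 d (M : 'M[K]_(m, d)) i : 0 < newroot M i.
Proof. exact: lt_le_trans ltr01 (le_trans (rbound_ge1 kd M) (newroot_ge M i)). Qed.

Lemma atmost_stab k d (M : 'M[K]_(m, d)) : atmost k d M -> atmost k d.+1 (stab M).
Proof. by move=> h [ts [sz /nroots_stab hts]]; apply: h; exists ts. Qed.

Lemma notright_stab k d (M : 'M[K]_(m, d)) : notright k d M -> notright k d.+1 (stab M).
Proof.
move=> [h h']; split; first exact: atmost_stab.
by move=> [ts [sz a /nroots_stab hts]]; apply: h'; exists ts.
Qed.

Lemma notleft_stab k d (M : 'M[K]_(m, d)) : notleft k d M -> notleft k d.+1 (stab M).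
Proof.
move=> [h h']; split; first exact: atmost_stab.
by move=> [t [ts [sz a /nroots_stab hts]]]; apply: h'; exists t, ts.
Qed.

Section MultiplyXn.
Variables (d0 d : nat).
Hypothesis dE : d = (n + d0)%N.

Definition mulXn (M : 'M[K]_(m, d0)) : 'M[K]_(m, d) := ofpoly d (fun i => 'X^n * rowpoly M i).
Definition divXn (M : 'M[K]_(m, d)) : 'M[K]_(m, d0) :=
  \matrix_(i, j) (rowpoly M i)`_(j + n).

Lemma rowpoly_mulXn M i : rowpoly (mulXn M) i = 'X^n * rowpoly M i.
Proof.
rewrite rowpoly_ofpoly // ?monicMl ?monicXn ?monic_rowpoly //.
by rewrite size_Mmonic ?monic_rowpoly ?monic_neq0 ?monicXn // size_polyXn size_rowpoly addnS dE.
Qed.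

Lemma mulXn_cts : continuous mulXn.
Proof.
apply: cts_mx => i j; under eq_fun do rewrite mxE coefXnM.
by case: (j < n)%N; [exact: cts_cst | exact: coef_rowpoly_cts].
Qed.

Lemma divXn_cts : continuous divXn.
Proof. by apply: cts_mx => i j; under eq_fun do rewrite mxE; exact: coef_rowpoly_cts. Qed.

Lemma mulXnK : cancel mulXn divXn.
Proof.
move=> M; apply/matrixP => i j; rewrite mxE rowpoly_mulXn coefXnM.
by rewrite ltnNge leq_addl /= addnK coef_rowpoly.
Qed.

Lemma mulXn_slice M : slice (mulXn M).
Proof. by move=> i j jn; rewrite mxE coefXnM jn. Qed.

Lemma divXnK M : slice M -> mulXn (divXn M) = M.
Proof.
move=> sM; apply/matrixP => i j; rewrite mxE coefXnM; case: ltnP => [jn|nj]; first by rewrite sM.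
have jd : (j - n < d0)%N by rewrite ltn_subLR // -dE.
by rewrite -[(j - n)%N]/(val (Ordinal jd)) coef_rowpoly mxE /= subnK // coef_rowpoly.
Qed.

(** Multiplication by X^n merely shifts the coefficients. The new roots chosen by [stab] are
    therefore the same, and [stab_mulXn] is an equality instead of a homotopy. *)
Lemma rbound_mulXn M : rbound (mulXn M) = rbound M.
Proof.
rewrite /rbound; congr (_ + _); apply: eq_bigr => i _.
rewrite (eq_bigr (fun j : 'I_d => if (j < n)%N then 0 else knrm kd (rowpoly M i)`_(j - n))); last first.
  by move=> j _; rewrite mxE coefXnM; case: ifP => //; rewrite nrm0.
rewrite dE big_split_ord /= big1 ?add0r; last by move=> j _; rewrite ltn_ord.
apply: eq_bigr => j _; by rewrite ltnNge leq_addr /= addKn coef_rowpoly.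
Qed.

Lemma nroots_mulXn0 M ts : nroots (rowpoly (mulXn M)) (0 :: ts) <-> nroots (rowpoly M) ts.
Proof.
have e : rootpoly kd (0 :: ts) ^+ n = 'X^n * rootpoly kd ts ^+ n.
  by rewrite rootpoly_cons rmorph0 subr0 exprMn.
have x0 : ('X^n : {poly K}) != 0 by rewrite -size_poly_eq0 size_polyXn.
by split=> h i; have := h i; rewrite e rowpoly_mulXn dvdp_mul2l.
Qed.

Lemma nroots_mulXn_notin M ts : 0 \notin ts ->
  nroots (rowpoly (mulXn M)) ts -> nroots (rowpoly M) ts.
Proof.
move=> h0 h i; have := h i; rewrite rowpoly_mulXn Gauss_dvdpr //.
by have := coprime_rootpoly kd n h0; rewrite rmorph0 subr0 coprimep_sym.
Qed.

(** A multiset containing 0 loses one copy of it. Otherwise its root polynomial is coprime to X^n,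
    and any member may be dropped. *)
Lemma nroots_mulXn_ex M k : (exists ts, size ts = k.+1 /\ nroots (rowpoly (mulXn M)) ts) <->
  (exists ts, size ts = k /\ nroots (rowpoly M) ts).
Proof.
split=> [[ts [sz h]]|[ts [<- h]]]; last first.
  by exists (0 :: ts); split=> //; apply/nroots_mulXn0.
have [t0|t0] := boolP (0 \in ts).
  exists (rem 0 ts); rewrite size_rem // sz; split=> //.
  by apply/nroots_mulXn0; apply: nroots_perm h; exact: perm_to_rem.
have := nroots_mulXn_notin t0 h; case: ts sz {h t0} => // t ts [sz] h.
by exists ts; split=> //; exact: nroots_behead h.
Qed.

Lemma atmost_mulXn k M : atmost k.+1 d (mulXn M) <-> atmost k d0 M.
Proof. by split; apply: contra_not => /nroots_mulXn_ex. Qed.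

Lemma atmost_slice k : atmost k.+1 d `&` slice = mulXn @` atmost k d0.
Proof.
apply/seteqP; split=> M.
  move=> [UM sM]; exists (divXn M); last exact: divXnK.
  by apply/atmost_mulXn; rewrite divXnK.
by move=> [N UN <-]; split; [exact/atmost_mulXn | exact: mulXn_slice].
Qed.

Lemma notright_or_notleft k : notright k d `|` notleft k d =
  atmost k.+1 d `\` (mulXn @` (atmost k d0 `&` nonneg_roots k d0)).
Proof.
transitivity (atmost k.+1 d `\` (nonneg_roots k.+1 d `&` nonpos_root k d)); first by rewrite setDIr.
apply/seteqP; split=> M [UM h]; split=> //; apply: contra_not h.
  move=> [N [UN [ts [sz a h]]] <-]; split; last by exists 0, ts; split=> //; apply/nroots_mulXn0.
  exists (0 :: ts); split; [by rewrite /= sz| |exact/nroots_mulXn0].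
  by move=> t; rewrite inE => /orP [/eqP ->|/a].
move=> [[ts [sz a h]] [t [ts' [sz' t0 h']]]].
(* Otherwise [t :: ts] would be a multiset of [k.+2] common roots, which [UM] excludes. Being a
   member of [ts], [t] is both nonnegative and nonpositive. *)
have tts : t \in ts.
  apply: contra_notT UM => tts; exists (t :: ts); rewrite /= sz; split=> //.
  by apply: nroots_cons_notin => //; exact: nroots_head h'.
have {}t0 : t = 0 by apply/eqP; rewrite eq_le t0 a.
have sM : slice M.
  move=> i j jn; have := nroots_head h' i.
  rewrite rootpoly1 t0 rmorph0 subr0 -coef_rowpoly => /dvdpP [q ->].
  by rewrite coefMXn jn.
have e := divXnK sM; exists (divXn M) => //; split.
  by apply/atmost_mulXn; rewrite e.
exists (rem t ts); split; first by rewrite size_rem // sz.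
  by move=> u /mem_rem /a.
by apply/nroots_mulXn0; rewrite e -t0; apply: nroots_perm h; exact: perm_to_rem.
Qed.

End MultiplyXn.

Lemma stab_mulXn d0 d (dE : d = (n + d0)%N) (dE' : d.+1 = (n + d0.+1)%N) (M : 'M[K]_(m, d0)) :
  stab (mulXn d M) = mulXn d.+1 (stab M).
Proof.
apply: rowpoly_inj => i; rewrite rowpoly_stab !rowpoly_mulXn // rowpoly_stab mulrA.
by rewrite /newroot rbound_mulXn.
Qed.

End Maps.

(** * Homology isomorphisms from homeomorphisms *)

Section HomologyIsos.
Variable R : realType.
Implicit Types (T U : topologicalType) (k : nat).

Lemma spush_id_on T (A : set T) (f : T -> T) k (z : Ch R T k) :
  (forall x, A x -> f x = x) -> C A z -> spush f z = z.
Proof.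
move=> fA h; rewrite -[RHS]/(idfun z); apply: (eq_ext_gspan _ h) => s hs.
rewrite /= spush_gen -(nsimp_id hs); congr nsimp.
by apply: funext => t /=; apply: fA; case: hs => _ + _; exact.
Qed.

Lemma hiso_id_spush T (D G D' G' : set T) k :
  @hiso (Hrel R D G k) (Hrel R D' G' k) (@spush R T T id k) -> @hiso (Hrel R D G k) (Hrel R D' G' k) id.
Proof.
move=> [inj surj]; split=> [x [Dx Gx]|y cy].
  by have := inj x (conj Dx Gx); rewrite (spush_id Dx).
have [x [Dx Gx] bx] := surj y cy; exists x => //.
by move: bx; rewrite (spush_id Dx).
Qed.

Lemma homeo_iso T U (a : T -> U) (b : U -> T) (A : set T) (B : set U) k :
  continuous a -> continuous b -> (forall x, A x -> B (a x)) -> (forall y, B y -> A (b y)) ->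
  (forall x, A x -> b (a x) = x) -> (forall y, B y -> a (b y) = y) ->
  @hiso (Hrel R A set0 k) (Hrel R B set0 k) (@spush R T U a k).
Proof.
move=> ca cb AB BA ba ab.
have s0 : forall x, set0 x -> set0 (b x) by [].
split=> [x [Ax _] bx|y cy].
  have := hmor_bnd (spush_hmor (D := B) (G := set0) (G' := set0) R k cb BA s0) bx.
  by rewrite /= spush_comp (spush_id_on (A := A)).
exists (spush b y); first exact: hmor_cyc (spush_hmor R k cb BA s0) _ cy.
rewrite spush_comp (spush_id_on (A := B)) //; last by case: cy.
by rewrite subrr; exact: rbnd0.
Qed.

Lemma image_iso T U (a : T -> U) (b : U -> T) (A : set T) k :
  continuous a -> continuous b -> cancel a b ->
  @hiso (Hrel R A set0 k) (Hrel R (a @` A) set0 k) (@spush R T U a k).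
Proof.
move=> ca cb ab; apply: (homeo_iso k ca cb) => [x Ax|_ [x Ax <-]|x _|_ [x _ <-]]; rewrite ?ab //.
Qed.

End HomologyIsos.

(** * The stabilization map *)

Section Assembly.
Variables (R : realType) (K : numFieldType) (kd : kdata R K) (m n : nat).
Local Notation emb := (kemb kd).
Local Notation nroots := (nroots kd n).
Local Notation atmost k d := (@atmost R K kd m n k d).
Local Notation nonneg_roots k d := (@nonneg_roots R K kd m n k d).
Local Notation notright k d := (@notright R K kd m n k d).
Local Notation notleft k d := (@notleft R K kd m n k d).
Local Notation slice := (@slice K m n _).
Local Notation stab := (stab K m).
Local Notation mulXn := (@mulXn K m n _).
Local Notation N := (n * m * kdim kd)%N.
Implicit Types (d k i : nat).
Hypotheses (m0 : (0 < m)%N) (n0 : (0 < n)%N) (mn : (m, n) != (1%N, 1%N)).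

Lemma acyc_point d (M0 : 'M[K]_(m, d)) : acyc R setT [set M0].
Proof.
pose h s (M : 'M[K]_(m, d)) := \matrix_(i, j) (M i j + emb s * (M0 i j - M i j)).
have cc (i : 'I_m) (j : 'I_d) : continuous (fun p : R * 'M[K]_(m, d) => p.2 i j).
  by apply: (cts_comp (f := fun M : 'M[K]_(m, d) => M i j)); [exact: coord_continuous | exact: cts_snd].
apply: (homotopy_acyc (h := h)) => //.
- apply: cts_mx => i j; under eq_fun do rewrite mxE.
  apply: ctsD => //; apply: ctsM; last by apply: ctsB => //; exact: cts_cst.
  by apply: (cts_comp (f := emb)); [exact: emb_cts | exact: cts_fst].
- by move=> M; apply/matrixP => i j; rewrite !mxE rmorph0 mul0r addr0.
- by move=> s _ _ ->; apply/matrixP => i j; rewrite !mxE subrr mulr0 addr0.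
- by move=> M _; apply/matrixP => i j; rewrite !mxE rmorph1 mul1r addrC subrK.
Qed.

(** Both matrix spaces contract to a point, and [f] maps the point 0 to a point. *)
Lemma affine_iso d d' (f : 'M[K]_(m, d) -> 'M[K]_(m, d')) i : continuous f ->
  @hiso (Hrel R setT set0 i) (Hrel R setT set0 i) (@spush R _ _ f i).
Proof.
move=> cf; apply/(incl_square (D1 := [set (0 : 'M[K]_(m, d))]) (G1 := set0) (D1' := [set f 0]) (G1' := set0)) => //.
- by move=> _ ->.
- by apply: triple_iso => //; exact: acyc_point.
- by apply: triple_iso => //; exact: acyc_point.
by apply: (@homeo_iso R _ _ _ (fun _ : 'M[K]_(m, d') => (0 : 'M[K]_(m, d)))) => //; [exact: cts_cst | move=> _ ->].
Qed.

Lemma atmostT k d : (d < n * k.+1)%N -> atmost k d = setT.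
Proof.
move=> dk; apply/seteqP; split=> // M _ [ts [sz h]].
have := dvdp_leq (monic_neq0 (monic_rowpoly M (Ordinal m0))) (h _).
rewrite size_rowpoly; apply/negP; rewrite -ltnNge.
have := size_exp (rootpoly kd ts) n; rewrite {2}/rootpoly size_prod_XsubC size_map sz /= mulnC => e.
by move: e dk; case: (size _) => [|s] /= <-.
Qed.

Lemma atmost_connecting k d i : @isorel (Hrel R (atmost k.+1 d) (atmost k d) i)
  (Hrel R (atmost k.+1 d) (notright k d `|` notleft k d) i.+1)
  (connecting (atmost k.+1 d) (notright k d) (notleft k d) (k := i)).
Proof.
rewrite -[X in Hrel R _ X i](notright_notleft kd m n k d).
apply: (connecting_isorel (O1 := notright k d) (O2 := notleft k d)).
- exact: (@open_notright R K kd m n).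
- exact: (@open_notleft R K kd m n).
- by rewrite setUK.
- by rewrite setUC setUK.
- by move=> M [].
- by move=> M [].
- exact: (acyc_notright m0 n0).
- exact: (acyc_notleft m0 n0).
Qed.

Section OneFactor.
Variables (d0 d : nat).
Hypothesis dE : d = (n + d0)%N.

Lemma mulXn_iso (A : set 'M[K]_(m, d0)) i :
  @hiso (Hrel R A set0 i) (Hrel R (mulXn d @` A) set0 i) (@spush R _ _ (mulXn d) i).
Proof. apply: (image_iso R A i (@mulXn_cts K m n d0 d) (@divXn_cts K m n d0 d)); exact: mulXnK. Qed.

(** Off the slice the union is all of [atmost k.+2 d]. By [slice_iso] for the identity it remains to
    compare the slices, where division by X^n turns the inclusion into that of [notright k d0] in
    [atmost k.+1 d0], an isomorphism by translation. *)
Lemma acyc_notright_or_notleft k :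
  acyc R (atmost k.+2 d) (notright k.+1 d `|` notleft k.+1 d).
Proof.
have nd : (n <= d)%N by rewrite dE leq_addr.
set W := _ `|` _.
have WE := notright_or_notleft kd m dE k.+1; rewrite -/W in WE.
have oW : open W by apply: openU; [exact: (@open_notright R K kd m n) | exact: (@open_notleft R K kd m n)].
have oU : open (atmost k.+2 d) by exact: (@open_atmost R K kd m n).
have WU : W `<=` atmost k.+2 d by rewrite WE => M [].
have sU := atmost_slice kd m dE k.+1.
have sW : W `&` slice = mulXn d @` notright k d0.
  rewrite WE setIDAC setIDA sU; apply/seteqP; split=> M.
    move=> [[L UL <-] h]; exists L => //; split=> // nL.
    by apply: h; exists L.
  move=> [L [UL nL] <-]; split; first by exists L.
  by move=> [L' [_ nL'] /(can_inj (mulXnK dE)) e]; rewrite e in nL'.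
have eD : atmost k.+2 d `\` slice = W `\` slice.
  rewrite WE setDDl; congr (_ `\` _); apply/seteqP; split=> M; first by right.
  by move=> [[L _ <-]|//]; exact: mulXn_slice.
apply: (triple_acyc (E := atmost k.+2 d `\` slice)) => //; first by rewrite eD => M [].
move=> i; apply: hiso_id_spush; rewrite [in X in hiso (H := X)]eD.
apply: (slice_iso (kd := kd) (sg := 1) (lam := fun _ _ => 1)) => //.
- exact: cts_id.
- by left.
- move=> M j j' ej jn _ i0; rewrite mulr1 rmorph1 mul1r; congr (M _ _).
  exact/esym/val_inj.
move=> _; rewrite sW sU.
apply/(map_square (a := mulXn d) (a' := mulXn d) (f1 := id) (D1 := notright k d0) (G1 := set0)
  (D1' := atmost k.+1 d0) (G1' := set0)) => //.
- exact: (@mulXn_cts K m n d0 d).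
- exact: (@mulXn_cts K m n d0 d).
- exact: cts_id.
- exact: cts_id.
- by move=> M [].
- by move=> M [L [UL _] <-]; exists L.
- exact: mulXn_iso.
- exact: mulXn_iso.
apply: hiso_spush_id; apply: triple_iso => //; last exact: (acyc_notright m0 n0).
by move=> M [].
Qed.

Lemma acyc_atmost_add k : acyc R (atmost k.+2 d) (atmost k.+1 d).
Proof.
by move=> i; apply: isorel_zero (atmost_connecting k.+1 d i) _; exact: acyc_notright_or_notleft.
Qed.

(** For k = 0 the empty multiset makes [nonneg_roots 0] everything, so the whole slice is missing
    from the union. *)
Lemma notright_or_notleft0 : notright 0 d `|` notleft 0 d = atmost 1 d `\` slice.
Proof.
rewrite (notright_or_notleft kd m dE) -[RHS]set0U -(setDv (atmost 1 d)) -setDIr (atmost_slice kd m dE); congr (_ `\` (_ @` _)).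
by apply/seteqP; split=> M; [case | move=> h; split=> //; exists [::]; split=> //; exact: nroots_nil].
Qed.

End OneFactor.

Lemma acyc_atmost k d : acyc R (atmost k.+2 d) (atmost k.+1 d).
Proof.
have [dn|nd] := ltnP d n; last by apply: (@acyc_atmost_add (d - n)); rewrite subnKC.
have lt l : (d < n * l.+1)%N by apply: leq_trans dn _; rewrite leq_pmulr.
by rewrite !atmostT // => i z [hz _]; exact: C_rbnd.
Qed.

Lemma atmost1_setT d i : @hiso (Hrel R (atmost 1 d) set0 i) (Hrel R setT set0 i) id.
Proof.
suff h k : @hiso (Hrel R (atmost 1 d) set0 i) (Hrel R (atmost k.+1 d) set0 i) idfun.
  (* The filtration is exhausted here: [d.+2] roots of multiplicity [n] exceed the degree [d]. *)
  have := h d; rewrite (@atmostT d.+1) //.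
  by apply: (@leq_trans d.+2) => //; rewrite leq_pmull.
elim: k => [|k IH].
  by split=> // z cz; exists z => //; rewrite subrr; exact: rbnd0.
have s1 : atmost 1 d `<=` atmost k.+1 d by elim: {IH} k => // k IH M /IH; exact: atmostS.
have s2 : atmost k.+1 d `<=` atmost k.+2 d by exact: atmostS.
have i2 := triple_iso i s2 (@sub0set _ _) (@acyc_atmost k d).
exact: (hiso_comp (id_hmor R i s1 (@subset_refl _ set0)) (id_hmor R i s2 (@subset_refl _ set0)) IH i2).
Qed.

Lemma stab_atmost1 d i : @hiso (Hrel R (atmost 1 d) set0 i) (Hrel R (atmost 1 d.+1) set0 i)
  (@spush R _ _ (stab d) i).
Proof.
have cs : continuous (@Defs.stab K m d) by exact: (@stab_cts R K kd m d).
apply/(incl_square (D2 := setT) (G2 := set0) (D2' := setT) (G2' := set0)) => //.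
- by move=> M; exact: (atmost_stab m0 n0 mn).
- exact: atmost1_setT.
- exact: atmost1_setT.
exact: affine_iso.
Qed.

Lemma stab_pair d0 d j : d = (n + d0)%N ->
  ((N <= j.+1)%N -> @hiso (Hrel R (atmost 0 d0) set0 (j.+1 - N)) (Hrel R (atmost 0 d0.+1) set0 (j.+1 - N))
    (@spush R _ _ (stab d0) (j.+1 - N))) ->
  @hiso (Hrel R (atmost 1 d) (atmost 0 d) j) (Hrel R (atmost 1 d.+1) (atmost 0 d.+1) j)
    (@spush R _ _ (stab d) j).
Proof.
move=> dE h.
have dE' : d.+1 = (n + d0.+1)%N by rewrite dE addnS.
have nd : (n <= d)%N by rewrite dE leq_addr.
have nd' : (n <= d.+1)%N by exact: leqW.
have cs e : continuous (@Defs.stab K m e) by exact: (@stab_cts R K kd m e).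
have oU e : open (atmost 1 e) by exact: (@open_atmost R K kd m n).
have sU e k M := @atmost_stab R K kd m n m0 n0 mn k e M.
have sr e k M := @notright_stab R K kd m n m0 n0 mn k e M.
have sl e k M := @notleft_stab R K kd m n m0 n0 mn k e M.
have mf := spush_hmor R j (cs d) (sU d 1%N) (sU d 0%N).
have sG M : (notright 0 d `|` notleft 0 d) M -> (notright 0 d.+1 `|` notleft 0 d.+1) (stab d M).
  by move=> [/sr|/sl]; [left | right].
have mg := spush_hmor R j.+1 (cs d) (sU d 1%N) sG.
apply/(isorel_transfer (atmost_connecting 0 d j) (atmost_connecting 0 d.+1 j) mf mg).
  move=> x y [x1 [x2 [D1 D2 G1 G2 ->]]]; exists (spush (stab d) x1), (spush (stab d) x2); split.
  - exact: spush_in (cs d) (sU d 1%N) D1.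
  - exact: spush_in (cs d) (sU d 1%N) D2.
  - by rewrite sbd_spush -linearB; exact: spush_in (cs d) (sr d 0%N) G1.
  - by rewrite sbd_spush -linearB; exact: spush_in (cs d) (sl d 0%N) G2.
  - by rewrite /= linearB.
rewrite (notright_or_notleft0 dE) (notright_or_notleft0 dE').
apply: (@slice_iso _ _ kd m n d d.+1 (stab d) (-1) (@newroot R K kd m d) nd nd' (cs d)) => //.
- by right.
- exact: newroot_gt0.
- by move=> M j1 j2 e _; exact: (stab_low kd).
- exact: (sU d 1%N).
move=> hN; rewrite (atmost_slice kd m dE) (atmost_slice kd m dE').
apply/(map_square (a := mulXn d) (a' := mulXn d.+1) (f1 := stab d0) (D1 := atmost 0 d0) (G1 := set0)
  (D1' := atmost 0 d0.+1) (G1' := set0)) => //.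
- exact: (@mulXn_cts K m n d0 d).
- exact: (@mulXn_cts K m n d0.+1 d.+1).
- exact: cs.
- exact: cs.
- exact: (sU d0 0%N).
- move=> _ [M UM <-]; exists (stab d0 M); first exact: (sU d0 0%N).
  by rewrite (stab_mulXn kd dE dE').
- by apply: funext => M; rewrite /= (stab_mulXn kd dE dE').
- exact: mulXn_iso.
- exact: mulXn_iso.
exact: h.
Qed.

(** Vanishing below the codimension comes from [slice_iso] for the inclusion of the empty set: in
    these degrees it asks nothing of the slices, and its source is zero. *)
Lemma pair_low_zero j : (j.+1 < N)%N -> hzero (Hrel R (atmost 1 n) (atmost 0 n) j).
Proof.
move=> jN; apply: isorel_zero (atmost_connecting 0 n j) _.
have dE : n = (n + 0)%N by rewrite addn0.
rewrite (notright_or_notleft0 dE).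
have [] : @hiso (Hrel R set0 (set0 `\` slice) j.+1) (Hrel R (atmost 1 n) (atmost 1 n `\` slice) j.+1)
    (@spush R _ _ id j.+1).
  apply: (slice_iso (kd := kd) (sg := 1) (lam := fun _ _ => 1)) => //.
  - exact: cts_id.
  - by left.
  - move=> M j1 j2 ej _ _ i0; rewrite mulr1 rmorph1 mul1r; congr (M _ _).
    exact/esym/val_inj.
  - exact: (@open_atmost R K kd m n).
  by rewrite leqNgt jN.
move=> _ surj y cy; have [x [/C_set0 -> _] h] := surj y cy.
by move: h; rewrite linear0 sub0r => h; rewrite -(opprK y); exact: bndN.
Qed.

Lemma stab_atmost0 d i : (3 <= N)%N ->
  (d %/ n = d.+1 %/ n)%N \/ (i <= (N - 2) * (d %/ n + 1) - 1)%N ->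
  @hiso (Hrel R (atmost 0 d) set0 i) (Hrel R (atmost 0 d.+1) set0 i) (@spush R _ _ (stab d) i).
Proof.
move=> N3; have [l] := ubnP d; elim: l d i => // l IH d i /ltnSE dl h.
(* While [d.+1 < n] no common n-fold root fits into the degree, and both spaces are full matrix
   spaces. *)
have [dn|] := ltnP d.+1 n.
  by rewrite !atmostT ?muln1 //; [exact: affine_iso (@stab_cts R K kd m d) | exact: ltnW].
move=> nd; have pair : forall j, (i <= j <= i.+1)%N ->
    @hiso (Hrel R (atmost 1 d) (atmost 0 d) j) (Hrel R (atmost 1 d.+1) (atmost 0 d.+1) j)
    (@spush R _ _ (stab d) j).
  move=> j /andP [ij ji].
  (* At [d.+1 = n] the source pair is trivial, and the target pair vanishes in degree [j] because j
     + 1 <= i + 2 < N. *)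
  move: nd; rewrite leq_eqVlt => /orP [/eqP nE|nd].
    apply: hzero_iso; first by exists 0; exact: rcyc0.
      have lt q : (d < n * q.+1)%N by rewrite mulnS nE addSn ltnS leq_addr.
      by rewrite !atmostT // => z [hz _]; exact: C_rbnd.
    have q0 : (d %/ n = 0)%N by rewrite divn_small // nE.
    rewrite -nE; apply: pair_low_zero; move: h.
    rewrite -nE divnn n0 q0 add0n muln1 => -[//|]; lia.
  have [d0 dE] : exists d0, d = (n + d0)%N by exists (d - n)%N; rewrite subnKC.
  have divE c : ((n + c) %/ n = 1 + c %/ n)%N by rewrite -{1}[n]mul1n divnMDl.
  (* Both alternatives descend to [d0]: the two quotients by [n] drop by 1 together, and j + 1 - N
     <= i + 2 - N fits because the bound drops by exactly N - 2. *)
  apply: (stab_pair dE) => Nj; apply: IH; first by rewrite dE in dl; lia.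
  move: h; rewrite dE -addnS !divE => -[e|h]; [left; lia | right].
  set q := (d0 %/ n)%N in h *.
  (* With [3 <= N] this makes the product positive, so subtracting 1 in the bound is not
     truncated. *)
  have q0 : (N - 2 <= (N - 2) * (q + 1))%N by rewrite leq_pmulr // addn1.
  have e : ((N - 2) * (1 + q + 1) = (N - 2) * (q + 1) + (N - 2))%N by rewrite -addnA mulnDr muln1 addnC.
  by move: h q0; rewrite e; move: ((N - 2) * (q + 1))%N => x; lia.
apply: (@pair_iso R _ _ _ (atmost 1 d) _ (atmost 1 d.+1)).
- exact: (@stab_cts R K kd m d).
- by move=> M; exact: (atmost_stab m0 n0 mn).
- by move=> M; exact: (atmost_stab m0 n0 mn).
- exact: atmostS.
- exact: atmostS.
- exact: stab_atmost1.
- by apply: pair; rewrite leqnSn leqnn.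
- by apply: pair; rewrite leqnSn leqnn.
Qed.

End Assembly.

(** * The real and complex scalar fields *)

Section Scalars.
Variable R : realType.

Definition real_kdata : kdata R (R : numFieldType).
Proof.
apply: (@KData R (R : numFieldType) idfun Num.norm 1 (fun=> id) (fun=> 1)) => //.
- by move=> x _; exists x.
- by move=> a b; rewrite !ord1.
- by move=> z /(_ ord0).
Defined.

Definition coordC (a : 'I_2) (z : R[i]) : R := if a == 0 then complex.Re z else complex.Im z.
Definition basisC (a : 'I_2) : R[i] := if a == 0 then 1 else 'i%C.

Lemma coordC_le a z : `|coordC a z| <= Num.sqrt (complex.Re z ^+ 2 + complex.Im z ^+ 2).
Proof.
by rewrite /coordC; case: ifP => _; rewrite -sqrtr_sqr ler_wsqrtr // ?lerDl ?lerDr sqr_ge0.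
Qed.

Definition complex_kdata : kdata R (CC R).
Proof.
apply: (@KData R (CC R) (real_complex R : {rmorphism R -> R[i]})
  (fun z : R[i] => Num.sqrt (complex.Re z ^+ 2 + complex.Im z ^+ 2)) 2 coordC basisC).
- by move=> x xr; exists (complex.Re (x : R[i])); rewrite [RHS]RRe_real.
- by move=> x y; exact: lecR.
- by move=> z; rewrite [RHS]normc_def.
- by move=> a [x y] [x' y']; rewrite /coordC; case: ifP.
- by move=> a t [x y]; rewrite /coordC /=; case: ifP; rewrite !mul0r ?subr0 ?addr0.
- exact: coordC_le.
- by move=> a b; rewrite /coordC /basisC; case: a => [[|[|]]] //= ?; case: b => [[|[|]]] //= ?.
- move=> [x y] h; have := h 0; have := h 1; rewrite /coordC /= => -> ->; exact: erefl.
Defined.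

End Scalars.

Lemma Qspace_atmost (R : realType) (K : numFieldType) (kd : kdata R K) d m n :
  Qspace K d m n = atmost kd n 0 (d := d).
Proof.
apply/seteqP; split=> M; apply: contra_not.
  move=> [[|t [|? ?]] [] // _ h]; exists (kemb kd t); split.
    by rewrite realE -(rmorph0 (kemb kd)) !kemb_le; exact: num_real.
  by move=> i; rewrite -(rootpoly1 kd).
move=> [x [/(kreal kd x) [t ->] h]]; exists [:: t]; split=> // i.
by rewrite rootpoly1.
Qed.

Lemma stab_homology_iso (R : realType) (K : numFieldType) (kd : kdata R K) d m n i :
  (0 < m)%N -> (0 < n)%N -> (m, n) != (1%N, 1%N) -> (3 <= kdim kd * m * n)%N ->
  (d %/ n = d.+1 %/ n)%N \/ (i <= (kdim kd * m * n - 2) * (d %/ n + 1) - 1)%N ->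
  homology_iso R (Qspace K d m n) (Qspace K d.+1 m n) (stab K m d) i.
Proof.
have -> : (kdim kd * m * n = n * m * kdim kd)%N by rewrite mulnC (mulnC (kdim kd)) mulnA.
move=> m0 n0 mn N3 h; rewrite !(Qspace_atmost kd); apply: homology_isoP.
exact: stab_atmost0.
Qed.

(* isC = false : K = R (d(K) = 1);  isC = true : K = C = R[i] (d(K) = 2) *)
Theorem theorem4p3 (R : realType) (isC : bool) (d m n : nat) :
  let K : numFieldType := if isC then CC R else (R : numFieldType) in
  let dK : nat := if isC then 2%N else 1%N in
  (1 <= d)%N -> (1 <= m)%N -> (1 <= n)%N -> (m, n) != (1%N, 1%N) ->
  (3 <= dK * m * n)%N ->
  ((d %/ n = d.+1 %/ n)%N ->
     homology_equivalence R (Qspace K d m n) (Qspace K d.+1 m n)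
       (stab K m d)) /\
  ((d %/ n < d.+1 %/ n)%N ->
     homology_equivalence_through R (Qspace K d m n) (Qspace K d.+1 m n)
       (stab K m d) ((dK * m * n - 2) * (d %/ n + 1) - 1)%N).
Proof.
move=> K dK _ m0 n0 mn N3.
have [kd kdE] : exists kd : kdata R K, kdim kd = dK.
  by rewrite /K /dK; case: isC {K dK N3}; [exists (complex_kdata R) | exists (real_kdata R)].
rewrite -kdE in N3 *.
split=> [e i|_ i hi]; apply: (stab_homology_iso (kd := kd)) => //; first by left.
by right.
Qed.
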